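(* Let $d\geq 1$ and $p\in\big(1,1+\frac{4}{d}\big)$, and let $V:\mathbb{R}^d\to[0,\infty)$ satisfy $V\in L^\infty_{loc}(\mathbb{R}^d)\cap C^\alpha(\mathbb{R}^d)$ for some $\alpha\in(0,1)$, $\inf_{x\in\mathbb{R}^d}V(x)=0$ and $\lim_{|x|\to\infty}V(x)=\infty$. Then: (i) for a.e. $\rho\in(0,\infty)$ there is a number $\mu_\rho\in\mathbb{R}$ such that every minimizer of $e(\rho)$ is a weak solution of $$-\Delta u+V(x)u=\mu_\rho u+\rho^{p-1}u^p\quad\text{in }\mathbb{R}^d,$$ i.e. all minimizers of $e(\rho)$ satisfy this equation with the same Lagrange multiplier $\mu=\mu_\rho$; (ii) for a.e. $\rho\in(0,\infty)$, $G_{\mu_\rho,\rho}=M_\rho$.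
   Context: Let $\mathcal{H}:=\{u\in H^1(\mathbb{R}^d):\int_{\mathbb{R}^d}V|u|^2\,dx<\infty\}$ with norm $\|u\|_{\mathcal H}=\big(\int_{\mathbb{R}^d}(|\nabla u|^2+(1+V)|u|^2)dx\big)^{1/2}$. For $\rho>0$ let $$E_\rho(u):=\frac12\int_{\mathbb{R}^d}|\nabla u|^2dx+\frac12\int_{\mathbb{R}^d}V|u|^2dx-\frac{\rho^{p-1}}{p+1}\int_{\mathbb{R}^d}|u|^{p+1}dx,\qquad e(\rho):=\inf\{E_\rho(u):u\in\mathcal H,\ \|u\|_2^2=1\},$$ and $M_\rho$ the set of minimizers of $e(\rho)$. For $\mu\in\mathbb{R}$ let $$F_{\mu,\rho}(u):=\frac12\int_{\mathbb{R}^d}|\nabla u|^2dx+\frac12\int_{\mathbb{R}^d}(V-\mu)|u|^2dx-\frac{\rho^{p-1}}{p+1}\int_{\mathbb{R}^d}|u|^{p+1}dx,$$ $S_{\mu,\rho}:=\{u\in\mathcal H\setminus\{0\}:\langle F_{\mu,\rho}'(u),\varphi\rangle=0\ \forall\varphi\in\mathcal H\}$ (the nontrivial weak solutions of $-\Delta u+Vu=\mu u+\rho^{p-1}u^p$), and $G_{\mu,\rho}:=\{u\in S_{\mu,\rho}:F_{\mu,\rho}(u)\le F_{\mu,\rho}(v)\ \forall v\in S_{\mu,\rho}\}$ (the set of ground states). *)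

(* Defs.v *)
From HB Require Import structures.
From mathcomp Require Import all_boot all_order all_algebra.
From mathcomp Require Import all_classical all_reals all_analysis.
Set Implicit Arguments. Unset Strict Implicit. Unset Printing Implicit Defensive.
Import Order.TTheory GRing.Theory Num.Theory.
Import numFieldNormedType.Exports.
Local Open Scope classical_set_scope.
Local Open Scope ring_scope.

Section Defs.
Variable R : realType.

(* iint n F integrates F over the coordinates 0..n-1 (each w.r.t. the
   Lebesgue measure on R); for nonnegative Borel functions this is, by
   Tonelli, the Lebesgue integral over R^n. *)
Fixpoint iint (n : nat) (F : (nat -> R) -> \bar R) : \bar R :=
  match n with
  | 0 => F (fun _ => 0)
  | n'.+1 => (\int[@lebesgue_measure R]_t
                iint n' (fun g => F (fun i => if i == n' then t else g i)))%E
  end.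

Definition Int (d : nat) (f : 'rV[R]_d -> \bar R) : \bar R :=
  iint d (fun g => f (\row_(i < d) g i)).

Definition Ints (d : nat) (f : 'rV[R]_d -> R) : \bar R :=
  (Int (fun x => (Num.max (f x) 0)%:E) - Int (fun x => (Num.max (- f x) 0)%:E))%E.

(* Borel measurability of a function on R^d (R^d identified with d.-tuple R,
   whose product sigma-algebra is the Borel sigma-algebra of R^d) *)
Definition rmeas (d : nat) (f : 'rV[R]_d -> R) : Prop :=
  measurable_fun [set: d.-tuple R] (fun t => f (\row_(i < d) tnth t i)).

Definition L2 (d : nat) (f : 'rV[R]_d -> R) : Prop :=
  rmeas f /\ (Int (fun x => (f x ^+ 2)%:E) < +oo)%E.

Definition partial (d : nat) (i : 'I_d) (f : 'rV[R]_d -> R) : 'rV[R]_d -> R :=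
  fun x => derive f x (delta_mx 0 i).

Fixpoint dpart (d : nat) (l : seq 'I_d) (f : 'rV[R]_d -> R) : 'rV[R]_d -> R :=
  match l with
  | [::] => f
  | i :: l' => partial i (dpart l' f)
  end.

Definition smooth (d : nat) (f : 'rV[R]_d -> R) : Prop :=
  forall l : seq 'I_d, continuous (dpart l f) /\
    forall (i : 'I_d) (x : 'rV[R]_d), derivable (dpart l f) x (delta_mx 0 i).

Definition test_fun (d : nat) (f : 'rV[R]_d -> R) : Prop :=
  smooth f /\ compact (closure [set x | f x != 0]).

Definition is_wgrad (d : nat) (u : 'rV[R]_d -> R) (g : 'I_d -> 'rV[R]_d -> R) :=
  forall (i : 'I_d) (phi : 'rV[R]_d -> R), test_fun phi ->
    Ints (fun x => u x * partial i phi x) = (- Ints (fun x => (g i x * phi x)%R))%E.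

Definition HV (d : nat) (V : 'rV[R]_d -> R) (u : 'rV[R]_d -> R)
    (g : 'I_d -> 'rV[R]_d -> R) : Prop :=
  [/\ L2 u, (forall i, L2 (g i)), is_wgrad u g &
      (Int (fun x => (V x * u x ^+ 2)%:E) < +oo)%E].

Definition sqgrad (d : nat) (g : 'I_d -> 'rV[R]_d -> R) (x : 'rV[R]_d) : R :=
  \sum_(i < d) g i x ^+ 2.

Definition Erho (d : nat) (V : 'rV[R]_d -> R) (p rho : R)
    (u : 'rV[R]_d -> R) (g : 'I_d -> 'rV[R]_d -> R) : \bar R :=
  ((2^-1)%:E * Int (fun x => (sqgrad g x)%:E)
   + (2^-1)%:E * Int (fun x => (V x * u x ^+ 2)%:E)
   - (powR rho (p - 1) / (p + 1))%:E * Int (fun x => (powR `|u x| (p + 1))%:E))%E.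

Definition Fmurho (d : nat) (V : 'rV[R]_d -> R) (p mu rho : R)
    (u : 'rV[R]_d -> R) (g : 'I_d -> 'rV[R]_d -> R) : \bar R :=
  ((2^-1)%:E * Int (fun x => (sqgrad g x)%:E)
   + (2^-1)%:E * Int (fun x => (V x * u x ^+ 2)%:E)
   - (mu / 2)%:E * Int (fun x => (u x ^+ 2)%:E)
   - (powR rho (p - 1) / (p + 1))%:E * Int (fun x => (powR `|u x| (p + 1))%:E))%E.

Definition minimizer (d : nat) (V : 'rV[R]_d -> R) (p rho : R)
    (u : 'rV[R]_d -> R) : Prop :=
  exists g, [/\ HV V u g, Int (fun x => (u x ^+ 2)%:E) = 1%E &
    forall v h, HV V v h -> Int (fun x => (v x ^+ 2)%:E) = 1%E ->
      (Erho V p rho u g <= Erho V p rho v h)%E].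

(* u in S_{mu,rho}: nontrivial weak solution of
   -Lap u + V u = mu u + rho^(p-1) |u|^(p-1) u, i.e. <F'(u), phi> = 0
   for every phi in H *)
Definition weak_sol (d : nat) (V : 'rV[R]_d -> R) (p mu rho : R)
    (u : 'rV[R]_d -> R) : Prop :=
  exists g, [/\ HV V u g, Int (fun x => (u x ^+ 2)%:E) != 0%E &
    forall phi h, HV V phi h ->
      Ints (fun x => \sum_(i < d) g i x * h i x + (V x - mu) * u x * phi x
                     - powR rho (p - 1) * (powR `|u x| (p - 1) * u x) * phi x)
      = 0%E].

Definition ground_state (d : nat) (V : 'rV[R]_d -> R) (p mu rho : R)
    (u : 'rV[R]_d -> R) : Prop :=
  weak_sol V p mu rho u /\
  exists g, HV V u g /\
    forall v h, weak_sol V p mu rho v -> HV V v h ->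
      (Fmurho V p mu rho u g <= Fmurho V p mu rho v h)%E.

Definition Linf_loc (d : nat) (V : 'rV[R]_d -> R) : Prop :=
  rmeas V /\ forall K : set 'rV[R]_d, compact K -> exists M : R,
    Int (fun x => (\1_(K `&` [set y | M < `|V y|]) x)%:E) = 0%E.

Definition holder_loc (d : nat) (alpha : R) (V : 'rV[R]_d -> R) : Prop :=
  forall K : set 'rV[R]_d, compact K -> exists C : R,
    forall x y, K x -> K y -> `|V x - V y| <= C * powR `|x - y| alpha.

End Defs.

(* Main.v *)
(* Write T(u) for the integral of |grad u|^2 + V u^2, L(u) for that of
   |u|^(p+1), and c = rho^(p-1).

   Existence. A Gagliardo-Nirenberg inequality bounds the energy below; a
   minimizing sequence has an L2-Cauchy subsequence because V is coercive, and
   the parallelogram identity makes it Cauchy for T as well.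

   Multiplier. By Young's inequality v |-> L(v) lies above its tangent at u;
   inserting normalized perturbations of a minimizer u gives the equation with
   mu = T(u) - c L(u). All minimizers have the same energy, so mu is determined
   by L(u). Comparing the energies of minimizers for rho < rho' yields
   L(u) <= L(u'); hence the intervals spanned by the values of L on minimizers
   are disjoint for different rho, and at most countably many of them are
   nondegenerate. Outside these rho the multiplier is unique.

   Ground states. Testing the equation with v itself gives
   T(v) - mu |v|_2^2 = c L(v) > 0, so the action along the ray t v is a positive
   multiple of t^2/2 - t^(p+1)/(p+1), with strict maximum at t = 1. At
   t = 1/|v|_2 the action is at least e(rho) - mu/2, the action of a minimizer,
   with equality at the maximum only if |v|_2 = 1. *)
Require Import Defs.
From HB Require Import structures.
From mathcomp Require Import all_boot all_order all_algebra.
From mathcomp Require Import all_classical all_reals all_analysis.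
From mathcomp Require Import measurable_realfun.
From mathcomp Require Import ring lra.
Set Implicit Arguments. Unset Strict Implicit. Unset Printing Implicit Defensive.
Import Order.TTheory GRing.Theory Num.Theory.
Import numFieldNormedType.Exports.
Local Open Scope classical_set_scope.
Local Open Scope ring_scope.

(** * Lebesgue measure on row vectors *)

Definition rv_display : measure_display.
Proof. by constructor. Qed.

Section measurable_rv.
Context {R : realType} (d : nat).

Let coor (i : 'I_d) (x : 'rV[R]_d) : R := x 0 i.

Let rv_set0 : g_sigma_preimage coor set0.
Proof. exact: sigma_algebra0. Qed.

Let rv_setC A : g_sigma_preimage coor A -> g_sigma_preimage coor (~` A).
Proof. exact: sigma_algebraC. Qed.

Let rv_bigcup (F : _^nat) : (forall i, g_sigma_preimage coor (F i)) ->
  g_sigma_preimage coor (\bigcup_i (F i)).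
Proof. exact: sigma_algebra_bigcup. Qed.

HB.instance Definition _ := @isMeasurable.Build rv_display
  'rV[R]_d (g_sigma_preimage coor) rv_set0 rv_setC rv_bigcup.

Lemma measurable_coord (i : 'I_d) : measurable_fun setT (fun x : 'rV[R]_d => x 0 i).
Proof.
move=> _ Y mY; rewrite setTI; apply: sub_sigma_algebra => /=.
rewrite -bigcup_seq/=; exists i => /=; first by rewrite mem_index_enum.
by exists Y => //; rewrite setTI.
Qed.

Lemma measurable_rvP d1 (T1 : measurableType d1) (f : T1 -> 'rV[R]_d) :
  (forall i, measurable_fun setT (fun t => f t 0 i)) -> measurable_fun setT f.
Proof.
move=> mf _ A mA; rewrite setTI.
have : preimage_set_system setT f (g_sigma_preimage coor) `<=` measurable.
  rewrite -g_sigma_preimage_comp; apply: smallest_sub.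
    exact: sigma_algebra_measurable.
  rewrite -bigcup_seq; apply: bigcup_sub => i _ /= B [C mC <-].
  exact: mf.
by apply; exists A => //; rewrite setTI.
Qed.

End measurable_rv.

Section rv_maps.
Context {R : realType} (d : nat).
Implicit Types (f : 'rV[R]_d -> R) (x y : 'rV[R]_d).

Lemma rmeasE f : rmeas f <-> measurable_fun setT f.
Proof.
split=> mf.
  have -> : f = (fun t : d.-tuple R => f (\row_i tnth t i)) \o
               (fun x => [tuple x 0 i | i < d]).
    by apply/funext => x /=; congr f; apply/rowP => i; rewrite mxE tnth_mktuple.
  apply: measurableT_comp => //; apply/measurable_fun_tnthP => i /=.
  rewrite (_ : _ \o _ = fun x : 'rV[R]_d => x 0 i); first exact: measurable_coord.
  by apply/funext => x /=; rewrite tnth_mktuple.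
apply: measurableT_comp => //; apply: measurable_rvP => i.
under eq_fun do rewrite mxE.
exact: measurable_tnth.
Qed.

Lemma measurable_rvD d1 (T1 : measurableType d1) (f g : T1 -> 'rV[R]_d) :
  measurable_fun setT f -> measurable_fun setT g ->
  measurable_fun setT (fun t => f t + g t).
Proof.
move=> mf mg; apply: measurable_rvP => i; under eq_fun do rewrite mxE.
exact: measurable_funD (measurableT_comp (measurable_coord i) mf)
  (measurableT_comp (measurable_coord i) mg).
Qed.

Lemma measurable_rvZ d1 (T1 : measurableType d1) (f : T1 -> R) x :
  measurable_fun setT f -> measurable_fun setT (fun t => f t *: x).
Proof.
move=> mf; apply: measurable_rvP => i; under eq_fun do rewrite mxE.
exact: measurable_funM.
Qed.

End rv_maps.

Definition app_rv {R : realType} (d : nat) (x : 'rV[R]_d * R) : 'rV[R]_d.+1 :=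
  \row_i (if unlift ord_max i is Some j then x.1 0 j else x.2).

Lemma measurable_app_rv {R : realType} (d : nat) :
  measurable_fun setT (@app_rv R d).
Proof.
apply: measurable_rvP => i; rewrite /app_rv.
under eq_fun do rewrite mxE.
case: unliftP => [j _|_]; last exact: measurable_snd.
exact: (measurableT_comp (measurable_coord j) measurable_fst).
Qed.

(* The coordinate of largest index is split off because [iint] integrates over it
   outermost. *)
Fixpoint vol (R : realType) (d : nat) : set 'rV[R]_d -> \bar R :=
  match d with
  | 0 => \d_(0 : 'rV[R]_0)
  | d'.+1 => pushforward (@vol R d' \x @lebesgue_measure R)%E (@app_rv R d')
  end.
Arguments vol {R} d : simpl never.

Section vol_measure.
Context {R : realType}.

Lemma vol_measureP (d : nat) :
  exists mu : {measure set 'rV[R]_d -> \bar R}, (mu : set _ -> \bar R) = vol d.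
Proof.
elim: d => [|d [mu muE]]; first by exists (\d_(0 : 'rV[R]_0)).
rewrite /vol -/(vol d) -muE.
by exists (measure_function_pushforward__canonical__measure_function_Measure
  (mu \x @lebesgue_measure R)%E (@measurable_app_rv R d)).
Qed.

Variable d : nat.

Let vol0 : vol d set0 = 0 :> \bar R.
Proof. by have [mu <-] := vol_measureP d; exact: measure0. Qed.

Let vol_ge0 (A : set 'rV[R]_d) : (0 <= vol d A)%E.
Proof. by have [mu <-] := vol_measureP d; exact: measure_ge0. Qed.

Let vol_sigma : semi_sigma_additive (@vol R d).
Proof. by have [mu <-] := vol_measureP d; exact: measure_semi_sigma_additive. Qed.

HB.instance Definition _ := isMeasure.Build _ _ _ (@vol R d) vol0 vol_ge0 vol_sigma.

End vol_measure.

Lemma app_rv_lift {R : realType} (d : nat) (x : 'rV[R]_d) t j :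
  app_rv (x, t) 0 (lift ord_max j) = x 0 j.
Proof. by rewrite mxE liftK. Qed.

Lemma app_rv_max {R : realType} (d : nat) (x : 'rV[R]_d) t :
  app_rv (x, t) 0 ord_max = t.
Proof. by rewrite mxE unlift_none. Qed.

Section vol_box.
Context {R : realType}.

Lemma measurable_prodrv (d : nat) (A : 'I_d -> set R) :
  (forall i, measurable (A i)) -> measurable [set x : 'rV[R]_d | forall i, A i (x 0 i)].
Proof.
move=> mA; rewrite (_ : mkset _ = \big[setI/setT]_(i < d) ((fun x : 'rV[R]_d => x 0 i) @^-1` A i)).
  apply: bigsetI_measurable => i _; rewrite -[X in measurable X]setTI.
  exact: measurable_coord.
apply/seteqP; split => x /=; rewrite -bigcap_seq => xA i; first by move=> _; exact: xA.
by apply: xA; rewrite /= mem_index_enum.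
Qed.

Lemma vol_prodrv (d : nat) (A : 'I_d -> set R) : (forall i, measurable (A i)) ->
  vol d [set x | forall i, A i (x 0 i)] = (\prod_(i < d) lebesgue_measure (A i))%E.
Proof.
elim: d A => [|d IH] A mA.
  rewrite big_ord0 /vol (_ : mkset _ = setT) ?diracT//.
  by apply/seteqP; split=> // x _ [].
rewrite {1}/vol -/(vol d) /pushforward big_ord_recr/=.
rewrite (_ : _ @^-1` _ = [set x : 'rV_d | forall i, A (lift ord_max i) (x 0 i)] `*` A ord_max).
  rewrite product_measure1E; last 2 first.
  - exact: (measurable_prodrv (A := fun i => A (lift ord_max i))).
  - exact: mA.
  congr (_ * _)%E; apply: (etrans (IH (fun i => A (lift ord_max i)) _)) => //.
  apply: eq_bigr => i _; congr (lebesgue_measure (A _)).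
  by apply: val_inj; rewrite [LHS]lift_max.
apply/seteqP; split=> [[x t]/= xA|[x t]/= [xA At] i].
  split=> [i|]; last by have := xA ord_max; rewrite app_rv_max.
  by have := xA (lift ord_max i); rewrite app_rv_lift.
by case: (unliftP ord_max i) => [j|] ->; rewrite ?app_rv_lift ?app_rv_max.
Qed.

Variable d : nat.

Let vol_sigma_finite : sigma_finite setT (@vol R d).
Proof.
exists (fun n => [set x : 'rV[R]_d | forall i, (`[- n%:R, n%:R]%classic : set R) (x 0 i)]).
  apply/esym; rewrite -subTset => x _.
  have [n xn] : exists n, forall i, `|x 0 i| <= n%:R.
    pose k i := (Num.trunc `|x 0 i|).+1.
    exists (\max_(i < d) k i)%N => i.
    apply: (@le_trans _ _ (k i)%:R); first by rewrite ltW ?truncnS_gt.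
    by rewrite ler_nat leq_bigmax.
  by exists n => //= i; rewrite in_itv/= -ler_norml.
move=> n; pose I (i : 'I_d) : set R := `[- n%:R, n%:R]%classic.
have mI i : measurable (I i) by exact: measurable_itv.
split; first exact: (measurable_prodrv mI).
rewrite (vol_prodrv mI) ltey_eq; apply/orP; left.
elim/big_ind: _ => // [x y|i _]; first exact: fin_numM.
by rewrite lebesgue_measure_itv/=; case: ifPn.
Qed.

HB.instance Definition _ := Measure_isSigmaFinite.Build _ _ _ (@vol R d) vol_sigma_finite.

End vol_box.

Section vol_integral.
Context {R : realType}.

Lemma ge0_integral_vol0 (f : 'rV[R]_0 -> \bar R) : (forall x, 0 <= f x)%E ->
  measurable_fun setT f -> (\int[vol 0]_x f x)%E = f 0.
Proof. by move=> f0 mf; rewrite /vol integral_dirac// diracT mul1e. Qed.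

Lemma ge0_integral_volS (d : nat) (f : 'rV[R]_d.+1 -> \bar R) :
  (forall x, 0 <= f x)%E -> measurable_fun setT f ->
  (\int[vol d.+1]_x f x = \int[lebesgue_measure]_t \int[vol d]_x f (app_rv (x, t)))%E.
Proof.
move=> f0 mf; rewrite /vol -/(vol d) ge0_integral_pushforward//.
  rewrite preimage_setT fubini_tonelli2//.
    by apply: measurableT_comp => //; exact: measurable_app_rv.
  by move=> x; exact: f0.
exact: measurable_app_rv.
Qed.

Lemma measurable_app_rv_fixed (d : nat) t : measurable_fun setT (fun x : 'rV[R]_d => app_rv (x, t)).
Proof.
by apply: (measurableT_comp (@measurable_app_rv R d)); exact: measurable_fun_pair.
Qed.

Lemma ge0_IntE (d : nat) (f : 'rV[R]_d -> \bar R) :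
  (forall x, 0 <= f x)%E -> measurable_fun setT f -> Int f = (\int[vol d]_x f x)%E.
Proof.
rewrite /Int; elim: d f => [|d IH] f f0 mf.
  by rewrite ge0_integral_vol0//=; congr f; apply/rowP => -[].
rewrite ge0_integral_volS//=; apply: eq_integral => t _.
rewrite -(IH (fun x => f (app_rv (x, t))))//; last first.
  exact: (measurableT_comp mf (measurable_app_rv_fixed t)).
congr iint; apply/funext => g; congr f; apply/rowP => i; rewrite !mxE.
case: unliftP => [j|] ->; last by rewrite eqxx.
by rewrite mxE lift_max ltn_eqF.
Qed.

Lemma IntsE (d : nat) (f : 'rV[R]_d -> R) : measurable_fun setT f ->
  Ints f = (\int[vol d]_x (f x)%:E)%E.
Proof.
move=> mf.
have H (h : 'rV[R]_d -> R) : measurable_fun setT h ->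
    Int (fun x => (Num.max (h x) 0)%:E) = (\int[vol d]_x (Num.max (h x) 0)%:E)%E.
  move=> mh; rewrite ge0_IntE// => [x|]; first by rewrite lee_fin le_max lexx orbT.
  by apply/measurable_EFinP; exact: measurable_maxr.
rewrite /Ints H// H; last exact: measurable_funN.
by rewrite [RHS]integralE; congr (_ - _)%E; apply: eq_integral => x _;
  rewrite ?funeposE ?funenegE -EFin_max.
Qed.

Lemma ge0_integral_shift1 (c : R) (f : R -> \bar R) :
  (forall x, 0 <= f x)%E -> measurable_fun setT f ->
  (\int[lebesgue_measure]_t f (t + c)%R = \int[lebesgue_measure]_t f t)%E.
Proof.
move=> f0 mf.
have ms : measurable_fun [set: measurableTypeR R] (fun t : measurableTypeR R => (t + c)%R : measurableTypeR R).
  exact: measurable_funD.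
rewrite -[LHS](@ge0_integral_pushforward _ _ _ _ _ _ ms lebesgue_measure setT f)//.
apply: eq_measure_integral => A mA _.
rewrite -(@lebesgue_measure_unique R (measure_function_pushforward__canonical__measure_function_Measure
  lebesgue_measure ms))//.
move=> _ [[a b] _ <-] /=; rewrite /pushforward.
rewrite (_ : _ @^-1` _ = (`]a - c, b - c]%classic : set R)); last first.
  by apply/seteqP; split => x /=; rewrite !in_itv/= ltrBlDr lerBrDr.
by rewrite !lebesgue_measure_itv/= !lte_fin ltrD2r -!EFinB; case: ifP => // _; congr (_%:E); ring.
Qed.

Lemma ge0_integral_vol_shift (d : nat) (c : 'rV[R]_d) (f : 'rV[R]_d -> \bar R) :
  (forall x, 0 <= f x)%E -> measurable_fun setT f ->
  (\int[vol d]_x f (x + c)%R = \int[vol d]_x f x)%E.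
Proof.
have mc e (a : 'rV[R]_e) : measurable_fun setT (fun x : 'rV[R]_e => x + a)%R.
  by apply: measurable_rvD.
elim: d c f => [|d IH] c f f0 mf.
  rewrite !ge0_integral_vol0//; first by congr f; apply/rowP => -[].
  exact: (measurableT_comp mf (mc _ _)).
rewrite !ge0_integral_volS//; last exact: (measurableT_comp mf (mc _ _)).
pose c' : 'rV[R]_d := \row_i c 0 (lift ord_max i).
rewrite -[RHS](ge0_integral_shift1 (c 0 ord_max)); last 2 first.
- by move=> t; apply: integral_ge0.
- apply: (measurable_fun_fubini_tonelli_G (f \o @app_rv R d)) => //.
    by apply: measurableT_comp => //; exact: measurable_app_rv.
  by move=> x; exact: f0.
apply: eq_integral => t _.
rewrite -[RHS](IH c')//; last exact: (measurableT_comp mf (measurable_app_rv_fixed _)).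
apply: eq_integral => x _; congr f; apply/rowP => i; rewrite !mxE.
by case: unliftP => [j|] -> //; rewrite !mxE.
Qed.

End vol_integral.

(** * Square-integrable functions *)

Section L2_space.
Context d (T : measurableType d) (R : realType) (mu : {measure set T -> \bar R}).
Implicit Types f g h : T -> R.

Definition L2fun f := measurable_fun setT f /\ (\int[mu]_x (f x ^+ 2)%:E < +oo)%E.

Definition ip f g : R := Rintegral mu setT (fun x => f x * g x).

Lemma le_integrable_EFin f g : measurable_fun setT f ->
  mu.-integrable setT (EFin \o g) -> (forall x, `|f x| <= g x) ->
  mu.-integrable setT (EFin \o f).
Proof.
move=> mf ig fg; apply: le_integrable ig => //; first exact/measurable_EFinP.
by move=> x _ /=; rewrite lee_fin (le_trans (fg x))// ler_norm.
Qed.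

Lemma ge0_integrable_EFin f : measurable_fun setT f -> (forall x, 0 <= f x) ->
  (\int[mu]_x (f x)%:E < +oo)%E -> mu.-integrable setT (EFin \o f).
Proof.
move=> mf f0 foo; apply/integrableP; split; first exact/measurable_EFinP.
by under eq_integral do rewrite /= ger0_norm//.
Qed.

Lemma Rintegral_EFin f : mu.-integrable setT (EFin \o f) ->
  (\int[mu]_x (f x)%:E)%E = (Rintegral mu setT f)%:E.
Proof. by move=> intf; rewrite /Rintegral fineK// integrable_fin_num. Qed.

Lemma L2_integrable_sqr f : L2fun f -> mu.-integrable setT (EFin \o (fun x => f x ^+ 2)).
Proof.
move=> [mf foo]; apply: ge0_integrable_EFin => // [|x]; last exact: sqr_ge0.
exact: measurable_funX.
Qed.

Lemma L2M_integrable f g : L2fun f -> L2fun g ->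
  mu.-integrable setT (EFin \o (fun x => f x * g x)).
Proof.
move=> f2 g2; have [[mf _] [mg _]] := (f2, g2).
apply: (@le_integrable_EFin _ (fun x => f x ^+ 2 + g x ^+ 2)).
- exact: measurable_funM.
- exact: (integrableD measurableT (L2_integrable_sqr f2) (L2_integrable_sqr g2)).
move=> x; rewrite normrM -(real_normK (num_real (f x))) -(real_normK (num_real (g x))).
nra.
Qed.

Lemma L2_dom f g : measurable_fun setT f -> L2fun g ->
  (forall x, `|f x| <= `|g x|) -> L2fun f.
Proof.
move=> mf [mg goo] fg; split=> //; apply: le_lt_trans goo.
apply: ge0_le_integral => //.
- by move=> x _; rewrite lee_fin sqr_ge0.
- by apply/measurable_EFinP; exact: measurable_funX.
- by apply/measurable_EFinP; exact: measurable_funX.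
by move=> x _; rewrite lee_fin -(real_normK (num_real (f x))) -(real_normK (num_real (g x)))
  lerXn2r ?nnegrE.
Qed.

Lemma L2D f g : L2fun f -> L2fun g -> L2fun (fun x => f x + g x).
Proof.
move=> f2 g2; have [[mf _] [mg _]] := (f2, g2).
have mfg : measurable_fun setT (fun x => f x + g x) by exact: measurable_funD.
split=> //.
have I : mu.-integrable setT (EFin \o (fun x => (f x + g x) ^+ 2)).
  apply: (@le_integrable_EFin _ (fun x => 2 * (f x ^+ 2 + g x ^+ 2))).
  - exact: measurable_funX.
  - exact: (integrableZl measurableT 2
      (integrableD measurableT (L2_integrable_sqr f2) (L2_integrable_sqr g2))).
  move=> x; rewrite ger0_norm ?sqr_ge0//.
  have := sqr_ge0 (f x - g x); nra.
move/integrable_lty : I; exact.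
Qed.

Lemma L2Z c f : L2fun f -> L2fun (fun x => c * f x).
Proof.
move=> f2; have [mf _] := f2.
have mcf : measurable_fun setT (fun x => c * f x) by exact: measurable_funM.
split=> //.
rewrite (_ : (fun x => _) = (fun x => (c ^+ 2)%:E * (f x ^+ 2)%:E)%E); last first.
  by apply/funext => x; rewrite exprMn EFinM.
by have /integrable_lty := integrableZl measurableT (c ^+ 2) (L2_integrable_sqr f2); exact.
Qed.

Lemma L2N f : L2fun f -> L2fun (fun x => - f x).
Proof.
by move=> /(L2Z (-1)); congr L2fun; apply/funext => x; rewrite mulN1r.
Qed.

Lemma L2B f g : L2fun f -> L2fun g -> L2fun (fun x => f x - g x).
Proof. by move=> f2 /L2N g2; exact: L2D. Qed.

Lemma ipC f g : ip f g = ip g f.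
Proof. by rewrite /ip; under eq_Rintegral do rewrite mulrC. Qed.

Lemma ipDl f g h : L2fun f -> L2fun g -> L2fun h ->
  ip (fun x => f x + g x) h = ip f h + ip g h.
Proof.
move=> f2 g2 h2; rewrite /ip; under eq_Rintegral do rewrite mulrDl.
by rewrite RintegralD//; exact: L2M_integrable.
Qed.

Lemma ipZl c f h : L2fun f -> L2fun h -> ip (fun x => c * f x) h = c * ip f h.
Proof.
move=> f2 h2; rewrite /ip; under eq_Rintegral do rewrite -mulrA.
by rewrite RintegralZl//; exact: L2M_integrable.
Qed.

Lemma ipNl f h : L2fun f -> L2fun h -> ip (fun x => - f x) h = - ip f h.
Proof.
move=> f2 h2; rewrite (_ : (fun x => - f x) = (fun x => -1 * f x)) ?ipZl ?mulN1r//.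
by apply/funext => x; rewrite mulN1r.
Qed.

Lemma ipBl f g h : L2fun f -> L2fun g -> L2fun h ->
  ip (fun x => f x - g x) h = ip f h - ip g h.
Proof.
by move=> f2 g2 h2; rewrite (@ipDl f (fun x => - g x))// ?ipNl//; exact: L2N.
Qed.

Lemma ipDr f g h : L2fun f -> L2fun g -> L2fun h ->
  ip h (fun x => f x + g x) = ip h f + ip h g.
Proof. by move=> *; rewrite ipC ipDl// !(ipC h). Qed.

Lemma ipZr c f h : L2fun f -> L2fun h -> ip h (fun x => c * f x) = c * ip h f.
Proof. by move=> *; rewrite ipC ipZl// (ipC h). Qed.

Lemma ipBr f g h : L2fun f -> L2fun g -> L2fun h ->
  ip h (fun x => f x - g x) = ip h f - ip h g.
Proof. by move=> *; rewrite ipC ipBl// !(ipC h). Qed.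

Lemma ip_ge0 f : 0 <= ip f f.
Proof. by apply: Rintegral_ge0 => x _; rewrite -expr2 sqr_ge0. Qed.

Lemma integral_sqrE f : L2fun f -> (\int[mu]_x (f x ^+ 2)%:E)%E = (ip f f)%:E.
Proof. by move=> f2; rewrite Rintegral_EFin//; exact: L2_integrable_sqr. Qed.

Lemma ip_sqrD f g : L2fun f -> L2fun g ->
  ip (fun x => f x + g x) (fun x => f x + g x) = ip f f + 2 * ip f g + ip g g.
Proof.
move=> f2 g2; have fg2 := L2D f2 g2.
by rewrite ipDl// !ipDr// (ipC g f); ring.
Qed.

Lemma ip_sqrB f g : L2fun f -> L2fun g ->
  ip (fun x => f x - g x) (fun x => f x - g x) = ip f f - 2 * ip f g + ip g g.
Proof.
move=> f2 g2; have fg2 := L2B f2 g2.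
by rewrite ipBl// !ipBr// (ipC g f); ring.
Qed.

Lemma cauchy_schwarz f g : L2fun f -> L2fun g -> ip f g ^+ 2 <= ip f f * ip g g.
Proof.
move=> f2 g2.
have H t : 0 <= ip f f - 2 * t * ip f g + t ^+ 2 * ip g g.
  have tg2 := L2Z t g2.
  have := ip_ge0 (fun x => f x - t * g x); rewrite ip_sqrB// ipZl// !ipZr//.
  by rewrite expr2 !mulrA.
have [g0|gN0] := eqVneq (ip g g) 0.
  rewrite g0 mulr0; have [->|a0] := eqVneq (ip f g) 0; first by rewrite expr0n.
  have := H ((ip f f + 1) / (2 * ip f g)); rewrite g0 mulr0 addr0.
  rewrite (_ : 2 * _ * _ = ip f f + 1); first lra.
  by field.
have g_gt0 : 0 < ip g g by rewrite lt_neqAle eq_sym gN0 ip_ge0.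
have := H (ip f g / ip g g).
rewrite (_ : _ + _ = ip f f - ip f g ^+ 2 / ip g g); last by field.
by rewrite subr_ge0 ler_pdivrMr.
Qed.

End L2_space.

Section L2_complete.
Context d (T : measurableType d) (R : realType) (mu : {measure set T -> \bar R}).

Lemma fatou_le (h_ : nat -> T -> \bar R) (h : T -> \bar R) (c : \bar R) :
  (forall k, measurable_fun setT (h_ k)) -> measurable_fun setT h ->
  (forall k x, 0 <= h_ k x)%E -> (forall x, 0 <= h x)%E ->
  (\forall x \ae mu, h_ k x @[k --> \oo] --> h x) ->
  (forall k, \int[mu]_x h_ k x <= c)%E ->
  (\int[mu]_x h x <= c)%E.
Proof.
move=> mh_ mh h_0 h0 cvh hc.
have mlim : measurable_fun setT (fun x => limn_einf (h_^~ x)).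
  rewrite (_ : (fun x => _) = (fun x => - limn_esup (fun n => - h_ n x))%E).
    apply: measurableT_comp => //; apply: measurable_fun_limn_esup => n.
    exact: measurableT_comp.
  apply/funext => x; rewrite -limn_einfN; congr limn_einf.
  by apply/funext => n /=; rewrite oppeK.
rewrite (@ae_eq_integral _ _ _ mu setT (fun x => limn_einf (h_^~ x)) h)//; last first.
  by apply: filterS cvh => x xcv _; rewrite (cvg_limn_einf_sup xcv).1.
apply: (le_trans (fatou mu measurableT mh_ (fun n x _ => h_0 n x))).
rewrite limn_einf_lim; apply: lime_le; first exact: is_cvg_einfs.
apply: nearW => n; apply: le_trans (hc n).
by apply: ereal_inf_lbound; exists n => /=.
Qed.

Lemma ae_cvg_summable_sqr (D : nat -> T -> R) : (forall j, L2fun mu (D j)) ->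
  (forall j, ip mu (D j) (D j) <= (4 ^+ j)^-1 / 2 ^+ j.+1) ->
  \forall x \ae mu, cvgn (series (D^~ x)).
Proof.
move=> D2 Dle.
pose S x := (\sum_(0 <= j <oo) (4 ^+ j * D j x ^+ 2)%:E)%E.
have t0 j x : (0 <= (4 ^+ j * D j x ^+ 2)%:E)%E.
  by rewrite lee_fin mulr_ge0 ?sqr_ge0 ?exprn_ge0 ?ler0n.
have mt j : measurable_fun setT (fun x => (4 ^+ j * D j x ^+ 2)%:E).
  have [mD _] := D2 j; apply/measurable_EFinP.
  by apply: measurable_funM => //; exact: measurable_funX.
have S0 x : (0 <= S x)%E by apply: nneseries_ge0 => *; exact: t0.
have mS : measurable_fun setT S by apply: ge0_emeasurable_sum => // *; exact: t0.
have Soo : (\int[mu]_x S x <= 1)%E.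
  rewrite integral_nneseries//.
  have -> : 1%E = (\sum_(0 <= k <oo) (1 / (2 ^ (k + 1))%:R)%:E)%E :> \bar R.
    apply/esym; apply/cvg_lim => //.
    have := @cvg_geometric_eseries_half R 1 0; rewrite expr0 divr1.
    exact.
  apply: lee_nneseries => [j _ _|j _]; first by apply: integral_ge0 => x _; exact: t0.
  rewrite (_ : (fun x => _) = (fun x => (4 ^+ j)%:E * (D j x ^+ 2)%:E)%E)//.
  rewrite integralZl//; last exact: L2_integrable_sqr.
  rewrite integral_sqrE// -EFinM lee_fin mulrC -ler_pdivlMr ?exprn_gt0//.
  by apply: le_trans (Dle j) _; rewrite mulrC natrX addn1 div1r.
have iS : mu.-integrable setT S.
  apply/integrableP; split => //; under eq_integral do rewrite gee0_abs//.
  exact: (le_lt_trans Soo (ltry _)).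
apply: filterS (integrable_ae measurableT iS) => x /(_ I) Sfin.
pose s := fine (S x).
have s0 : 0 <= s by rewrite fine_ge0.
have Dx j : `|D j x| <= geometric (Num.sqrt s) (2^-1) j.
  rewrite /geometric/= -(@ler_pXn2r _ 2)// ?nnegrE ?mulr_ge0 ?sqrtr_ge0 ?exprn_ge0 ?invr_ge0//.
  rewrite real_normK ?num_real// exprMn sqr_sqrtr// -exprM mulnC exprM exprVn.
  rewrite (_ : 2 ^+ 2 = 4) ?exprVn; last by ring.
  rewrite ler_pdivlMr ?exprn_gt0// mulrC -lee_fin /s fineK//.
  apply: le_trans (nneseries_lim_ge j.+1 _); last by move=> *; exact: t0.
  by rewrite big_nat_recr//= leeDr// sume_ge0.
apply: (@normed_cvg R R^o).
apply: (series_le_cvg _ _ Dx) => //.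
- by move=> n; rewrite /geometric/= mulr_ge0 ?sqrtr_ge0 ?exprn_ge0 ?invr_ge0.
- by apply: is_cvg_geometric_series; rewrite ger0_norm ?invr_ge0// invf_lt1// ltr1n.
Qed.

Lemma L2_complete (f : nat -> T -> R) : (forall n, L2fun mu (f n)) ->
  (forall eps, 0 < eps -> exists N, forall m n, (N <= m)%N -> (N <= n)%N ->
     ip mu (fun x => f m x - f n x) (fun x => f m x - f n x) <= eps) ->
  exists h : T -> R, exists k : nat -> nat, [/\ L2fun mu h, forall n, (n <= k n)%N,
    \forall x \ae mu, f (k n) x @[n --> \oo] --> h x &
    forall eps, 0 < eps -> exists N, forall n, (N <= n)%N ->
     ip mu (fun x => h x - f n x) (fun x => h x - f n x) <= eps].
Proof.
move=> f2 fC.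
have e_gt0 j : 0 < (4 ^+ j)^-1 / 2 ^+ j.+1 :> R.
  by rewrite mulr_gt0 ?invr_gt0 ?exprn_gt0.
have [N HN] := choice (fun j => fC _ (e_gt0 j)).
pose k n := (\sum_(i < n.+1) N i + n)%N.
have Nk i n : (i <= n)%N -> (N i <= k n)%N.
  move=> lein; rewrite /k (bigD1 (Ordinal (lein : (i < n.+1)%N)))//= -addnA leq_addr//.
have ck n : (n <= k n)%N by rewrite leq_addl.
pose D j x := f (k j.+1) x - f (k j) x.
have D2 j : L2fun mu (D j) by exact: L2B.
have cvD := ae_cvg_summable_sqr D2 (fun j => HN j _ _ (Nk _ _ (leqnSn j)) (Nk _ _ (leqnn j))).
pose h x := fine (limn_esup (fun n => (f (k n) x)%:E)).
have mh : measurable_fun setT h.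
  apply: measurableT_comp => //; apply: measurable_fun_limn_esup => n.
  by apply/measurable_EFinP; exact: (f2 (k n)).1.
have cvh : \forall x \ae mu, f (k n) x @[n --> \oo] --> h x.
  apply: filterS cvD => x cx.
  have cf : cvgn (fun n => f (k n) x).
    rewrite (_ : (fun n => _) = (fun n => f (k 0) x + series (D^~ x) n)).
      by apply: is_cvgD => //; exact: is_cvg_cst.
    apply/funext => n; have := eq_sum_telescope (fun n => f (k n) x) n.
    exact.
  have /cvg_limn_einf_sup[_ ls] : (f (k n) x)%:E @[n --> \oo] --> (limn (fun n => f (k n) x))%:E.
    by apply: cvg_EFin; [exact: nearW|exact: cf].
  by rewrite /h ls.
have close eps : 0 < eps -> exists N, forall n, (N <= n)%N ->
    (\int[mu]_x ((h x - f n x) ^+ 2)%:E <= eps%:E)%E.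
  move=> e0; have [M HM] := fC _ e0; exists M => n Mn.
  apply: (@fatou_le (fun j x => ((f (k (M + j)%N) x - f n x) ^+ 2)%:E)).
  - move=> j; apply/measurable_EFinP; apply: measurable_funX.
    by apply: measurable_funB; [exact: (f2 _).1|exact: (f2 n).1].
  - apply/measurable_EFinP; apply: measurable_funX.
    by apply: measurable_funB => //; exact: (f2 n).1.
  - by move=> j x; rewrite lee_fin sqr_ge0.
  - by move=> x; rewrite lee_fin sqr_ge0.
  - apply: filterS cvh => x cx; apply: cvg_EFin; first exact: nearW.
    rewrite /comp/=.
    have cx' : f (k (M + j)%N) x @[j --> \oo] --> h x.
      rewrite (_ : (fun j => _) = (fun j => f (k (j + M)%N) x)); last first.
        by apply/funext => j; rewrite addnC.
      by have := cx; rewrite -(cvg_shiftn M (fun n => f (k n) x)).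
    have c1 : (f (k (M + j)%N) x - f n x) @[j --> \oo] --> h x - f n x.
      by apply: cvgB => //; exact: cvg_cst.
    have c2 := cvgM c1 c1; exact: c2.
  - move=> j; rewrite integral_sqrE; last exact: L2B.
    by rewrite lee_fin; apply: HM => //; apply: leq_trans (ck _); rewrite leq_addr.
have h2 : L2fun mu h.
  have [M HM] := close 1 ltr01.
  have hf : L2fun mu (fun x => h x - f M x).
    split; first by apply: measurable_funB => //; exact: (f2 M).1.
    by apply: le_lt_trans (HM _ (leqnn _)) _; rewrite ltry.
  have := L2D hf (f2 M); congr L2fun; apply/funext => x; exact: subrK.
exists h, k; split => // eps e0; have [M HM] := close _ e0; exists M => n Mn.
by have := HM n Mn; rewrite integral_sqrE ?lee_fin//; exact: L2B.
Qed.

End L2_complete.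

(** * Bump functions *)

Section smooth_bump.
Context {R : realType}.
Implicit Types (a b c x y : R) (f : R -> R).

Lemma is_derive_quadratic f x (C : R) :
  (forall h, `|f (h + x) - f x| <= C * h ^+ 2) -> is_derive x 1 f 0.
Proof.
move=> fC.
have C0 : 0 <= C by have := fC 1; rewrite expr1n mulr1; apply: le_trans.
have cv : h^-1 *: (f (h *: (1 : R) + x) - f x) @[h --> 0^'] --> (0 : R).
  apply/cvgrPdist_le => e e0; near=> h.
  rewrite sub0r normrN normrZ normfV [h *: _]mulr1.
  have h0 : 0 < `|h|.
    by rewrite normr_gt0; near: h; exact: nbhs_dnbhs_neq.
  rewrite mulrC ler_pdivrMr//; apply: le_trans (fC h) _.
  rewrite -(real_normK (num_real h)) expr2 mulrA ler_wpM2r//.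
  have he : `|h| <= e / (C + 1).
    near: h; apply: dnbhs0_le; apply: divr_gt0 => //; exact: ltr_wpDl.
  have : `|h| * (C + 1) <= e by rewrite -ler_pdivlMr//; exact: ltr_wpDl.
  have := normr_ge0 h; nra.
by apply: DeriveDef; [apply/cvg_ex; exists 0|exact/cvg_lim].
Unshelve. all: by end_near. Qed.

(* The family is closed under differentiation up to linear combinations. *)
Definition flat c (k : nat) y : R :=
  if 0 < y then y^-1 ^+ k * expR (- c * y^-1) else 0.

Lemma flat_le c k : 0 < c -> exists C, forall y, `|flat c k y| <= C * y ^+ 2.
Proof.
move=> c0; pose n : R := k.+2%:R; have n0 : 0 < n by rewrite ltr0n.
exists ((n / c) ^+ k.+2) => y; rewrite /flat; case: ifPn => [y0|_]; last first.
  by rewrite normr0 mulr_ge0 ?sqr_ge0 ?exprn_ge0// divr_ge0// ltW.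
have y0' := ltW y0; have c0' := ltW c0; have n0' := ltW n0.
rewrite ger0_norm ?mulr_ge0 ?expR_ge0 ?exprn_ge0 ?invr_ge0//.
have e1 : (c / (n * y)) ^+ k.+2 <= expR (c / y).
  have -> : c / y = n * (c / (n * y)) by field; lra.
  rewrite expRM_natl lerXn2r ?nnegrE ?expR_ge0//.
    by rewrite divr_ge0 ?mulr_ge0.
  by apply: le_trans (expR_ge1Dx _); rewrite lerDr.
have t0 : 0 < (c / (n * y)) ^+ k.+2 by rewrite exprn_gt0// divr_gt0 ?mulr_gt0.
rewrite mulNr expRN.
apply: (@le_trans _ _ (y^-1 ^+ k * ((c / (n * y)) ^+ k.+2)^-1)).
  by rewrite ler_wpM2l ?exprn_ge0 ?invr_ge0// lef_pV2 ?posrE ?expR_gt0.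
rewrite le_eqVlt; apply/orP; left.
rewrite -exprVn invf_div mulrAC exprMn mulrCA; apply/eqP; congr (_ * _).
by rewrite -addn2 exprD mulrA -exprMn mulVf ?gt_eqF// expr1n mul1r.
Qed.

Lemma is_derive_flat c k y : 0 < c ->
  is_derive y 1 (flat c k) (c * flat c k.+2 y - k%:R * flat c k.+1 y).
Proof.
move=> c0; have [y0|y0|y0] := ltrgtP y 0.
- rewrite {2 3}/flat !ifN -?leNgt ?ltW// !mulr0 subr0.
  apply: near_eq_is_derive (is_derive_cst _ _ _).
  near=> z; rewrite /flat ifN// -leNgt ltW//; near: z.
  exact: lt_nbhsl.
- have dV : is_derive y 1 (fun z : R => z^-1) (- y ^- 2).
    apply: is_derive_eq; first by apply: is_deriveV => //; rewrite gt_eqF.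
    by rewrite [_ *: _]mulr1.
  rewrite {2 3}/flat y0.
  apply: (@near_eq_is_derive _ _ _ (fun z : R => z^-1 ^+ k * expR (- c * z^-1))).
    near=> z; rewrite /flat ifT//; near: z; exact: lt_nbhsr.
  have d1 : is_derive y 1 (fun z : R => - c * z^-1) (- c * (- y ^- 2)).
    by apply: is_deriveZ.
  have d2 := @is_derive1_comp _ expR (fun z : R => - c * z^-1) y _ _ (is_derive_expR _) d1.
  have d3 := @is_deriveX _ _ _ k _ _ _ dV.
  rewrite (_ : (fun z => _) = (fun z : R => z^-1) ^+ k * (expR \o (fun z => - c * z^-1))); last first.
    by apply/funext => z; rewrite mulrfctE exprfctE.
  apply: (is_derive_eq (is_deriveM d3 d2)).
  rewrite exprfctE /comp; set E := expR _.
  rewrite /GRing.scale/= -[y ^- 2]exprVn; clearbody E.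
  move: (y^-1) => z; case: k {d3} => [|k] /=; rewrite !exprS; first by ring.
  by move: (z ^+ k) => zk; ring.
- have [C HC] := flat_le k c0; rewrite y0.
  rewrite {2 3}/flat ltxx !mulr0 subr0; apply: (@is_derive_quadratic _ _ C) => h.
  by rewrite {2}/flat ltxx subr0 addr0.
Unshelve. all: by end_near. Qed.

End smooth_bump.

Section smooth1.
Context {R : realType}.
Implicit Types (a b c x y : R) (f : R -> R).

Definition smooth1 f := exists C : set (R -> R), C f /\
  forall h, C h -> exists2 h', C h' & forall x, is_derive x (1 : R) h (h' x).

Lemma smooth1_derive f : smooth1 f ->
  exists2 f', smooth1 f' & forall x, is_derive x (1 : R) f (f' x).
Proof. by move=> [C [/[dup] Cf /[swap] HC /HC[f' Cf' ff']]]; exists f' => //; exists C. Qed.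

Lemma smooth1_continuous f : smooth1 f -> continuous f.
Proof.
move=> /smooth1_derive[f' _ ff'] x; apply/differentiable_continuous/derivable1_diffP.
exact: (@ex_derive _ _ _ _ _ _ _ (ff' x)).
Qed.

Lemma flatS c k y : flat c k y = y * flat c k.+1 y.
Proof.
rewrite /flat; case: ifPn => [y0|]; last by rewrite mulr0.
by rewrite exprS mulrA mulrA mulfV ?mul1r// gt_eqF.
Qed.

Section bumpq.
Variables a b c : R.

Let W : {poly R} := ('X - a%:P) * (b%:P - 'X).

Definition bumpq (q : {poly R}) (k : nat) x := q.[x] * flat c k W.[x].

Definition bumpq_deriv (q : {poly R}) (k : nat) : {poly R} :=
  q^`() * W ^+ 2 + q * W^`() * (c%:P - k%:R%:P * W).

Lemma is_derive_bumpq q k x : 0 < c ->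
  is_derive x 1 (bumpq q k) (bumpq (bumpq_deriv q k) k.+2 x).
Proof.
move=> c0.
have d2 := @is_derive1_comp _ (flat c k) (horner W) x _ _ (is_derive_flat k W.[x] c0) (is_derive_poly W x).
apply: (is_derive_eq (is_deriveM (is_derive_poly q x) d2)).
rewrite /GRing.scale/= /bumpq /bumpq_deriv; move: W => w {d2}.
rewrite !(hornerM, hornerD, hornerN, hornerC, horner_exp) (flatS c k) (flatS c k.+1).
by move: (flat _ _ _) => F; ring.
Qed.

Lemma bumpq_out q k x : a < b -> ~~ (a < x < b) -> bumpq q k x = 0.
Proof.
move=> ab; rewrite negb_and -!leNgt => xab; rewrite /bumpq /flat ifN ?mulr0//.
rewrite -leNgt /W hornerM !hornerD !hornerN !hornerC !hornerX.
by case/orP : xab => ?; [apply: mulr_le0_ge0|apply: mulr_ge0_le0]; lra.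
Qed.

Lemma smooth1_bumpq q k : 0 < c -> smooth1 (bumpq q k).
Proof.
move=> c0; exists [set h | exists q k, h = bumpq q k]; split; first by exists q, k.
move=> _ [r [m ->]]; exists (bumpq (bumpq_deriv r m) m.+2); first by exists (bumpq_deriv r m), m.+2.
by move=> x; exact: is_derive_bumpq.
Qed.

End bumpq.

Definition bump c a b := bumpq a b c 1 0.

Lemma bumpE c a b x : a < x < b -> bump c a b x = expR (- (c / ((x - a) * (b - x)))).
Proof.
move=> /andP[ax xb]; rewrite /bump /bumpq /flat hornerC mul1r.
rewrite hornerM !hornerD !hornerN !hornerC !hornerX ifT ?expr0 ?mul1r ?mulNr//.
by apply: mulr_gt0; lra.
Qed.

Lemma bump_ge0 c a b x : 0 <= bump c a b x.
Proof.
rewrite /bump /bumpq /flat hornerC mul1r; case: ifPn => // _.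
by rewrite expr0 mul1r expR_ge0.
Qed.

Lemma bump_le1 c a b x : 0 < c -> bump c a b x <= 1.
Proof.
move=> c0; rewrite /bump /bumpq /flat hornerC mul1r; case: ifPn => // w0.
rewrite expr0 mul1r -expR0 ler_expR mulNr oppr_le0 divr_ge0// ltW//.
Qed.

Lemma bump_cvg a b x : a < b ->
  bump n.+1%:R^-1 a b x @[n --> \oo] --> (\1_(`]a, b[%classic : set R) x : R).
Proof.
move=> ab; rewrite indicE; have [xab|xab] := boolP (a < x < b).
  rewrite mem_set ?in_itv//=; under eq_fun do rewrite bumpE//.
  have cv : - (n.+1%:R^-1 / ((x - a) * (b - x))) @[n --> \oo] --> - ((0:R) / ((x - a) * (b - x))).
    by apply: cvgN; apply: cvgMr_tmp; exact: cvg_harmonic.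
  rewrite mul0r oppr0 in cv.
  have := @continuous_cvg _ _ _ _ _ _ _ _ (@continuous_expR R 0) cv; rewrite expR0; exact.
rewrite memNset; last by rewrite /= in_itv/=; exact/negP.
under eq_fun do rewrite /bump bumpq_out//.
exact: cvg_cst.
Qed.

Lemma bumpq_bounded a b c q k : 0 < c -> a < b -> exists M, forall x, `|bumpq a b c q k x| <= M.
Proof.
move=> c0 ab.
have cont : {within `[a, b], continuous (fun x => `|bumpq a b c q k x|)}.
  apply: continuous_subspaceT => x; apply: continuous_comp; last exact: norm_continuous.
  exact: smooth1_continuous (smooth1_bumpq a b q k c0) x.
have [z _ Hz] := EVT_max (ltW ab) cont.
exists `|bumpq a b c q k z| => x; have [xab|xab] := boolP (a < x < b).
  by apply: Hz; rewrite in_itv/=; case/andP: xab => /ltW-> /ltW->.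
by rewrite bumpq_out// normr0.
Qed.

End smooth1.

Section tensor.
Context {R : realType} (d : nat).
Implicit Types (F : 'I_d -> R -> R) (x : 'rV[R]_d).

Definition tens F x : R := \prod_(i < d) F i (x 0 i).

Definition upd F (i : 'I_d) (f : R -> R) (j : 'I_d) : R -> R :=
  if j == i then f else F j.

Lemma tens_upd F i f x : tens (upd F i f) x = f (x 0 i) * \prod_(j < d | j != i) F j (x 0 j).
Proof.
rewrite /tens (bigD1 i)//= /upd eqxx; congr (_ * _).
by apply: eq_bigr => j /negbTE->.
Qed.

Lemma tensD1 F i x : tens F x = F i (x 0 i) * \prod_(j < d | j != i) F j (x 0 j).
Proof. by rewrite /tens (bigD1 i). Qed.

Lemma is_derive_tens F i f x : is_derive (x 0 i) (1 : R) (F i) (f (x 0 i)) ->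
  is_derive x (delta_mx 0 i : 'rV[R]_d) (tens F) (tens (upd F i f) x).
Proof.
move=> [dF vF].
have E : (fun h : R => h^-1 *: (tens F (h *: delta_mx 0 i + x) - tens F x)) =
    (fun h => (h^-1 *: (F i (h *: (1 : R) + x 0 i) - F i (x 0 i))) *
              \prod_(j < d | j != i) F j (x 0 j)).
  apply/funext => h; rewrite !(tensD1 _ i) !mxE !eqxx.
  rewrite (eq_bigr (fun j => F j (x 0 j))).
    by rewrite -mulrBl [LHS]mulrA.
  by move=> j ji; rewrite !mxE (negbTE ji) mulr0 add0r.
have cv : (h^-1 *: (F i (h *: (1 : R) + x 0 i) - F i (x 0 i))) *
    \prod_(j < d | j != i) F j (x 0 j) @[h --> 0^'] -->
    tens (upd F i f) x.
  by rewrite tens_upd; apply: cvgMr_tmp; rewrite -vF; exact: dF.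
apply: DeriveDef; first by rewrite /derivable E; apply/cvg_ex; eexists; exact: cv.
by rewrite /derive E; apply/cvg_lim.
Qed.

Lemma tens_continuous F : (forall i, continuous (F i)) -> continuous (tens F).
Proof.
move=> cF; rewrite /tens; elim: (index_enum _) => [|i s IH].
  by under eq_fun do rewrite big_nil; exact: cst_continuous.
under eq_fun do rewrite big_cons; move=> x; apply: continuousM; last exact: IH.
apply: (continuous_comp (f := fun y : 'rV[R]_d => y 0 i)); last exact: cF.
exact: coord_continuous.
Qed.

Lemma measurable_tens F : (forall i, continuous (F i)) -> measurable_fun setT (tens F).
Proof.
move=> cF; rewrite /tens; elim: (index_enum _) => [|i s IH].
  by under eq_fun do rewrite big_nil; exact: measurable_cst.
under eq_fun do rewrite big_cons; apply: measurable_funM => //.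
apply: (measurableT_comp (f := F i)); last exact: measurable_coord.
exact: continuous_measurable_fun.
Qed.

Lemma dpart_tens F l : (forall i, smooth1 (F i)) ->
  exists2 F', (forall i, smooth1 (F' i)) & dpart l (tens F) = tens F'.
Proof.
move=> sF; elim: l => [|i l [G sG /= ->]]; first by exists F.
have [g sg gg] := smooth1_derive (sG i).
exists (upd G i g); first by move=> j; rewrite /upd; case: ifP.
apply/funext => x; rewrite /partial.
by have /@derive_val -> := is_derive_tens (gg (x 0 i)).
Qed.

Lemma smooth_tens F : (forall i, smooth1 (F i)) -> smooth (tens F).
Proof.
move=> sF l; have [G sG ->] := dpart_tens l sF; split.
  by apply: tens_continuous => i; exact: smooth1_continuous.
move=> i x; have [g sg gg] := smooth1_derive (sG i).
exact: (@ex_derive _ _ _ _ _ _ _ (is_derive_tens (gg (x 0 i)))).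
Qed.

Lemma tens_out F (a b : 'I_d -> R) x :
  (forall i y, ~~ (a i < y < b i) -> F i y = 0) ->
  ~ (forall i, a i < x 0 i < b i) -> tens F x = 0.
Proof.
move=> F0 /existsNP[i /negP xi]; rewrite (tensD1 _ i) F0 ?mul0r//.
Qed.

Lemma test_fun_tens F (a b : 'I_d -> R) : (forall i, smooth1 (F i)) ->
  (forall i y, ~~ (a i < y < b i) -> F i y = 0) -> test_fun (tens F).
Proof.
move=> sF F0; split; first exact: smooth_tens.
pose B := [set x : 'rV[R]_d | forall i, (`[a i, b i]%classic : set R) (x ord0 i)].
have cB : compact B.
  by apply: (@rV_compact _ _ (fun i => `[a i, b i]%classic)) => i; exact: segment_compact.
have clB : closed B by apply: compact_closed cB; exact: norm_hausdorff.
apply: subclosed_compact cB _; first exact: closed_closure.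
rewrite [X in _ `<=` X](closure_id B).1//; apply: closureS => x /= /eqP tx i.
have /(_ i) : forall i, a i < x 0 i < b i.
  by apply: contrapT => /(tens_out F0).
by move=> /andP[/ltW ai /ltW bi]; rewrite /= in_itv/= ai bi.
Qed.

End tensor.

Section tensor_bump.
Context {R : realType} (d : nat).
Variables (c : R) (a b : 'I_d -> R).
Hypotheses (c0 : 0 < c) (ab : forall i, a i < b i).

Definition tbump : 'rV[R]_d -> R := tens (fun i => bump c (a i) (b i)).

Lemma bump_out i y : ~~ (a i < y < b i) -> bump c (a i) (b i) y = 0.
Proof. by move=> /bumpq_out; exact. Qed.

Lemma test_fun_tbump : test_fun tbump.
Proof.
by apply: test_fun_tens bump_out => i; exact: smooth1_bumpq.
Qed.

Definition bump' i := bumpq (a i) (b i) c (bumpq_deriv (a i) (b i) c 1 0) 2.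

Lemma partial_tbump i :
  partial i tbump = tens (upd (fun i => bump c (a i) (b i)) i (bump' i)).
Proof.
apply/funext => x; rewrite /partial.
by have /@derive_val -> := @is_derive_tens _ _ (fun i => bump c (a i) (b i)) i (bump' i) x
  (is_derive_bumpq (a i) (b i) 1 0 (x 0 i) c0).
Qed.

End tensor_bump.

Section density_measure.
Context d (T : measurableType d) (R : realType) (mu : {measure set T -> \bar R}).
Variable f : T -> \bar R.
Hypotheses (mf : measurable_fun setT f) (f0 : forall x, (0 <= f x)%E).

Let dens (A : set T) : \bar R := (\int[mu]_(x in A) f x)%E.

Let dens0 : dens set0 = 0.
Proof. exact: integral_set0. Qed.

Let dens_ge0 A : (0 <= dens A)%E.
Proof. exact: integral_ge0. Qed.

Let dens_sigma : semi_sigma_additive dens.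
Proof.
move=> F mF tF mUF; rewrite /dens ge0_integral_bigcup//; last exact: measurable_funTS.
by apply: is_cvg_nneseries => n _ _; exact: integral_ge0.
Qed.

HB.instance Definition _ := isMeasure.Build _ _ _ dens dens0 dens_ge0 dens_sigma.

Lemma density_measure : exists nu : {measure set T -> \bar R},
  forall A, nu A = (\int[mu]_(x in A) f x)%E.
Proof. by exists dens. Qed.

End density_measure.

Section density.
Context {R : realType} (d : nat).

Definition obox (a b : 'I_d -> R) : set 'rV[R]_d :=
  [set x | forall i, (`]a i, b i[%classic : set R) (x 0 i)].

Lemma measurable_obox a b : measurable (obox a b).
Proof. exact: (measurable_prodrv (A := fun i => `]a i, b i[%classic)). Qed.

Lemma vol_obox_lty a b : (vol d (obox a b) < +oo)%E.
Proof.
rewrite [X in (X < _)%E](vol_prodrv (A := fun i => `]a i, b i[%classic))//.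
rewrite ltey_eq; apply/orP; left.
elim/big_ind: _ => // [x y|i _]; first exact: fin_numM.
by rewrite lebesgue_measure_itv/=; case: ifPn.
Qed.

Definition oboxes := [set A | exists a b, A = obox a b].

Lemma obox_gt (a : R) (i : 'I_d) : [set x : 'rV[R]_d | a < x 0 i] =
  \bigcup_n obox (fun j => if j == i then a else - n%:R) (fun=> n%:R).
Proof.
apply/seteqP; split=> [x /= ax|x [n _ /(_ i)] /=]; last first.
  by rewrite eqxx in_itv/= => /andP[].
pose k j := (Num.trunc `|x 0 j|).+1.
exists (\max_(i < d) k i)%N => // j /=.
have : `|x 0 j| < (\max_(i < d) k i)%:R.
  by apply: lt_le_trans (truncnS_gt _) _; rewrite ler_nat (leq_bigmax (F := k)).
rewrite ltr_norml => /andP[h1 h2]; rewrite in_itv/= h2 andbT.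
by case: eqP => // ->.
Qed.

Lemma measurable_oboxesE : @measurable _ 'rV[R]_d = <<s oboxes >>.
Proof.
apply/seteqP; split; last first.
  apply: smallest_sub; first exact: sigma_algebra_measurable.
  by move=> _ [a [b ->]]; exact: measurable_obox.
apply: smallest_sub; first exact: smallest_sigma_algebra.
rewrite -bigcup_seq; apply: bigcup_sub => i _ _ [B mB <-].
pose g := (fun x : 'rV[R]_d => x 0 i) : g_sigma_algebraType oboxes -> R.
suff mg : measurable_fun setT g by exact: mg.
apply: (measurability _ (RGenOInfty.measurableE R)) => _ [_ [a ->] <-].
rewrite setTI (_ : _ @^-1` _ = [set x : 'rV[R]_d | a < x 0 i]).
  rewrite obox_gt; apply: bigcupT_measurable => n; apply: sub_sigma_algebra.
  by eexists; eexists.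
by apply/seteqP; split => x /=; rewrite in_itv/= andbT.
Qed.

Lemma oboxesI : setI_closed oboxes.
Proof.
move=> _ _ [a [b ->]] [a' [b' ->]].
exists (fun i => Num.max (a i) (a' i)), (fun i => Num.min (b i) (b' i)).
apply/seteqP; split => [x [] xab xab' i|x xab]; last split=> i.
- have := xab i; have := xab' i; rewrite /= !in_itv/= gt_max lt_min.
  by move=> /andP[-> ->] /andP[-> ->].
- by have := xab i; rewrite /= !in_itv/= gt_max lt_min => /andP[/andP[-> _] /andP[-> _]].
- by have := xab i; rewrite /= !in_itv/= gt_max lt_min => /andP[/andP[_ ->] /andP[_ ->]].
Qed.

Lemma oboxes_cover : \bigcup_n obox (fun=> - n%:R) (fun=> n%:R) = setT.
Proof.
apply/seteqP; split=> // x _; pose k j := (Num.trunc `|x 0 j|).+1.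
exists (\max_(i < d) k i)%N => // j /=.
rewrite in_itv/= -ltr_norml.
by apply: lt_le_trans (truncnS_gt _) _; rewrite ler_nat (leq_bigmax (F := k)).
Qed.

Lemma L2_indic (A : set 'rV[R]_d) : measurable A -> (vol d A < +oo)%E -> L2fun (vol d) (\1_A).
Proof.
move=> mA Aoo; split=> //.
rewrite (_ : (fun x => _) = EFin \o \1_A) ?integral_indic ?setIT//.
by apply/funext => x /=; rewrite indicE; case: (_ \in _); rewrite ?expr1n ?expr0n.
Qed.

Lemma ae_eq0_obox (f : 'rV[R]_d -> R) : L2fun (vol d) f ->
  (forall a b, ip (vol d) f (\1_(obox a b)) = 0) -> \forall x \ae vol d, f x = 0.
Proof.
move=> f2 f0; have [mf _] := f2.
have mp : measurable_fun setT (EFin \o f^\+) by apply/measurable_EFinP; exact: measurable_funrpos.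
have mn : measurable_fun setT (EFin \o f^\-) by apply/measurable_EFinP; exact: measurable_funrneg.
have p0 x : (0 <= (f^\+ x)%:E)%E by rewrite lee_fin funrpos_ge0.
have n0 x : (0 <= (f^\- x)%:E)%E by rewrite lee_fin funrneg_ge0.
have [nu1 E1] := density_measure (vol d) mp p0.
have [nu2 E2] := density_measure (vol d) mn n0.
have I1 a b : (nu1 (obox a b) = \int[vol d]_x (f^\+ x * \1_(obox a b) x)%:E)%E.
  rewrite E1 integral_mkcond; apply: eq_integral => x _.
  by rewrite /patch indicE; case: (_ \in _); rewrite ?mulr1 ?mulr0.
have I2 a b : (nu2 (obox a b) = \int[vol d]_x (f^\- x * \1_(obox a b) x)%:E)%E.
  rewrite E2 integral_mkcond; apply: eq_integral => x _.
  by rewrite /patch indicE; case: (_ \in _); rewrite ?mulr1 ?mulr0.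
have Lp : L2fun (vol d) f^\+.
  apply: L2_dom f2 _; first exact: measurable_funrpos.
  by move=> x; rewrite ger0_norm ?funrpos_ge0// /funrpos ge_max ler_norm normr_ge0.
have Ln : L2fun (vol d) f^\-.
  apply: L2_dom f2 _; first exact: measurable_funrneg.
  by move=> x; rewrite ger0_norm ?funrneg_ge0// /funrneg ge_max -normrN ler_norm normr_ge0.
have LI a b : L2fun (vol d) (\1_(obox a b)).
  by apply: L2_indic; [exact: measurable_obox|exact: vol_obox_lty].
have nuE A : measurable A -> nu1 A = nu2 A.
  apply: (@measure_unique _ _ _ oboxes (fun n => obox (fun=> - n%:R) (fun=> n%:R))).
  - exact: measurable_oboxesE.
  - exact: oboxesI.
  - by move=> n; eexists; eexists.
  - exact: oboxes_cover.
  - move=> _ [a [b ->]]; rewrite I1 I2.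
    rewrite !Rintegral_EFin; [|exact: L2M_integrable..].
    congr (_%:E); apply/eqP; rewrite -subr_eq0 -[X in _ == X](f0 a b); apply/eqP.
    rewrite -(ipBl Lp Ln (LI a b)); congr ip; exact: (funrposBneg f).
  - move=> n; rewrite I1 Rintegral_EFin ?ltry//; exact: L2M_integrable.
pose P := [set x | 0 < f x].
have mP : measurable P.
  rewrite (_ : P = f @^-1` `]0, +oo[); last by apply/seteqP; split=> x /=; rewrite in_itv/= andbT.
  by rewrite -[X in measurable X]setTI; exact: mf.
have P2 : nu2 P = 0.
  rewrite E2 integral0_eq// => x /= fx; congr (_%:E).
  by rewrite /funrneg; apply/max_idPr; rewrite oppr_le0 ltW.
have C1 : nu1 (~` P) = 0.
  rewrite E1 integral0_eq// => x /= /negP; rewrite -leNgt => fx; congr (_%:E).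
  by rewrite /funrpos; apply/max_idPr.
have I0 : (\int[vol d]_x `|(f x)%:E| = 0)%E.
  have -> : (\int[vol d]_x `|(f x)%:E| = \int[vol d]_x ((f^\+ x)%:E + (f^\- x)%:E))%E.
    by apply: eq_integral => x _; rewrite -EFinD; congr (_%:E); exact: (esym (congr1 (fun g => g x) (funrposDneg f))).
  rewrite ge0_integralD//.
  rewrite -[X in (X + _)%E]E1 -[X in (_ + X)%E]E2.
  have U (nu : {measure set 'rV[R]_d -> \bar R}) : nu setT = (nu P + nu (~` P))%E.
    by rewrite -(setUv P) measureU ?setICr//; exact: measurableC.
  have mCP : measurable (~` P) by exact: measurableC.
  by rewrite !U (nuE _ mP) P2 -(nuE _ mCP) C1 !adde0.
have /ae_eq_integral_abs := I0; move=> /(_ measurableT) H.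
have : measurable_fun setT (EFin \o f) by exact/measurable_EFinP.
move=> /H; apply: filterS => x /(_ I) /=; by case.
Qed.

Lemma indic_obox_prod a b (x : 'rV[R]_d) :
  \1_(obox a b) x = \prod_(i < d) \1_(`]a i, b i[%classic : set R) (x 0 i) :> R.
Proof.
rewrite indicE; have [xab|] := boolP (x \in obox a b).
  rewrite big1// => i _; rewrite indicE mem_set//.
  by move: xab; rewrite inE; exact.
rewrite notin_setE => /existsNP[i xi].
by rewrite (bigD1 i)//= indicE memNset// mul0r.
Qed.

Lemma tbump_cvg a b (x : 'rV[R]_d) : (forall i, a i < b i) ->
  tbump n.+1%:R^-1 a b x @[n --> \oo] --> (\1_(obox a b) x : R).
Proof.
move=> ab; rewrite indic_obox_prod /tbump /tens; elim: (index_enum _) => [|i s IH].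
  by under eq_fun do rewrite big_nil; rewrite big_nil; exact: cvg_cst.
rewrite big_cons; under eq_fun do rewrite big_cons.
by apply: cvgM IH; exact: bump_cvg.
Qed.

Lemma tbump_bound c a b (x : 'rV[R]_d) : 0 < c -> (forall i, a i < b i) ->
  0 <= tbump c a b x <= \1_(obox a b) x.
Proof.
move=> c0 ab; have t0 : 0 <= tbump c a b x by apply: prodr_ge0 => i _; exact: bump_ge0.
rewrite t0/= indicE; have [xab|] := boolP (x \in obox a b).
  by apply: prodr_ile1 => i _; rewrite bump_ge0 bump_le1.
rewrite notin_setE => xab; rewrite le_eqVlt; apply/orP; left; apply/eqP.
apply: (@tens_out _ _ _ a b); first by move=> i y; exact: bump_out.
by move=> h; apply: xab => i /=; rewrite in_itv/=; exact: h.
Qed.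

Lemma measurable_tbump c (a b : 'I_d -> R) : 0 < c -> measurable_fun setT (tbump c a b).
Proof.
by move=> c0; apply: measurable_tens => i; apply: smooth1_continuous; exact: smooth1_bumpq.
Qed.

Lemma L2_tbump c (a b : 'I_d -> R) : 0 < c -> (forall i, a i < b i) ->
  L2fun (vol d) (tbump c a b).
Proof.
move=> c0 ab; apply: (@L2_dom _ _ _ _ _ (\1_(obox a b))).
- exact: measurable_tbump.
- by apply: L2_indic; [exact: measurable_obox|exact: vol_obox_lty].
move=> x; have /andP[t0 t1] := tbump_bound x c0 ab.
by rewrite ger0_norm// (le_trans t1)// ler_norm.
Qed.

Lemma ae_eq0_tbump (f : 'rV[R]_d -> R) : L2fun (vol d) f ->
  (forall c a b, 0 < c -> (forall i, a i < b i) -> ip (vol d) f (tbump c a b) = 0) ->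
  \forall x \ae vol d, f x = 0.
Proof.
move=> f2 f0; have [mf _] := f2; apply: ae_eq0_obox => // a b.
have [ab|/existsNP[i abi]] := pselect (forall i, a i < b i); last first.
  rewrite /ip (_ : (fun x => _) = cst 0) ?Rintegral_cst ?mul0r//.
  apply/funext => x; rewrite indic_obox_prod (bigD1 i)//= indicE memNset ?mul0r ?mulr0//=.
  by rewrite in_itv/= => /andP[h1 h2]; apply: abi; exact: lt_trans h1 h2.
have e0 n : 0 < n.+1%:R^-1 :> R by [].
have LI : L2fun (vol d) (\1_(obox a b)).
  by apply: L2_indic; [exact: measurable_obox|exact: vol_obox_lty].
have Lf : L2fun (vol d) (fun x => `|f x|).
  by apply: L2_dom f2 _ => [|x]; [exact: measurableT_comp|rewrite normr_id].
have [|||||_ _ cv] := @dominated_convergence _ _ _ (vol d) setT measurableT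
    (fun n x => (f x * tbump n.+1%:R^-1 a b x)%:E) (fun x => (f x * \1_(obox a b) x)%:E)
    (fun x => (`|f x| * \1_(obox a b) x)%:E).
- by move=> n; apply/measurable_EFinP; apply: measurable_funM => //; exact: measurable_tbump.
- apply/measurable_EFinP; apply: measurable_funM => //.
  by apply: measurable_indic; exact: measurable_obox.
- apply: aeW => x _; apply: cvg_EFin; first exact: nearW.
  by apply: cvgMl_tmp; exact: tbump_cvg.
- exact: L2M_integrable.
- apply: aeW => x n _; rewrite lee_fin normrM ler_wpM2l//.
  by have /andP[t0 t1] := tbump_bound x (e0 n) ab; rewrite ger0_norm.
have z : (fun n => \int[vol d]_x (f x * tbump n.+1%:R^-1 a b x)%:E)%E = cst 0%E.
  apply/funext => n; rewrite Rintegral_EFin; last by apply: L2M_integrable => //; exact: L2_tbump.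
  by congr (_%:E); exact: f0.
rewrite /= z in cv.
have cv0 : (cst 0%E : nat -> \bar R) n @[n --> \oo] --> 0%E by exact: cvg_cst.
have : (\int[vol d]_x (f x * \1_(obox a b) x)%:E = 0)%E.
  by apply: cvg_unique cv cv0; exact: ereal_hausdorff.
by rewrite (Rintegral_EFin (L2M_integrable f2 LI)) => -[].
Qed.

End density.

(** * Sobolev functions and translations *)

Section parametric_integral.
Context d1 d2 (X : measurableType d1) (Y : measurableType d2) (R : realType).
Context (m1 : {sigma_finite_measure set X -> \bar R}) (m2 : {sigma_finite_measure set Y -> \bar R}).
Implicit Types F : X * Y -> R.

Lemma measurable_Rintegral_snd F : measurable_fun setT F ->
  measurable_fun setT (fun x => Rintegral m2 setT (fun y => F (x, y))).
Proof.
move=> mF; rewrite /Rintegral; apply: measurableT_comp => //.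
have mE : measurable_fun setT (EFin \o F) by exact/measurable_EFinP.
rewrite (_ : (fun x => _) = (fun x => fubini_F m2 (EFin \o F)^\+%E x - fubini_F m2 (EFin \o F)^\-%E x)%E).
  apply: emeasurable_funB; apply: measurable_fun_fubini_tonelli_F => //.
  - exact: measurable_funepos.
  - exact: measurable_funeneg.
apply/funext => x; rewrite integralE; congr (_ - _)%E;
  by apply: eq_integral => y _; rewrite ?funeposE ?funenegE.
Qed.

Lemma fubini_Rintegral F (G : X -> R) (H : Y -> R) : measurable_fun setT F ->
  (\int[m2]_y \int[m1]_x `|(F (x, y))%:E| < +oo)%E ->
  measurable_fun setT G ->
  (\forall x \ae m1, (\int[m2]_y (F (x, y))%:E)%E = (G x)%:E) ->
  (forall y, (\int[m1]_x (F (x, y))%:E)%E = (H y)%:E) ->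
  Rintegral m1 setT G = Rintegral m2 setT H.
Proof.
move=> mF Foo mG aG EH; have mE : measurable_fun setT (EFin \o F) by exact/measurable_EFinP.
have iF : (m1 \x m2)%E.-integrable setT (EFin \o F) by apply/integrable21ltyP.
rewrite /Rintegral; congr fine.
have -> : (\int[m1]_x (G x)%:E = \int[m1]_x fubini_F m2 (EFin \o F) x)%E.
  apply: ae_eq_integral => //.
  - exact/measurable_EFinP.
  - exact: (measurable_fubini_F iF).
  - by apply: filterS aG => x /= xG _; rewrite -xG.
rewrite /fubini_F Fubini//; apply: eq_integral => y _; exact: EH.
Qed.

End parametric_integral.

Section shift.
Context {R : realType} (d : nat).
Implicit Types (f g : 'rV[R]_d -> R) (c : 'rV[R]_d).
Local Notation mu := (@vol R d).

Lemma measurable_shift c : measurable_fun setT (fun x : 'rV[R]_d => x + c).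
Proof. exact: measurable_rvD. Qed.

Lemma integral_vol_shift c (f : 'rV[R]_d -> \bar R) : measurable_fun setT f ->
  (\int[mu]_x f (x + c)%R = \int[mu]_x f x)%E.
Proof.
move=> mf; rewrite [LHS]integralE [RHS]integralE; congr (_ - _)%E.
- rewrite -[RHS](ge0_integral_vol_shift c)//; last exact: measurable_funepos.
  by apply: eq_integral => x _; rewrite !funeposE.
- rewrite -[RHS](ge0_integral_vol_shift c)//; last exact: measurable_funeneg.
  by apply: eq_integral => x _; rewrite !funenegE.
Qed.

Lemma measurable_comp_shift c f : measurable_fun setT f -> measurable_fun setT (fun x : 'rV[R]_d => f (x + c)).
Proof. by move=> mf; exact: (measurableT_comp mf (measurable_shift c)). Qed.

Lemma L2_shift c f : L2fun mu f -> L2fun mu (fun x : 'rV[R]_d => f (x + c)).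
Proof.
move=> [mf foo]; split; first exact: measurable_comp_shift.
rewrite (integral_vol_shift c (f := fun x : 'rV[R]_d => (f x ^+ 2)%:E))//.
by apply/measurable_EFinP; exact: measurable_funX.
Qed.

Lemma ip_shift c f g : measurable_fun setT f -> measurable_fun setT g ->
  ip mu (fun x : 'rV[R]_d => f (x + c)) (fun x : 'rV[R]_d => g (x + c)) = ip mu f g.
Proof.
move=> mf mg; rewrite /ip /Rintegral (integral_vol_shift c (f := fun x : 'rV[R]_d => (f x * g x)%:E))//.
by apply/measurable_EFinP; exact: measurable_funM.
Qed.

Lemma ip_shiftr c f g : measurable_fun setT f -> measurable_fun setT g ->
  ip mu f (fun x : 'rV[R]_d => g (x + c)) = ip mu (fun x : 'rV[R]_d => f (x - c)) g.
Proof.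
move=> mf mg; rewrite -(ip_shift c (f := fun x : 'rV[R]_d => f (x - c)))//; last exact: measurable_comp_shift.
by congr ip; apply/funext => x; rewrite addrK.
Qed.

Lemma partial_shift i c f x : partial i (fun y => f (y + c)) x = partial i f (x + c).
Proof.
have E : (fun h : R => h^-1 *: (f (h *: (delta_mx 0 i) + x + c) - f (x + c))) =
    (fun h : R => h^-1 *: (f (h *: (delta_mx 0 i) + (x + c)) - f (x + c))).
  by apply/funext => h; rewrite addrA.
by rewrite /partial /derive /= E.
Qed.

Lemma L2E f : L2 f <-> L2fun mu f.
Proof.
have E : measurable_fun setT f -> Int (fun x => (f x ^+ 2)%:E) = (\int[mu]_x (f x ^+ 2)%:E)%E.
  move=> mf; have mf2 : measurable_fun setT (fun x => (f x ^+ 2)%:E).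
    by apply/measurable_EFinP; exact: measurable_funX.
  by rewrite ge0_IntE// => x; rewrite lee_fin sqr_ge0.
split=> [[/rmeasE mf]|[mf]] foo; split=> //; [by rewrite -E|exact/rmeasE|by rewrite E].
Qed.

Definition sobolev f (g : 'I_d -> 'rV[R]_d -> R) :=
  [/\ L2fun mu f, forall i, L2fun mu (g i) & is_wgrad f g].

Lemma sobolev_ip f (g : 'I_d -> 'rV[R]_d -> R) i phi : sobolev f g -> test_fun phi -> L2fun mu phi ->
  L2fun mu (partial i phi) -> ip mu f (partial i phi) = - ip mu (g i) phi.
Proof.
move=> [f2 g2 fg] tphi phi2 dphi2; have := fg i phi tphi.
have [mf _] := f2; have [mg _] := g2 i; have [mp _] := phi2; have [mdp _] := dphi2.
rewrite !IntsE; [|exact: measurable_funM..].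
rewrite !Rintegral_EFin; [|exact: L2M_integrable..].
by move=> [].
Qed.

End shift.

Section shift_bump.
Context {R : realType} (d : nat).
Variables (c : R) (a b : 'I_d -> R).
Hypotheses (c0 : 0 < c) (ab : forall i, a i < b i).
Local Notation mu := (@vol R d).
Local Notation e i := (delta_mx 0 i : 'rV[R]_d).
Local Notation chi := (tbump c a b).
Local Notation dchi i := (tens (upd (fun j => bump c (a j) (b j)) i (bump' c a b i))).

Lemma tbump_shift s i : (fun x => chi (x + s *: e i)) =
  tbump c (fun j => a j - s * (j == i)%:R) (fun j => b j - s * (j == i)%:R).
Proof.
apply/funext => x; apply: eq_bigr => j _; rewrite !mxE eqxx/=.
rewrite /bump /bumpq !hornerE; congr (flat _ _ _); ring.
Qed.

Lemma test_fun_tbump_shift s i : test_fun (fun x => chi (x + s *: e i)).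
Proof. by rewrite tbump_shift; apply: test_fun_tbump => // j; rewrite ltrD2r. Qed.

Lemma continuous_dbump i : continuous (bump' c a b i).
Proof. by apply: smooth1_continuous; exact: smooth1_bumpq. Qed.

Lemma measurable_dchi i : measurable_fun setT (dchi i).
Proof.
apply: measurable_tens => j; rewrite /upd; case: ifP => _; first exact: continuous_dbump.
by apply: smooth1_continuous; exact: smooth1_bumpq.
Qed.

Lemma dchi_bound i : exists M, forall x, `|dchi i x| <= M * \1_(obox a b) x.
Proof.
have [M HM] := bumpq_bounded (bumpq_deriv (a i) (b i) c 1 0) 2 c0 (ab i).
have M0 : 0 <= M by apply: le_trans (HM 0).
exists M => x; rewrite indicE; have [xab|] := boolP (x \in obox a b).
  rewrite mulr1 tens_upd normrM -[leRHS]mulr1 ler_pM//; first exact: HM.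
  rewrite ger0_norm; last by apply: prodr_ge0 => j _; exact: bump_ge0.
  by apply: prodr_ile1 => j _; rewrite bump_ge0 bump_le1.
rewrite notin_setE mulr0 => xab; rewrite (@tens_out _ _ _ a b) ?normr0//.
by move=> j y jy; rewrite /upd; case: eqP jy => [-> jy|_ jy];
    [rewrite /bump' bumpq_out|rewrite /bump bumpq_out].
Qed.

Lemma L2_dchi i : L2fun mu (dchi i).
Proof.
have [M HM] := dchi_bound i; apply: (@L2_dom _ _ _ _ _ (fun x => M * \1_(obox a b) x)).
- exact: measurable_dchi.
- by apply: L2Z; apply: L2_indic; [exact: measurable_obox|exact: vol_obox_lty].
by move=> x; apply: le_trans (HM x) _; rewrite ler_norm.
Qed.

Lemma is_derive_chi_line i (x : 'rV[R]_d) s :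
  is_derive s (1 : R) (fun s => chi (x + s *: e i)) (dchi i (x + s *: e i)).
Proof.
have E r : x + r *: e i = r *: e i + x by rewrite addrC.
have := @is_derive_tens _ _ (fun i => bump c (a i) (b i)) i (bump' c a b i) (x + s *: e i)
  (is_derive_bumpq (a i) (b i) 1 0 ((x + s *: e i) 0 i) c0).
have H : (fun h : R => h^-1 *: (chi (h *: e i + (x + s *: e i)) - chi (x + s *: e i))) =
  (fun h : R => h^-1 *: (chi (x + (h *: (1:R) + s) *: e i) - chi (x + s *: e i))).
  by apply/funext => h; rewrite [_ *: (1:R)]mulr1 scalerDl addrCA.
move=> [dF vF]; apply: DeriveDef.
  by move: dF; rewrite /derivable /= -/chi H.
by rewrite -vF /derive /= H.
Qed.

Lemma ftc_chi i (x : 'rV[R]_d) t : 0 < t ->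
  (\int[lebesgue_measure]_(s in `[0%R, t]) (dchi i (x + s *: e i))%:E)%E =
  (chi (x + t *: e i) - chi x)%:E.
Proof.
move=> t0; have cF (s : R) : {for s, continuous (fun s : R => chi (x + s *: e i))}.
  apply/differentiable_continuous/derivable1_diffP.
  exact: (@ex_derive _ _ _ _ _ _ _ (is_derive_chi_line i x s)).
rewrite (@continuous_FTC2 _ _ (fun s : R => chi (x + s *: e i)) 0 t)//; first by rewrite scale0r addr0.
- apply: continuous_subspaceT => s.
  apply: (continuous_comp (f := fun s : R => x + s *: e i) (g := dchi i)).
    by apply: continuousD; [exact: cst_continuous|apply: scalel_continuous].
  apply: tens_continuous => j; rewrite /upd; case: ifP => _; first exact: continuous_dbump.
  by apply: smooth1_continuous; exact: smooth1_bumpq.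
- split.
  + by move=> s _; exact: (@ex_derive _ _ _ _ _ _ _ (is_derive_chi_line i x s)).
  + by apply: cvg_at_right_filter; exact: cF.
  + by apply: cvg_at_left_filter; exact: cF.
- move=> s _; rewrite derive1E; exact: (@derive_val _ _ _ _ _ _ _ (is_derive_chi_line i x s)).
Qed.

End shift_bump.

Section translation.
Context {R : realType} (d : nat).
Local Notation mu := (@vol R d).
Local Notation lam := (@lebesgue_measure R).
Local Notation e i := (delta_mx 0 i : 'rV[R]_d).

Lemma L2_indic_itv (t : R) : 0 <= t ->
  L2fun lam (\1_(`[0, t]%classic : set R)) /\
  ip lam (\1_(`[0, t]%classic : set R)) (\1_(`[0, t]%classic : set R)) = t.
Proof.
move=> t0; pose I : R -> R := \1_(`[0, t]%classic : set R).
have I2 s : I s ^+ 2 = I s.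
  by rewrite /I indicE; case: (_ \in _); rewrite ?expr1n ?expr0n.
have E : (\int[lam]_s (I s ^+ 2)%:E = t%:E)%E.
  under eq_integral do rewrite I2.
  rewrite integral_indic// setIT/= lebesgue_measure_itv/= lte_fin.
  by case: ltgtP t0 => // [_|<-] _; rewrite ?sube0// .
have L : L2fun lam I by split; [exact: measurable_indic|rewrite E ltry].
by split => //; apply: EFin_inj; rewrite -integral_sqrE.
Qed.

Section sobolev_line.
Variables (u : 'rV[R]_d -> R) (g : 'I_d -> 'rV[R]_d -> R) (i : 'I_d) (t : R).
Hypotheses (ug : sobolev u g) (t0 : 0 < t).

Let I : R -> R := \1_(`[0, t]%classic : set R).

Let I_01 s : 0 <= I s <= 1.
Proof. by rewrite /I indicE; case: (_ \in _); rewrite lexx ler01. Qed.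

Let I_idem s : I s * I s = I s.
Proof. by rewrite /I indicE; case: (_ \in _); rewrite ?mulr1 ?mulr0. Qed.

Let mI : measurable_fun setT I.
Proof. exact: measurable_indic. Qed.

Let I2 : L2fun lam I.
Proof. by have [] := L2_indic_itv (ltW t0). Qed.

Let IE : ip lam I I = t.
Proof. by have [] := L2_indic_itv (ltW t0). Qed.

Let g2 : L2fun mu (g i). Proof. by case: ug => _ + _; exact. Qed.
Let u2 : L2fun mu u. Proof. by have [] := ug. Qed.
Let mg : measurable_fun setT (g i). Proof. by have [] := g2. Qed.
Let mu' : measurable_fun setT u. Proof. by have [] := u2. Qed.

Let gl (z : 'rV[R]_d * R) := g i (z.1 - z.2 *: e i) * I z.2.

Let m_line (s : R) : measurable_fun setT (fun z : 'rV[R]_d * R => z.1 + (s * z.2) *: e i).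
Proof.
apply: measurable_rvD; first exact: measurable_fst.
by apply: measurable_rvZ; apply: measurable_funM => //; exact: measurable_snd.
Qed.

Let mgl0 : measurable_fun setT (fun z : 'rV[R]_d * R => g i (z.1 - z.2 *: e i)).
Proof.
rewrite (_ : (fun z => _) = g i \o (fun z : 'rV[R]_d * R => z.1 + (-1 * z.2) *: e i)).
  exact: (measurableT_comp mg (m_line (-1))).
by apply/funext => z /=; rewrite mulN1r scaleNr.
Qed.

Let mgl : measurable_fun setT gl.
Proof.
apply: measurable_funM; first exact: mgl0.
exact: (measurableT_comp mI measurable_snd).
Qed.

Let h x := Rintegral lam setT (fun s => gl (x, s)).
Let K x := (\int[lam]_s (gl (x, s) ^+ 2)%:E)%E.

Let mgl2 : measurable_fun setT (fun z => (gl z ^+ 2)%:E).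
Proof. by apply/measurable_EFinP; exact: measurable_funX. Qed.

Let mK : measurable_fun setT K.
Proof.
apply: (measurable_fun_fubini_tonelli_F (m2 := lam) (fun z : 'rV[R]_d * R => (gl z ^+ 2)%:E)) => //.
by move=> z; rewrite lee_fin sqr_ge0.
Qed.

Let mh : measurable_fun setT h.
Proof. exact: (measurable_Rintegral_snd lam mgl). Qed.

Let shiftN s : (fun x => g i (x - s *: e i)) = (fun x => g i (x + (- s *: e i))).
Proof. by apply/funext => x; rewrite scaleNr. Qed.

Let g2s s : L2fun mu (fun x => g i (x - s *: e i)).
Proof. by rewrite shiftN; exact: L2_shift. Qed.

Let intK : (\int[mu]_x K x = (t * ip mu (g i) (g i))%:E)%E.
Proof.
apply: (etrans (fubini_tonelli (m1 := mu) (m2 := lam)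
  (fun z : 'rV[R]_d * R => (gl z ^+ 2)%:E) _ _)) => //.
  by move=> z; rewrite lee_fin sqr_ge0.
transitivity (\int[lam]_s (I s * I s * ip mu (g i) (g i))%:E)%E.
  apply: eq_integral => s _.
  have -> : (\int[mu]_x (gl (x, s) ^+ 2)%:E =
      \int[mu]_x ((I s * g i (x - s *: e i)) ^+ 2)%:E)%E.
    by apply: eq_integral => x _; rewrite /gl mulrC.
  rewrite integral_sqrE; last exact: L2Z.
  rewrite ipZl// ?ipZr//; last exact: L2Z.
  by rewrite mulrA shiftN ip_shift.
rewrite -IE Rintegral_EFin.
  congr (_%:E); rewrite RintegralZr//; exact: L2M_integrable.
exact: (integrableZr measurableT (ip mu (g i) (g i)) (L2M_integrable I2 I2)).
Qed.

Let K_ae : \forall x \ae mu, (K x < +oo)%E.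
Proof.
have iK : mu.-integrable setT K.
  apply/integrableP; split=> //.
  have -> : (\int[mu]_x `|K x| = \int[mu]_x K x)%E.
    apply: eq_integral => x _; rewrite gee0_abs//; apply: integral_ge0 => s _.
    by rewrite lee_fin sqr_ge0.
  by rewrite intK ltry.
apply: filterS (integrable_ae measurableT iK) => x /(_ Logic.I).
by rewrite ltey; case: (K x).
Qed.

Let gl2 x : (K x < +oo)%E -> L2fun lam (fun s => gl (x, s)).
Proof. by move=> Kx; split => //; exact: (measurableT_comp mgl). Qed.

Let glI x s : gl (x, s) * I s = gl (x, s).
Proof. by rewrite /gl/= -mulrA I_idem. Qed.

Let hE x : h x = ip lam (fun s => gl (x, s)) I.
Proof. by rewrite /h /ip; under [in RHS]eq_Rintegral do rewrite glI. Qed.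

Let h_le x : ((h x ^+ 2)%:E <= t%:E * K x)%E.
Proof.
have [Koo|] := ltP (K x) +oo%E.
  have Lx := gl2 Koo; rewrite /K integral_sqrE// -EFinM lee_fin hE mulrC -IE.
  exact: cauchy_schwarz.
by rewrite leye_eq => /eqP ->; rewrite gt0_muley ?leey ?lte_fin.
Qed.

Let int_h : (\int[mu]_x (h x ^+ 2)%:E <= (t ^+ 2 * ip mu (g i) (g i))%:E)%E.
Proof.
rewrite expr2 -mulrA EFinM -intK -ge0_integralZl//; last 2 first.
- by move=> x _; apply: integral_ge0 => s _; rewrite lee_fin sqr_ge0.
- by rewrite lee_fin ltW.
apply: ge0_le_integral => //.
- by move=> x _; rewrite lee_fin sqr_ge0.
- by apply/measurable_EFinP; exact: measurable_funX.
- by apply: emeasurable_funM.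
Qed.

Let h2 : L2fun mu h.
Proof. by split=> //; apply: le_lt_trans int_h _; rewrite ltry. Qed.

Section against_bump.
Variables (c : R) (a b : 'I_d -> R).
Hypotheses (c0 : 0 < c) (ab : forall i, a i < b i).
Local Notation chi := (tbump c a b).
Local Notation dchi := (tens (upd (fun j => bump c (a j) (b j)) i (bump' c a b i))).

Let chi2 : L2fun mu chi. Proof. exact: L2_tbump. Qed.
Let mchi : measurable_fun setT chi. Proof. exact: measurable_tbump. Qed.
Let dchi2 : L2fun mu dchi. Proof. exact: L2_dchi. Qed.
Let mdchi : measurable_fun setT dchi. Proof. exact: measurable_dchi. Qed.

Let by_parts s : ip mu u (fun x => dchi (x + s *: e i)) =
  - ip mu (fun x => g i (x - s *: e i)) chi.
Proof.
rewrite -ip_shiftr//.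
have D : partial i (fun x => chi (x + s *: e i)) = (fun x => dchi (x + s *: e i)).
  by apply/funext => x; rewrite partial_shift partial_tbump.
rewrite -D; apply: (sobolev_ip ug); first exact: test_fun_tbump_shift.
- exact: L2_shift.
- by rewrite D; exact: L2_shift.
Qed.

Let bound_prod (f f' : 'rV[R]_d * R -> R) (C : R) :
  measurable_fun setT f -> measurable_fun setT f' ->
  (forall s, L2fun mu (fun x => f (x, s))) -> (forall s, L2fun mu (fun x => f' (x, s))) ->
  (forall s, ip mu (fun x => f (x, s)) (fun x => f (x, s)) <= C) ->
  (forall s, ip mu (fun x => f' (x, s)) (fun x => f' (x, s)) <= C) ->
  (\int[lam]_s \int[mu]_x `|(f (x, s) * f' (x, s) * I s)%:E| < +oo)%E.
Proof.
move=> mf mf' f2 f2' fC fC'.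
have C0 : 0 <= C by apply: le_trans (fC 0); exact: ip_ge0.
have mP : measurable_fun setT (fun z => `|(f z * f' z * I z.2)%:E|%E).
  apply: measurableT_comp => //; apply/measurable_EFinP; apply: measurable_funM.
    exact: measurable_funM.
  exact: (measurableT_comp mI measurable_snd).
apply: (@le_lt_trans _ _ (\int[lam]_s ((C + C) * I s)%:E)%E); last first.
  have -> : (\int[lam]_s ((C + C) * I s)%:E = \int[lam]_s ((C + C)%:E * (I s * I s)%:E))%E.
    by apply: eq_integral => s _; rewrite I_idem.
  rewrite integralZl//; last exact: L2M_integrable.
  by rewrite Rintegral_EFin ?ltry//; exact: L2M_integrable.
apply: ge0_le_integral => //.
- by move=> s _; exact: integral_ge0.
- exact: (measurable_fun_fubini_tonelli_G (fun z => `|(f z * f' z * I z.2)%:E|%E)).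
- by apply/measurable_EFinP; exact: measurable_funM.
move=> s _; have /andP[Is0 Is1] := I_01 s.
apply: (@le_trans _ _ (\int[mu]_x ((I s)%:E * ((f (x, s) ^+ 2)%:E + (f' (x, s) ^+ 2)%:E)))%E).
  apply: ge0_le_integral => //.
  - exact: (measurableT_comp mP).
  - apply: emeasurable_funM => //; apply: emeasurable_funD;
      apply/measurable_EFinP; apply: measurable_funX.
    + by have [] := f2 s.
    + by have [] := f2' s.
  move=> x _; rewrite abse_EFin -EFinD -EFinM lee_fin 2!normrM (ger0_norm Is0) mulrC.
  rewrite ler_wpM2l// -(real_normK (num_real (f (x, s)))) -(real_normK (num_real (f' (x, s)))).
  by have := sqr_ge0 (`|f (x, s)| - `|f' (x, s)|); have := normr_ge0 (f (x, s));
    have := normr_ge0 (f' (x, s)); nra.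
rewrite integralZl//; last first.
  by apply: integrableD => //; exact: L2_integrable_sqr.
rewrite integralD//; [|exact: L2_integrable_sqr..].
by rewrite !integral_sqrE// -EFinD -EFinM lee_fin mulrC ler_wpM2r// lerD.
Qed.

Let fubini_g : ip mu h chi = Rintegral lam setT (fun s => ip mu (fun x => g i (x - s *: e i)) chi * I s).
Proof.
pose F (z : 'rV[R]_d * R) := g i (z.1 - z.2 *: e i) * chi z.1 * I z.2.
have mchi1 : measurable_fun setT (fun z : 'rV[R]_d * R => chi z.1).
  exact: (measurableT_comp mchi measurable_fst).
apply: (@fubini_Rintegral _ _ _ _ _ mu lam F).
- apply: measurable_funM; first exact: measurable_funM.
  exact: (measurableT_comp mI measurable_snd).
- apply: (bound_prod (f := fun z => g i (z.1 - z.2 *: e i)) (f' := fun z => chi z.1)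
    (C := ip mu (g i) (g i) + ip mu chi chi)) => //= s.
  + by rewrite shiftN ip_shift// lerDl ip_ge0.
  + by rewrite lerDr ip_ge0.
- exact: measurable_funM.
- apply: filterS K_ae => x Kx; have Lx := gl2 Kx.
  have iL : lam.-integrable setT (EFin \o (fun s => gl (x, s))).
    by have := L2M_integrable Lx I2; congr integrable; apply/funext => s /=; rewrite glI.
  have -> : (\int[lam]_s (F (x, s))%:E = \int[lam]_s ((chi x)%:E * (gl (x, s))%:E))%E.
    by apply: eq_integral => s _; rewrite /F /gl/= -EFinM; congr (_%:E); ring.
  by rewrite integralZl// Rintegral_EFin// -EFinM mulrC.
- move=> s.
  have -> : (\int[mu]_x (F (x, s))%:E =
      \int[mu]_x ((I s)%:E * (g i (x - s *: e i) * chi x)%:E))%E.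
    by apply: eq_integral => x _; rewrite /F /= -EFinM mulrC.
  rewrite integralZl//; last exact: L2M_integrable.
  by rewrite Rintegral_EFin; [rewrite -EFinM mulrC|exact: L2M_integrable].
Qed.

Let fubini_u : ip mu u (fun x => chi x - chi (x + t *: e i)) =
  Rintegral lam setT (fun s => - ip mu u (fun x => dchi (x + s *: e i)) * I s).
Proof.
pose F (z : 'rV[R]_d * R) := - u z.1 * dchi (z.1 + z.2 *: e i) * I z.2.
have uN2 := L2N u2.
have mu1 : measurable_fun setT (fun z : 'rV[R]_d * R => - u z.1).
  by apply: measurable_funN; exact: (measurableT_comp mu' measurable_fst).
have md1 : measurable_fun setT (fun z : 'rV[R]_d * R => dchi (z.1 + z.2 *: e i)).
  rewrite (_ : (fun z => _) = dchi \o (fun z : 'rV[R]_d * R => z.1 + (1 * z.2) *: e i)).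
    exact: (measurableT_comp mdchi (m_line 1)).
  by apply/funext => z /=; rewrite mul1r.
apply: (@fubini_Rintegral _ _ _ _ _ mu lam F).
- apply: measurable_funM; first exact: measurable_funM.
  exact: (measurableT_comp mI measurable_snd).
- apply: (bound_prod (f := fun z => - u z.1) (f' := fun z => dchi (z.1 + z.2 *: e i))
    (C := ip mu (fun x => - u x) (fun x => - u x) + ip mu dchi dchi)) => //= s.
  + exact: L2_shift.
  + by rewrite lerDl ip_ge0.
  + by rewrite ip_shift// lerDr ip_ge0.
- apply: measurable_funM => //; apply: measurable_funB => //; exact: measurable_comp_shift.
- apply: aeW => x; have ftc := ftc_chi a b c0 i x t0.
  have iD : lam.-integrable setT (fun s => (dchi (x + s *: e i) * I s)%:E).
    have [M HM] := dchi_bound c0 ab i.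
    apply: (@le_integrable_EFin _ _ _ lam (fun s => dchi (x + s *: e i) * I s) (fun s => M * (I s * I s))).
    + apply: measurable_funM => //.
      have mp : measurable_fun setT (fun s : R => (x, s)) by exact: measurable_fun_pair.
      exact: (measurableT_comp md1 mp).
    + exact: (integrableZl measurableT M (L2M_integrable I2 I2)).
    move=> s; have /andP[Is0 Is1] := I_01 s.
    rewrite I_idem normrM (ger0_norm Is0) ler_wpM2r//; apply: le_trans (HM _) _.
    have M0 : 0 <= M.
      have := HM (\row_j ((a j + b j) / 2)); rewrite indicE mem_set ?mulr1; first exact: le_trans.
      by move=> j /=; rewrite mxE in_itv/=; have := ab j; lra.
    by rewrite ler_piMr// indicE; case: (_ \in _).
  have -> : (\int[lam]_s (F (x, s))%:E =
      \int[lam]_s ((- u x)%:E * (dchi (x + s *: e i) * I s)%:E))%E.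
    by apply: eq_integral => s _; rewrite /F/= -EFinM mulrA.
  rewrite integralZl//.
  have -> : u x * (chi x - chi (x + t *: e i)) = - u x * (chi (x + t *: e i) - chi x).
    by ring.
  rewrite EFinM -ftc; congr (_ * _)%E; rewrite [RHS]integral_mkcond.
  apply: eq_integral => s _; rewrite /patch /I indicE.
  by case: (_ \in _); rewrite ?mulr1 ?mulr0.
- move=> s; have d2s : L2fun mu (fun x => dchi (x + s *: e i)) by exact: L2_shift.
  have -> : (\int[mu]_x (F (x, s))%:E =
      \int[mu]_x ((- I s)%:E * (u x * dchi (x + s *: e i))%:E))%E.
    by apply: eq_integral => x _; rewrite /F /= -EFinM; congr (_%:E); ring.
  rewrite integralZl//; last exact: L2M_integrable.
  by rewrite Rintegral_EFin; [rewrite -EFinM mulNr mulrC -mulNr|exact: L2M_integrable].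
Qed.

Lemma ip_difference_bump : ip mu (fun x => h x - (u x - u (x - t *: e i))) chi = 0.
Proof.
have us2 : L2fun mu (fun x => u (x - t *: e i)).
  by have := L2_shift (- (t *: e i)) u2.
have cs2 := L2_shift (t *: e i) chi2.
rewrite ipBl//; last exact: L2B.
rewrite ipBl// -ip_shiftr//.
rewrite -ipBr// fubini_u fubini_g; apply/eqP; rewrite subr_eq0; apply/eqP.
by apply: eq_Rintegral => s _; rewrite by_parts opprK.
Qed.

End against_bump.

Lemma difference_backward_le :
  ip mu (fun x => u x - u (x - t *: e i)) (fun x => u x - u (x - t *: e i)) <=
  t ^+ 2 * ip mu (g i) (g i).
Proof.
have us2 : L2fun mu (fun x => u (x - t *: e i)).
  by have := L2_shift (- (t *: e i)) u2.
have ds2 := L2B u2 us2.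
have := ae_eq0_tbump (L2B h2 ds2) ip_difference_bump.
move=> h0; rewrite -lee_fin -integral_sqrE//; apply: le_trans int_h.
rewrite le_eqVlt; apply/orP; left; apply/eqP; apply: ae_eq_integral => //.
- by apply/measurable_EFinP; apply: measurable_funX; have [] := ds2.
- by apply/measurable_EFinP; exact: measurable_funX.
- by apply: filterS h0 => x /eqP; rewrite subr_eq0 => /eqP ->.
Qed.

End sobolev_line.

(* [u (x + t e_i) - u x] is the integral of [g i] along the segment: this holds
   after testing against bump functions, which determine an L2 function. *)
Lemma translation_le (u : 'rV[R]_d -> R) g i (t : R) : sobolev u g ->
  ip mu (fun x => u (x + t *: e i) - u x) (fun x => u (x + t *: e i) - u x) <=
  t ^+ 2 * ip mu (g i) (g i).
Proof.
move=> ug; have [u2 _ _] := ug; have [mu' _] := u2.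
have [t0|t0|->] := ltrgtP t 0; last first.
- rewrite expr0n mul0r (_ : (fun x => _) = (fun=> 0)).
    by rewrite /ip (_ : (fun x => _) = cst 0) ?Rintegral_cst ?mul0r//; apply/funext => x; rewrite mul0r.
  by apply/funext => x; rewrite scale0r addr0 subrr.
- have m1 : measurable_fun setT (fun x : 'rV[R]_d => u (x + t *: e i) - u x).
    by apply: measurable_funB => //; exact: measurable_comp_shift.
  rewrite -(ip_shift (- (t *: e i)))//.
  have := difference_backward_le i ug t0; congr (_ <= _); congr ip;
    by apply/funext => x; rewrite subrK.
- have Nt0 : 0 < - t by rewrite oppr_gt0.
  have := difference_backward_le i ug Nt0; rewrite sqrrN; congr (_ <= _).
  rewrite /ip; apply: eq_Rintegral => x _; rewrite scaleNr opprK; ring.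
Qed.

End translation.

(** * Gagliardo-Nirenberg inequality *)

Section GN.
Context {R : realType} (d : nat).
Local Notation mu := (@vol R d).
Local Notation e i := (delta_mx 0 i : 'rV[R]_d).
Implicit Types (w : 'rV[R]_d -> R) (g : 'I_d -> 'rV[R]_d -> R) (x z : 'rV[R]_d).

Definition dirichlet g : R := \sum_(i < d) ip mu (g i) (g i).

Lemma dirichlet_ge0 g : 0 <= dirichlet g.
Proof. by apply: sumr_ge0 => i _; exact: ip_ge0. Qed.

Lemma ip_sqrD_le w w' : L2fun mu w -> L2fun mu w' ->
  ip mu (fun x => w x + w' x) (fun x => w x + w' x) <= 2 * ip mu w w + 2 * ip mu w' w'.
Proof.
move=> w2 w2'; rewrite ip_sqrD//.
have := ip_ge0 mu (fun x => w x - w' x); rewrite ip_sqrB//; lra.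
Qed.

Lemma translation_vec_le w g z (s : seq 'I_d) : sobolev w g ->
  ip mu (fun x => w (x + \sum_(j <- s) z 0 j *: e j) - w x)
        (fun x => w (x + \sum_(j <- s) z 0 j *: e j) - w x) <=
  2 ^+ size s * \sum_(j <- s) z 0 j ^+ 2 * ip mu (g j) (g j).
Proof.
move=> wg; have [w2 _ _] := wg; have [mw _] := w2.
elim: s => [|i s IH].
  rewrite !big_nil mulr0 (_ : (fun x => _) = (fun=> 0)); last first.
    by apply/funext => x; rewrite addr0 subrr.
  by rewrite /ip (_ : (fun x => _) = cst 0) ?Rintegral_cst ?mul0r//; apply/funext => x; rewrite mul0r.
rewrite !big_cons; set zs := \sum_(j <- s) _ in IH *.
have ws2 := L2_shift zs w2.
have wi2 := L2_shift (z 0 i *: e i) w2.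
pose D x := w (x + z 0 i *: e i) - w x.
have D2 : L2fun mu D by exact: L2B.
have := ip_sqrD_le (L2_shift zs D2) (L2B ws2 w2).
rewrite ip_shift; [|by case: D2..].
have -> : (fun x => D (x + zs) + (w (x + zs) - w x)) = (fun x => w (x + (z 0 i *: e i + zs)) - w x).
  by apply/funext => x; rewrite /D addrA subrK addrAC addrA.
move=> /le_trans; apply; rewrite /= exprS mulrDr.
apply: lerD.
  rewrite -mulrA ler_wpM2l//; apply: le_trans (translation_le i (z 0 i) wg) _.
  by rewrite ler_peMl ?exprn_ege1 ?ler1n// mulr_ge0 ?sqr_ge0 ?ip_ge0.
by rewrite -mulrA ler_wpM2l.
Qed.

Lemma sum_delta_mx z : \sum_(j <- index_enum 'I_d) z 0 j *: e j = z.
Proof. by rewrite [RHS]row_sum_delta. Qed.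

Definition cube (r : R) : set 'rV[R]_d :=
  [set z | forall i, (`[- r, r]%classic : set R) (z 0 i)].

Lemma measurable_cube r : measurable (cube r).
Proof. exact: (measurable_prodrv (A := fun i => `[- r, r]%classic)). Qed.

Lemma vol_cube r : 0 < r -> vol d (cube r) = ((2 * r) ^+ d)%:E.
Proof.
move=> r0; rewrite [LHS](vol_prodrv (A := fun i => `[- r, r]%classic))//.
rewrite (eq_bigr (fun=> (2 * r)%:E)) ?prodEFin ?prodr_const ?card_ord// => i _.
rewrite lebesgue_measure_itv/= lte_fin ifT ?gt0_cp// -EFinB; congr (_%:E); ring.
Qed.

Lemma integral_cube r (C : R) : 0 < r -> 0 <= C ->
  (\int[mu]_z (C%:E * (\1_(cube r) z)%:E) = ((2 * r) ^+ d * C)%:E)%E.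
Proof.
move=> r0 C0; have mc := measurable_cube r.
rewrite ge0_integralZl//; last exact/measurable_EFinP/measurable_indic.
have -> : (\int[mu]_z (\1_(cube r) z)%:E = ((2 * r) ^+ d)%:E)%E.
  by rewrite integral_indic// setIT; exact: vol_cube.
by rewrite -EFinM mulrC.
Qed.

Lemma translation_cube_le w g r z : sobolev w g -> cube r z ->
  ip mu (fun x => w (x + z) - w x) (fun x => w (x + z) - w x) <=
  2 ^+ d * r ^+ 2 * dirichlet g.
Proof.
move=> wg zr; have := translation_vec_le z (index_enum 'I_d) wg.
rewrite sum_delta_mx => /le_trans; apply.
have -> : size (index_enum 'I_d) = d by rewrite -[RHS]card_ord cardT enumT.
rewrite -mulrA ler_wpM2l ?exprn_ge0// mulr_sumr; apply: ler_sum => i _.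
rewrite ler_wpM2r ?ip_ge0//; have := zr i; rewrite /= in_itv/=; nra.
Qed.

Definition osc (r : R) w x : \bar R :=
  (\int[mu]_z ((w (x + z) - w x) ^+ 2 * \1_(cube r) z)%:E)%E.

Lemma osc_ge0 r w x : (0 <= osc r w x)%E.
Proof. by apply: integral_ge0 => z _; rewrite lee_fin mulr_ge0 ?sqr_ge0. Qed.

Let measurable_add : measurable_fun setT (fun q : 'rV[R]_d * 'rV[R]_d => q.1 + q.2).
Proof. by apply: measurable_rvD; [exact: measurable_fst|exact: measurable_snd]. Qed.

Let measurable_osc_integrand r w : measurable_fun setT w ->
  measurable_fun setT (fun q : 'rV[R]_d * 'rV[R]_d =>
    ((w (q.1 + q.2) - w q.1) ^+ 2 * \1_(cube r) q.2)%:E).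
Proof.
move=> mw; apply/measurable_EFinP; apply: measurable_funM.
  apply: measurable_funX; apply: measurable_funB.
    exact: (measurableT_comp mw measurable_add).
  exact: (measurableT_comp mw measurable_fst).
have m1 : measurable_fun setT (fun z => (\1_(cube r) z : R)).
  by apply: measurable_indic; exact: measurable_cube.
exact: (measurableT_comp m1 measurable_snd).
Qed.

Lemma measurable_osc r w : measurable_fun setT w -> measurable_fun setT (osc r w).
Proof.
move=> mw; apply: (measurable_fun_fubini_tonelli_F (m2 := mu) (fun q : 'rV[R]_d * 'rV[R]_d =>
    ((w (q.1 + q.2) - w q.1) ^+ 2 * \1_(cube r) q.2)%:E)).
- exact: measurable_osc_integrand.
- by move=> q; rewrite lee_fin mulr_ge0 ?sqr_ge0.
Qed.

Lemma integral_osc_le r w g : 0 < r -> sobolev w g ->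
  (\int[mu]_x osc r w x <= ((2 * r) ^+ d * (2 ^+ d * r ^+ 2 * dirichlet g))%:E)%E.
Proof.
move=> r0 wg; have [w2 _ _] := wg; have [mw _] := w2.
have -> : (\int[mu]_x osc r w x =
    \int[mu]_z \int[mu]_x ((w (x + z)%R - w x) ^+ 2 * \1_(cube r) z)%:E)%E.
  apply: (etrans (fubini_tonelli (m1 := mu) (m2 := mu) (fun q : 'rV[R]_d * 'rV[R]_d =>
    ((w (q.1 + q.2) - w q.1) ^+ 2 * \1_(cube r) q.2)%:E) _ _)) => //=.
  - exact: measurable_osc_integrand.
  - by move=> q; rewrite lee_fin mulr_ge0 ?sqr_ge0.
set C := 2 ^+ d * _ * _.
rewrite -integral_cube//; last by rewrite mulr_ge0 ?dirichlet_ge0// mulr_ge0 ?sqr_ge0 ?exprn_ge0.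
apply: ge0_le_integral => //.
- by move=> z _; apply: integral_ge0 => x _; rewrite lee_fin mulr_ge0 ?sqr_ge0.
- apply: (measurable_fun_fubini_tonelli_G (m1 := mu) (fun q : 'rV[R]_d * 'rV[R]_d =>
    ((w (q.1 + q.2) - w q.1) ^+ 2 * \1_(cube r) q.2)%:E)).
  + exact: measurable_osc_integrand.
  + by move=> q; rewrite lee_fin mulr_ge0 ?sqr_ge0.
- apply: emeasurable_funM => //; apply/measurable_EFinP.
  by apply: measurable_indic; exact: measurable_cube.
move=> z _; have d2 : L2fun mu (fun x => w (x + z) - w x).
  by apply: L2B => //; exact: L2_shift.
rewrite indicE; have [zc|zc] := boolP (z \in cube r).
  under eq_integral do rewrite mulr1.
  rewrite integral_sqrE// mule1 lee_fin; apply: translation_cube_le => //.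
  by move: zc; rewrite inE.
by rewrite mule0 integral0_eq// => x _; rewrite mulr0.
Qed.

Lemma sqr_le_osc r w x : 0 < r -> L2fun mu w ->
  (((2 * r) ^+ d * w x ^+ 2)%:E <= 2%:E * osc r w x + (2 * ip mu w w)%:E)%E.
Proof.
move=> r0 w2; have [mw _] := w2.
have m1 : measurable_fun setT (fun z => (\1_(cube r) z : R)).
  by apply: measurable_indic; exact: measurable_cube.
have m2 : measurable_fun setT (fun z : 'rV[R]_d => w (x + z)).
  by rewrite (_ : (fun z => _) = (fun z => w (z + x))); [exact: measurable_comp_shift|
    apply/funext => z; rewrite addrC].
rewrite -integral_cube ?sqr_ge0//.
have -> : (2 * ip mu w w)%:E = (2%:E * \int[mu]_z ((w (x + z)) ^+ 2)%:E)%E.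
  rewrite EFinM -integral_sqrE//; congr (_ * _)%E.
  rewrite -(integral_vol_shift x (f := fun z => (w z ^+ 2)%:E)).
    by apply: eq_integral => z _; rewrite addrC.
  by apply/measurable_EFinP; exact: measurable_funX.
rewrite /osc -!ge0_integralZl//; last first.
- by move=> z _; rewrite lee_fin mulr_ge0 ?sqr_ge0.
- apply/measurable_EFinP; apply: measurable_funM => //; apply: measurable_funX.
  exact: measurable_funB.
- by move=> z _; rewrite lee_fin sqr_ge0.
- by apply/measurable_EFinP; exact: measurable_funX.
rewrite -ge0_integralD//; last first.
- by apply: emeasurable_funM => //; apply/measurable_EFinP; exact: measurable_funX.
- by move=> z _; rewrite -EFinM lee_fin mulr_ge0 ?sqr_ge0.
- apply: emeasurable_funM => //; apply/measurable_EFinP; apply: measurable_funM => //.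
  by apply: measurable_funX; exact: measurable_funB.
- by move=> z _; rewrite -EFinM lee_fin mulr_ge0// mulr_ge0 ?sqr_ge0.
apply: ge0_le_integral => //.
- by move=> z _; rewrite -EFinM lee_fin mulr_ge0 ?sqr_ge0.
- by apply: emeasurable_funM => //; exact/measurable_EFinP.
- apply: emeasurable_funD; apply: emeasurable_funM => //; apply/measurable_EFinP.
    by apply: measurable_funM => //; apply: measurable_funX; exact: measurable_funB.
  exact: measurable_funX.
move=> z _; rewrite -!EFinM -EFinD lee_fin indicE; case: (_ \in _).
  by rewrite !mulr1; have := sqr_ge0 (w (x + z) - w x + w (x + z)); nra.
by rewrite !mulr0 add0r mulr_ge0 ?sqr_ge0.
Qed.

End GN.

Section GN_power.
Context {R : realType} (d : nat).
Local Notation mu := (@vol R d).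
Variable q : R.
Hypotheses (d1 : (1 <= d)%N) (q0 : 0 < q) (qd : q * d%:R < 4).

Let lam n : R := 2 * 2 ^+ (n * d).

Let lam_gt0 n : 0 < lam n. Proof. by rewrite mulr_gt0 ?exprn_gt0. Qed.

Let lam_ge0 n : 0 <= lam n. Proof. exact: ltW. Qed.

Let r_ n : R := 2^-1 * 4 ^- n.

Let r_gt0 n : 0 < r_ n. Proof. by rewrite mulr_gt0 ?invr_gt0 ?exprn_gt0. Qed.

Let r_pow n : (2 * r_ n) ^+ d = 4 ^- (n * d).
Proof. by rewrite /r_ mulrA mulfV// mul1r -!exprVn exprM. Qed.

Let lam_sqr n : lam n ^+ 2 = 4 * 4 ^+ (n * d).
Proof. by rewrite /lam exprMn -exprM mulnC exprM (_ : 2 ^+ 2 = 4)//; ring. Qed.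

Let lam_unbounded (M : R) : exists n, M < lam n.
Proof.
exists (Num.trunc M).+1; apply: lt_le_trans (truncnS_gt _) _.
set n := _.+1; apply: (@le_trans _ _ (2 ^+ (n * d))).
  rewrite -natrX ler_nat; apply: leq_trans (ltnW (ltn_expl n (ltnSn 1))) _.
  by rewrite leq_exp2l// leq_pmulr.
by rewrite ler_peMl ?exprn_ge0// ler1n.
Qed.

Let level j (y : R) : lam j <= y -> exists n, lam (j + n) <= y < lam (j + n.+1).
Proof.
move=> jy; have ex : exists n, y < lam (j + n).
  have [n yn] := lam_unbounded y; exists n; apply: lt_le_trans yn _.
  by rewrite /lam ler_pM2l// ler_eXn2l ?ltr1n// leq_mul2r leq_addl orbT.
case: (ex_minnP ex) => -[|n]; first by rewrite addn0 ltNge jy.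
move=> yn min; exists n; rewrite yn andbT leNgt; apply/negP => /min.
by rewrite ltnn.
Qed.

Let coef n : R := lam n.+1 `^ q * (4 * 4 ^+ (n * d)).

Let coef_ge0 n : 0 <= coef n.
Proof. by rewrite mulr_ge0 ?powR_ge0 ?mulr_ge0 ?exprn_ge0. Qed.

Lemma powR_sqr (y : R) : `|y| `^ (q + 2) = `|y| `^ q * y ^+ 2.
Proof.
rewrite powRD; last by rewrite gt_eqF ?addr_gt0.
by rewrite (powR_mulrn 2)// real_normK ?num_real.
Qed.

Let pointwise j (w : 'rV[R]_d -> R) x : L2fun mu w -> ip mu w w <= 1 ->
  ((`|w x| `^ (q + 2))%:E <= (lam j `^ q * w x ^+ 2)%:E +
    \sum_(0 <= n <oo) ((coef (j + n))%:E * osc (r_ (j + n)) w x))%E.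
Proof.
move=> w2 w1; have s0 n : (0 <= (coef (j + n))%:E * osc (r_ (j + n)) w x)%E.
  by rewrite mule_ge0 ?osc_ge0// lee_fin.
rewrite powR_sqr; have [wj|] := leP (lam j) `|w x|; last first.
  move=> /ltW wj; apply: (@le_trans _ _ (lam j `^ q * w x ^+ 2)%:E).
    by rewrite lee_fin ler_wpM2r ?sqr_ge0// ge0_ler_powR ?nnegrE// ltW.
  by rewrite leeDl// nneseries_ge0.
have [n /andP[wn wn1]] := level wj.
apply: (@le_trans _ _ ((coef (j + n))%:E * osc (r_ (j + n)) w x)%E); last first.
  apply: (@le_trans _ _ (\sum_(0 <= n <oo) ((coef (j + n))%:E * osc (r_ (j + n)) w x))%E).
    apply: le_trans (nneseries_lim_ge n.+1 _); last by move=> *; exact: s0.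
    by rewrite big_nat_recr//= leeDr// sume_ge0.
  by rewrite leeDr// lee_fin mulr_ge0 ?powR_ge0 ?sqr_ge0.
set m := (j + n)%N in wn *.
have := sqr_le_osc x (r_gt0 m) w2; rewrite r_pow => H.
have wm : 4 * 4 ^+ (m * d) <= w x ^+ 2.
  by rewrite -lam_sqr -(real_normK (num_real (w x))) lerXn2r ?nnegrE.
have F0 : 0 < 4 ^+ (m * d) :> R by rewrite exprn_gt0.
have H2 : ((4 ^- (m * d) * w x ^+ 2)%:E <= 4%:E * osc (r_ m) w x)%E.
  case: (osc (r_ m) w x) (osc_ge0 (r_ m) w x) H => [z|_ _|//]; last by rewrite gt0_muley ?lte_fin// leey.
  rewrite -!EFinM -EFinD !lee_fin => z0 H.
  have := wm; rewrite -ler_pdivlMr// mulrC => H3.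
  lra.
have -> : coef m = lam m.+1 `^ q * 4 ^+ (m * d) * 4 by rewrite /coef; ring.
rewrite [(_ * 4)%:E]EFinM -muleA; apply: (@le_trans _ _ ((lam m.+1 `^ q * 4 ^+ (m * d))%:E * (4 ^- (m * d) * w x ^+ 2)%:E)%E); last first.
  by apply: lee_wpmul2l => //; rewrite lee_fin mulr_ge0 ?powR_ge0 ?ltW.
rewrite -EFinM lee_fin -[leRHS]mulrA mulVKf ?gt_eqF// ler_wpM2r ?sqr_ge0//.
by rewrite ge0_ler_powR ?nnegrE ?(ltW q0)// /m -addnS ltW.
Qed.

Let kappa : R := 2 `^ (q * d%:R) / 16.

Let kappa_ge0 : 0 <= kappa. Proof. by rewrite divr_ge0 ?powR_ge0. Qed.

Let kappa_lt1 : kappa < 1.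
Proof.
rewrite ltr_pdivrMr// mul1r (_ : 16 = 2 `^ 4%:R :> R); last first.
  by rewrite (powR_mulrn 4)//; ring.
by rewrite /powR pnatr_eq0/= ltr_expR ltr_pM2r// ln_gt0// ltr1n.
Qed.

Let A : R := 2 ^+ d * (2 * 2 ^+ d) `^ q.


Let coef_le n (G : R) : coef n * ((2 * r_ n) ^+ d * (2 ^+ d * r_ n ^+ 2 * G)) = A * G * kappa ^+ n.
Proof.
rewrite r_pow /coef.
have F0 : 4 ^+ (n * d) != 0 :> R by rewrite expf_neq0.
have E1 : r_ n ^+ 2 = 4^-1 * 16 ^- n.
  by rewrite /r_ exprMn -!exprVn -exprM mulnC exprM; congr (_ * _ ^+ _); field.
have E2 : lam n.+1 `^ q = (2 * 2 ^+ d) `^ q * (2 `^ (q * d%:R)) ^+ n.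
  rewrite /lam mulSn exprD mulrA powRM ?mulr_ge0 ?exprn_ge0//; congr (_ * _).
  rewrite -(powR_mulrn (n * d) (ler0n R 2)) -(powR_mulrn n (powR_ge0 2 (q * d%:R))) -!powRrM; congr (_ `^ _).
  by rewrite natrM; ring.
rewrite E1 E2 /A /kappa expr_div_n; field.
by rewrite F0 expf_neq0.
Qed.

(* On [lam m <= |w| < lam m.+1] the mean of [w^2] over a cube of radius [r_ m] is
   a small part of [w x ^+ 2], so [osc (r_ m) w x] controls [w x ^+ 2]. Summing
   over the levels [m >= j] gives a geometric series of ratio [kappa], which is
   less than 1 exactly because [q * d < 4]. *)
Lemma gagliardo_nirenberg (eps : R) : 0 < eps -> exists2 C : R, 0 <= C &
  forall w g, sobolev w g -> ip mu w w <= 1 ->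
  (\int[mu]_x (`|w x| `^ (q + 2))%:E <= (C * ip mu w w + eps * dirichlet g)%:E)%E.
Proof.
move=> e0; have k1 : 0 < 1 - kappa by rewrite subr_gt0.
have [j Hj] : exists j, A * kappa ^+ j / (1 - kappa) <= eps.
  have cv : A * kappa ^+ n / (1 - kappa) @[n --> \oo] --> A * 0 / (1 - kappa).
    apply: cvgMr_tmp; apply: cvgMl_tmp; apply: cvg_expr.
    by rewrite ger0_norm.
  rewrite mulr0 mul0r in cv.
  have /cvgrPdist_le/(_ _ e0)[j _ Hj] := cv; exists j.
  by apply: le_trans (Hj j (leqnn j)); rewrite sub0r normrN ler_norm.
exists (lam j `^ q); first exact: powR_ge0.
move=> w g wg w1; have [w2 _ _] := wg; have [mw _] := w2.
have mo n : measurable_fun setT (fun x => (coef (j + n))%:E * osc (r_ (j + n)) w x)%E.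
  by apply: emeasurable_funM => //; exact: measurable_osc.
have o0 n x : (0 <= (coef (j + n))%:E * osc (r_ (j + n)) w x)%E.
  by rewrite mule_ge0 ?osc_ge0// lee_fin.
have mS : measurable_fun setT (fun x => \sum_(0 <= n <oo) ((coef (j + n))%:E * osc (r_ (j + n)) w x))%E.
  by apply: ge0_emeasurable_sum => // *; exact: o0.
have mw2 : measurable_fun setT (fun x => (lam j `^ q * w x ^+ 2)%:E).
  by apply/measurable_EFinP; apply: measurable_funM => //; exact: measurable_funX.
have mwq : measurable_fun setT (fun x => (`|w x| `^ (q + 2))%:E).
  apply/measurable_EFinP.
  have mq : measurable_fun setT (fun x => `|w x|) by exact: measurableT_comp.
  exact: (measurableT_comp (measurable_powR (q + 2)) mq).
apply: (@le_trans _ _ (\int[mu]_x ((lam j `^ q * w x ^+ 2)%:E +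
    \sum_(0 <= n <oo) ((coef (j + n))%:E * osc (r_ (j + n)) w x)))%E).
  apply: ge0_le_integral => //.
  - exact: emeasurable_funD.
  - by move=> x _; exact: pointwise.
rewrite ge0_integralD//; last 2 first.
- by move=> x _; rewrite lee_fin mulr_ge0 ?powR_ge0 ?sqr_ge0.
- by move=> x _; exact: nneseries_ge0.
rewrite EFinD; apply: leeD.
  under eq_integral do rewrite EFinM.
  rewrite ge0_integralZl; [by rewrite integral_sqrE|by []| | |].
  - by apply/measurable_EFinP; exact: measurable_funX.
  - by move=> x _; rewrite lee_fin sqr_ge0.
  - by rewrite lee_fin powR_ge0.
rewrite integral_nneseries//.
have tle n : (\int[mu]_x ((coef (j + n))%:E * osc (r_ (j + n)) w x) <=
    (A * dirichlet g * kappa ^+ (j + n))%:E)%E.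
  rewrite ge0_integralZl//; last 2 first.
  - by move=> x _; exact: osc_ge0.
  - by rewrite lee_fin.
    rewrite -coef_le [leRHS]EFinM; apply: lee_wpmul2l; first by rewrite lee_fin.
    exact: integral_osc_le.
  exact: measurable_osc.
have tge n : (0 <= \int[mu]_x ((coef (j + n))%:E * osc (r_ (j + n)) w x))%E.
  exact: integral_ge0.
apply: lime_le; first exact: is_cvg_nneseries.
apply: nearW => n; apply: (@le_trans _ _ (\sum_(0 <= i < n) (A * dirichlet g * kappa ^+ (j + i))%:E)%E).
  by apply: lee_sum => i _.
rewrite sumEFin lee_fin.
have -> : \sum_(0 <= i < n) A * dirichlet g * kappa ^+ (j + i) =
    A * kappa ^+ j * dirichlet g * \sum_(i < n) kappa ^+ i.
  by rewrite big_mkord [RHS]mulr_sumr; apply: eq_bigr => i _; rewrite exprD; ring.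
have S1 : \sum_(i < n) kappa ^+ i <= (1 - kappa)^-1.
  rewrite -[leRHS]mul1r ler_pdivlMr// mulrC.
  have := subrX1 kappa n; have := exprn_ge0 n kappa_ge0; lra.
have D0 := dirichlet_ge0 g.
apply: (@le_trans _ _ (A * kappa ^+ j * dirichlet g * (1 - kappa)^-1)).
  by rewrite ler_wpM2l// !mulr_ge0// exprn_ge0.
by rewrite mulrAC ler_wpM2r.
Qed.

End GN_power.

(** * L2 compactness *)

Section test_functions.
Context {R : realType} (d : nat).
Local Notation mu := (@vol R d).
Implicit Types (f phi u v : 'rV[R]_d -> R).

Lemma measurable_open_rv (O : set 'rV[R]_d) : open O -> measurable O.
Proof.
move=> oO.
pose box (k : {ffun 'I_d -> rat * rat}) : set 'rV[R]_d :=
  obox (fun i => ratr (k i).1) (fun i => ratr (k i).2).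
pose B n : set 'rV[R]_d := if unpickle n is Some k then
  if `[< box k `<=` O >] then box k else set0 else set0.
have -> : O = \bigcup_n B n.
  apply/seteqP; split=> [x Ox|x [n _]]; last first.
    by rewrite /B; case: unpickle => // k; case: asboolP => // kO; exact: kO.
  have [e /= e0 eO] : nbhs_ball x O.
    by apply/nbhs_ballP; exact: open_nbhs_nbhs.
  have /choice[q Hq] : forall i, exists q : rat * rat,
      x 0 i - e < ratr q.1 < x 0 i /\ x 0 i < ratr q.2 < x 0 i + e.
    move=> i.
    have [q1] := @rat_in_itvoo R (x 0 i - e) (x 0 i) ltac:(by rewrite ltrBlDr ltrDl).
    have [q2] := @rat_in_itvoo R (x 0 i) (x 0 i + e) ltac:(by rewrite ltrDl).
    by rewrite !in_itv/= => h2 h1; exists (q1, q2).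
  exists (pickle (finfun q)) => //; rewrite /B pickleK.
  have qO : box (finfun q) `<=` O.
    move=> y yq; apply: eO; split=> // i j; rewrite (ord1 i); have := yq j; rewrite /= in_itv/= !ffunE.
    have [/andP[h1 h2] /andP[h3 h4]] := Hq j => /andP[h5 h6].
    by rewrite /ball/= ltr_norml; lra.
  rewrite asboolT// => i; rewrite /= in_itv/= !ffunE.
  by have [/andP[_ ->] /andP[-> _]] := Hq i.
apply: bigcupT_measurable => n; rewrite /B; case: unpickle => // k.
by case: asboolP => // _; exact: measurable_obox.
Qed.

Lemma measurable_continuous_rv f : continuous f -> measurable_fun setT f.
Proof.
move=> cf; apply: (measurability _ (RGenOInfty.measurableE R)) => _ [_ [a ->] <-].
rewrite setTI; apply: measurable_open_rv.
by apply: open_comp => [x _|]; [exact: cf|rewrite set_itvE; exact: open_gt].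
Qed.

Lemma coord_le_norm (x : 'rV[R]_d) i : `|x 0 i| <= `|x|.
Proof.
rewrite [leRHS]/Num.norm/= mx_normrE; apply/bigmax_geP; right => /=.
by exists (0, i).
Qed.

Lemma L2_bounded_compact f (K : set 'rV[R]_d) : continuous f -> compact K ->
  (forall x, ~ K x -> f x = 0) -> L2fun mu f.
Proof.
move=> cf cK f0; have mf := measurable_continuous_rv cf.
have [M [_ HM]] := compact_bounded (continuous_compact (continuous_subspaceT cf) cK).
have [r [_ Hr]] := compact_bounded cK.
pose M' := `|M| + 1; pose r' := `|r| + 1.
have r'0 : 0 < r' by rewrite ltr_wpDl.
have rr' : r < r' by rewrite (le_lt_trans (ler_norm r))// ltrDl.
have MM' : M < M' by rewrite (le_lt_trans (ler_norm M))// ltrDl.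
apply: (@L2_dom _ _ _ _ _ (fun x => M' * \1_(cube r') x)) => //.
  apply: L2Z; apply: L2_indic; first exact: measurable_cube.
  by rewrite [X in (X < _)%E]vol_cube// ltry.
move=> x; rewrite indicE; have [Kx|Kx] := pselect (K x).
  rewrite mem_set ?mulr1.
    by rewrite (le_trans (HM _ MM' _ _))// ?ler_norm//; exists x.
  move=> i /=; rewrite in_itv/= -ler_norml; apply: le_trans (Hr _ rr' _ Kx).
  exact: coord_le_norm.
by rewrite (f0 _ Kx) normr0.
Qed.

Lemma continuous_test_fun phi : test_fun phi -> continuous phi.
Proof. by move=> [/(_ [::])[]]. Qed.

Lemma continuous_partial i phi : test_fun phi -> continuous (partial i phi).
Proof. by move=> [/(_ [:: i])[]]. Qed.

Lemma L2_test_fun phi : test_fun phi -> L2fun mu phi.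
Proof.
move=> tphi; apply: (L2_bounded_compact (continuous_test_fun tphi) tphi.2) => x.
move=> xS; apply/eqP; apply: contrapT => /negP px; apply: xS.
exact: subset_closure.
Qed.

Lemma L2_partial i phi : test_fun phi -> L2fun mu (partial i phi).
Proof.
move=> tphi; have [_ cS] := tphi.
apply: (L2_bounded_compact (continuous_partial tphi) cS) => x xS.
have oC : open (~` closure [set x | phi x != 0]) by apply: closed_openC; exact: closed_closure.
have nx : \forall y \near x, phi y = 0.
  apply: filterS (open_nbhs_nbhs (conj oC xS)) => y yS; apply/eqP.
  by apply: contrapT => /negP py; apply: yS; exact: subset_closure.
suff : is_derive x (delta_mx 0 i : 'rV[R]_d) phi 0 by move=> /@derive_val.
apply: near_eq_is_derive (is_derive_cst (0 : R) x _).
by apply: filterS nx => y ->.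
Qed.

Lemma Ints_ip u v : L2fun mu u -> L2fun mu v -> Ints (fun x => u x * v x) = (ip mu u v)%:E.
Proof.
move=> u2 v2; have [m1 _] := u2; have [m2 _] := v2.
rewrite IntsE ?Rintegral_EFin//; [exact: L2M_integrable|exact: measurable_funM].
Qed.

Lemma sobolevP u (g : 'I_d -> 'rV[R]_d -> R) : L2fun mu u -> (forall i, L2fun mu (g i)) ->
  (forall i phi, test_fun phi -> ip mu u (partial i phi) = - ip mu (g i) phi) -> sobolev u g.
Proof.
move=> u2 g2 H; split=> // i phi tphi.
have p2 := L2_test_fun tphi; have dp2 := L2_partial i tphi.
by rewrite !Ints_ip// H.
Qed.

Lemma sobolev_wgrad u (g : 'I_d -> 'rV[R]_d -> R) i phi : sobolev u g -> test_fun phi ->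
  ip mu u (partial i phi) = - ip mu (g i) phi.
Proof.
by move=> ug tphi; apply: (sobolev_ip ug) => //; [exact: L2_test_fun|exact: L2_partial].
Qed.

Lemma sobolevD u v (g h : 'I_d -> 'rV[R]_d -> R) : sobolev u g -> sobolev v h ->
  sobolev (fun x => u x + v x) (fun i x => g i x + h i x).
Proof.
move=> ug vh; have [u2 g2 _] := ug; have [v2 h2 _] := vh.
apply: sobolevP => [|i|i phi tphi]; [exact: L2D|exact: L2D|].
have p2 := L2_test_fun tphi; have dp2 := L2_partial i tphi.
by rewrite !ipDl// (sobolev_wgrad i ug)// (sobolev_wgrad i vh)//; ring.
Qed.

Lemma sobolevZ c u (g : 'I_d -> 'rV[R]_d -> R) : sobolev u g ->
  sobolev (fun x => c * u x) (fun i x => c * g i x).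
Proof.
move=> ug; have [u2 g2 _] := ug.
apply: sobolevP => [|i|i phi tphi]; [exact: L2Z|exact: L2Z|].
have p2 := L2_test_fun tphi; have dp2 := L2_partial i tphi.
by rewrite !ipZl// (sobolev_wgrad i ug)//; ring.
Qed.

Lemma sobolevB u v (g h : 'I_d -> 'rV[R]_d -> R) : sobolev u g -> sobolev v h ->
  sobolev (fun x => u x - v x) (fun i x => g i x - h i x).
Proof.
move=> ug /(sobolevZ (-1)) vh; have := sobolevD ug vh; congr sobolev.
  by apply/funext => x; rewrite mulN1r.
by apply/funext => i; apply/funext => x; rewrite mulN1r.
Qed.

Lemma sobolev_limit (u : 'rV[R]_d -> R) (g : 'I_d -> 'rV[R]_d -> R)
    (un : nat -> 'rV[R]_d -> R) (gn : nat -> 'I_d -> 'rV[R]_d -> R) :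
  (forall n, sobolev (un n) (gn n)) -> L2fun mu u -> (forall i, L2fun mu (g i)) ->
  (forall i eps, 0 < eps -> exists n,
    ip mu (fun x => u x - un n x) (fun x => u x - un n x) <= eps /\
    ip mu (fun x => g i x - gn n i x) (fun x => g i x - gn n i x) <= eps) ->
  sobolev u g.
Proof.
move=> s u2 g2 cv; apply: sobolevP => // i phi tphi.
have final (A X Y E P Q : R) : A <= 2 * X + 2 * Y -> X <= E * P -> Y <= E * Q -> 0 < E ->
  A <= E * (2 * (P + Q + 1)) by nra.
have p2 := L2_test_fun tphi; have dp2 := L2_partial i tphi.
set a := ip _ _ _; set b := ip _ _ _; apply/eqP; rewrite -subr_eq0 opprK -sqrf_eq0.
rewrite eq_le sqr_ge0 andbT; apply/ler_addgt0Pl => eps e0; rewrite addr0.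
pose D := ip mu (partial i phi) (partial i phi) + ip mu phi phi.
have D0 : 0 <= D by rewrite addr_ge0 ?ip_ge0.
have D10 : 0 < 2 * (D + 1) by rewrite mulr_gt0// ltr_wpDl.
have [n [un1 gn1]] := cv i (eps / (2 * (D + 1))) (divr_gt0 e0 D10).
have [un2 gn2 _] := s n.
have w := sobolev_wgrad i (s n) tphi.
have c1 := cauchy_schwarz (L2B u2 un2) dp2.
have c2 := cauchy_schwarz (L2B (g2 i) (gn2 i)) p2.
rewrite ipBl// in c1; rewrite ipBl// in c2.
rewrite w -/a in c1; rewrite -/b in c2.
have e1 : 0 < eps / (2 * (D + 1)) by exact: divr_gt0.
set E := eps / _ in un1 gn1 e1.
have EE : E * (2 * (D + 1)) = eps by rewrite divfK ?gt_eqF.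
have P1 := ip_ge0 mu (partial i phi); have P2 := ip_ge0 mu phi.
have c1' := le_trans c1 (ler_wpM2r P1 un1).
have c2' := le_trans c2 (ler_wpM2r P2 gn1).
have : (a + b) ^+ 2 <= 2 * (a - - ip mu (gn n i) phi) ^+ 2 + 2 * (b - ip mu (gn n i) phi) ^+ 2.
  clearbody a b; move: (ip mu (gn n i) phi) => r.
  by have := sqr_ge0 ((a - - r) - (b - r)); nra.
rewrite -EE /D => /final; exact.
Qed.

End test_functions.

Section cells.
Context {R : realType} (d : nat).
Local Notation mu := (@vol R d).
Implicit Types (w : 'rV[R]_d -> R) (x y : 'rV[R]_d).
Variables (r : R) (K : nat).
Hypothesis r0 : 0 < r.

Let side (k : nat) : set R := `[(k%:R - K%:R) * r, (k.+1%:R - K%:R) * r[%classic.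

Definition cell (f : {ffun 'I_d -> 'I_(2 * K).+1}) : set 'rV[R]_d :=
  [set y | forall i, side (f i) (y 0 i)].

Let measurable_side k : measurable (side k).
Proof. exact: measurable_itv. Qed.

Lemma measurable_cell f : measurable (cell f).
Proof. by apply: (measurable_prodrv (A := fun i => side (f i))) => i. Qed.

Lemma vol_cell f : vol d (cell f) = (r ^+ d)%:E.
Proof.
rewrite [LHS](vol_prodrv (A := fun i => side (f i)))//.
rewrite (eq_bigr (fun=> r%:E)) ?prodEFin ?prodr_const ?card_ord// => i _.
rewrite lebesgue_measure_itv/= lte_fin ifT.
  by rewrite -EFinB; congr (_%:E); rewrite -natr1; ring.
by rewrite ltr_pM2r// ltrD2r ltr_nat.
Qed.

Lemma cell_cover x : (forall i, `|x 0 i| <= K%:R * r) -> exists f, cell f x.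
Proof.
move=> xK; pose t i := Num.trunc (x 0 i / r + K%:R).
have t0 i : 0 <= x 0 i / r + K%:R.
  have := xK i; rewrite ler_norml => /andP[h _].
  have : - K%:R <= x 0 i / r by rewrite ler_pdivlMr// mulNr.
  by rewrite -subr_ge0 opprK.
have tK i : (t i < (2 * K).+1)%N.
  rewrite ltnS /t; have /andP[h _] := trunc_itv (t0 i).
  rewrite -(ler_nat R); apply: le_trans h _.
  have := xK i; rewrite ler_norml => /andP[_]; rewrite -ler_pdivrMr// natrM => h.
  by lra.
exists [ffun i => Ordinal (tK i)] => i; rewrite ffunE /side /= in_itv/=.
have /andP[h1 h2] := trunc_itv (t0 i).
rewrite -ler_pdivlMr// -ltr_pdivrMr// ltrBrDr h2 andbT lerBlDr.
exact: h1.
Qed.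

Lemma cell_diff f x y : cell f x -> cell f y -> cube r (y - x).
Proof.
move=> fx fy i; have := fx i; have := fy i; rewrite /side/= !in_itv/= !mxE.
rewrite -natr1 => /andP[h1 h2] /andP[h3 h4]; apply/andP; split; nra.
Qed.

Lemma L2_cell f : L2fun mu (\1_(cell f)).
Proof.
by apply: L2_indic; [exact: measurable_cell|rewrite [X in (X < _)%E]vol_cell ltry].
Qed.

Lemma ip_cell f : ip mu (\1_(cell f)) (\1_(cell f)) = r ^+ d.
Proof.
apply: EFin_inj; rewrite -integral_sqrE; last exact: L2_cell.
rewrite -(vol_cell f) -[X in _ = mu X]setIT -integral_indic//; last exact: measurable_cell.
apply: eq_integral => x _; rewrite indicE; case: (_ \in _); rewrite ?expr1n ?expr0n//.
Qed.

Lemma sqr_le_cell w f x : L2fun mu w -> cell f x ->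
  ((r ^+ d * r ^+ d * w x ^+ 2)%:E <=
   (2 * r ^+ d)%:E * osc r w x + (2 * ip mu w (\1_(cell f)) ^+ 2)%:E)%E.
Proof.
move=> w2 fx; have [mw _] := w2; pose I : 'rV[R]_d -> R := \1_(cell f).
have LI : L2fun mu I := L2_cell f.
have wI2 : L2fun mu (fun y => w y * I y).
  apply: L2_dom w2 _; first by apply: measurable_funM => //; case: LI.
  by move=> y; rewrite /I indicE normrM; case: (_ \in _); rewrite ?normr1 ?normr0 ?mulr1 ?mulr0.
pose h y := w y * I y - w x * I y.
have h2 : L2fun mu h by apply: L2B => //; exact: L2Z.
have II y : I y * I y = I y.
  by rewrite /I indicE; case: (_ \in _); rewrite ?mulr1 ?mulr0.
have hI : ip mu h I = ip mu w I - w x * r ^+ d.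
  rewrite -(ip_cell f) ipBl ?ipZl//; last exact: L2Z.
  congr (_ - _); rewrite /ip; apply: eq_Rintegral => y _.
  by rewrite -mulrA II.
have hh : ((ip mu h h)%:E <= osc r w x)%E.
  rewrite -integral_sqrE// /osc.
  rewrite -(integral_vol_shift x (f := fun y => (h y ^+ 2)%:E)); last first.
    by apply/measurable_EFinP; apply: measurable_funX; case: h2.
  have m2 : measurable_fun setT (fun z : 'rV[R]_d => w (x + z)).
    by rewrite (_ : (fun z => _) = (fun z => w (z + x))); [exact: measurable_comp_shift|
      apply/funext => z; rewrite addrC].
  apply: ge0_le_integral => //.
  - by move=> z _; rewrite lee_fin sqr_ge0.
  - apply/measurable_EFinP; apply: measurable_funX; apply: (measurable_comp_shift x (f := h)).
    by case: h2.
  - apply/measurable_EFinP; apply: measurable_funM.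
      by apply: measurable_funX; exact: measurable_funB.
    by apply: measurable_indic; exact: measurable_cube.
  move=> z _; rewrite lee_fin /h -mulrBl exprMn (addrC z x).
  have -> : I (x + z) ^+ 2 = I (x + z) by rewrite expr2 II.
  rewrite ler_wpM2l ?sqr_ge0// /I !indicE.
  have [fz|] := boolP (x + z \in cell f); last by rewrite ler0n.
  rewrite mem_set//.
  by have := cell_diff fx (set_mem fz); rewrite addrAC subrr add0r.
have cs := cauchy_schwarz h2 LI.
rewrite ip_cell hI in cs.
case: (osc r w x) (osc_ge0 r w x) hh => [z|_ _|//]; last first.
  by rewrite gt0_muley ?leey// lte_fin mulr_gt0// exprn_gt0.
rewrite -EFinM -EFinD !lee_fin => z0 hh.
have rd0 : 0 < r ^+ d by rewrite exprn_gt0.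
move: (ip mu h h) (ip mu w _) (r ^+ d) (w x) cs hh rd0 => a m v b cs hh v0.
have : a * v <= z * v by rewrite ler_wpM2r// ltW.
have := sqr_ge0 ((m - b * v) + m); nra.
Qed.

End cells.

Section compactness.
Context {R : realType} (d : nat).
Local Notation mu := (@vol R d).
Variable V : 'rV[R]_d -> R.
Hypotheses (V0 : forall x, 0 <= V x) (mV : measurable_fun setT V)
  (Voo : forall M, exists r, forall x, r < `|x| -> M < V x).

Lemma sqr_le_cells (w : 'rV[R]_d -> R) (r eta M : R) K x :
  0 < r -> 0 < M -> L2fun mu w ->
  (forall f : {ffun 'I_d -> 'I_(2 * K).+1}, `|ip mu w (\1_(cell r f))| <= eta) ->
  (forall x, K%:R * r < `|x| -> M < V x) ->
  ((w x ^+ 2)%:E <= (2 / r ^+ d)%:E * osc r w x +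
     (2 * (eta / r ^+ d) ^+ 2)%:E * (\1_(cube (K%:R * r)) x)%:E +
     (M^-1)%:E * (V x * w x ^+ 2)%:E)%E.
Proof.
move=> r0 M0 w2 Heta HM; have rd0 : 0 < r ^+ d by rewrite exprn_gt0.
have o_0 := osc_ge0 r w x.
have c3 : 0 <= M^-1 by rewrite invr_ge0 ltW.
have [xK|/existsNP[i /negP xi]] := pselect (forall i, `|x 0 i| <= K%:R * r).
  have [f xf] := cell_cover r0 xK.
  apply: (@le_trans _ _ ((2 / r ^+ d)%:E * osc r w x + (2 * (eta / r ^+ d) ^+ 2)%:E *
    (\1_(cube (K%:R * r)) x)%:E)%E); last first.
    by rewrite leeDl// -EFinM lee_fin mulr_ge0// mulr_ge0 ?sqr_ge0.
  rewrite indicE mem_set ?mule1; last by move=> i /=; rewrite in_itv/= -ler_norml.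
  have := sqr_le_cell r0 w2 xf; case: (osc r w x) o_0 => [z|_ _|//]; last first.
    by rewrite gt0_muley ?leey// lte_fin divr_gt0.
  rewrite -!EFinM -!EFinD !lee_fin => z0 H.
  have m2 : ip mu w (\1_(cell r f)) ^+ 2 <= eta ^+ 2.
    rewrite -(real_normK (num_real (ip _ _ _))) lerXn2r ?nnegrE//.
    exact: le_trans (Heta f).
  have -> : 2 / r ^+ d * z + 2 * (eta / r ^+ d) ^+ 2 =
      (2 * r ^+ d * z + 2 * eta ^+ 2) / (r ^+ d * r ^+ d).
    by field; rewrite gt_eqF.
  by rewrite ler_pdivlMr ?mulr_gt0// mulrC; lra.
apply: (@le_trans _ _ ((M^-1)%:E * (V x * w x ^+ 2)%:E)%E).
  rewrite -EFinM lee_fin mulrA ler_peMl ?sqr_ge0// mulrC ler_pdivlMr// mul1r ltW// HM//.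
  by rewrite (lt_le_trans _ (coord_le_norm x i))// ltNge.
rewrite leeDr// adde_ge0//.
  by rewrite mule_ge0// lee_fin divr_ge0// ltW.
by rewrite -EFinM lee_fin mulr_ge0// mulr_ge0 ?sqr_ge0.
Qed.

(* Up to small errors, the L2 norm of [w] is controlled by finitely many linear
   functionals, its integrals over the cells of a grid. *)
Lemma L2_le_cells (w : 'rV[R]_d -> R) g (r eta M : R) K :
  0 < r -> 0 < M -> (0 < K)%N -> sobolev w g ->
  (forall f : {ffun 'I_d -> 'I_(2 * K).+1}, `|ip mu w (\1_(cell r f))| <= eta) ->
  (forall x, K%:R * r < `|x| -> M < V x) ->
  ((ip mu w w)%:E <= ((2 * 4 ^+ d * r ^+ 2) * dirichlet g)%:E +
     ((2 * (K%:R * r)) ^+ d * (2 * (eta / r ^+ d) ^+ 2))%:E +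
     (M^-1)%:E * \int[mu]_x (V x * w x ^+ 2)%:E)%E.
Proof.
move=> r0 M0 K0 wg Heta HM; have [w2 _ _] := wg; have [mw _] := w2.
have Kr0 : 0 < K%:R * r by rewrite mulr_gt0// ltr0n.
have c1 : 0 <= 2 / r ^+ d by rewrite divr_ge0// ltW// exprn_gt0.
have c2 : 0 <= 2 * (eta / r ^+ d) ^+ 2 by rewrite mulr_ge0 ?sqr_ge0.
have c3 : 0 <= M^-1 by rewrite invr_ge0 ltW.
have m1 : measurable_fun setT (fun x => (2 / r ^+ d)%:E * osc r w x)%E.
  by apply: measurable_funeM; exact: measurable_osc.
have m2 : measurable_fun setT (fun x : 'rV[R]_d => (2 * (eta / r ^+ d) ^+ 2)%:E *
    (\1_(cube (K%:R * r)) x)%:E)%E.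
  apply: measurable_funeM; apply/measurable_EFinP; apply: measurable_indic.
  exact: measurable_cube.
have m30 : measurable_fun setT (fun x => (V x * w x ^+ 2)%:E).
  by apply/measurable_EFinP; apply: measurable_funM => //; exact: measurable_funX.
have m3 : measurable_fun setT (fun x => (M^-1)%:E * (V x * w x ^+ 2)%:E)%E.
  exact: measurable_funeM.
have p1 x : (0 <= (2 / r ^+ d)%:E * osc r w x)%E by rewrite mule_ge0 ?osc_ge0.
have p2 x : (0 <= (2 * (eta / r ^+ d) ^+ 2)%:E * (\1_(cube (K%:R * r)) x)%:E)%E.
  by rewrite mule_ge0 ?lee_fin.
have p30 x : (0 <= (V x * w x ^+ 2)%:E)%E by rewrite lee_fin mulr_ge0 ?sqr_ge0.
have p3 x : (0 <= (M^-1)%:E * (V x * w x ^+ 2)%:E)%E by apply: mule_ge0; [rewrite lee_fin|exact: p30].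
rewrite -integral_sqrE//.
apply: (@le_trans _ _ (\int[mu]_x ((2 / r ^+ d)%:E * osc r w x +
     (2 * (eta / r ^+ d) ^+ 2)%:E * (\1_(cube (K%:R * r)) x)%:E +
     (M^-1)%:E * (V x * w x ^+ 2)%:E))%E).
  apply: ge0_le_integral => //.
  - by move=> x _; rewrite lee_fin sqr_ge0.
  - by apply/measurable_EFinP; exact: measurable_funX.
  - by apply: emeasurable_funD => //; exact: emeasurable_funD.
  - by move=> x _; exact: sqr_le_cells.
rewrite ge0_integralD//; [|by move=> x _; rewrite adde_ge0|exact: emeasurable_funD].
rewrite ge0_integralD// integral_cube// ge0_integralZl//; last 2 first.
- exact: measurable_osc.
- by move=> x _; exact: osc_ge0.
rewrite ge0_integralZl//.
apply: leeD => //; apply: leeD => //.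
apply: (@le_trans _ _ ((2 / r ^+ d)%:E * ((2 * r) ^+ d * (2 ^+ d * r ^+ 2 * dirichlet g))%:E)%E).
  by apply: lee_wpmul2l; [rewrite lee_fin|exact: integral_osc_le].
rewrite -EFinM lee_fin exprMn (_ : 4 ^+ d = 2 ^+ d * 2 ^+ d); last first.
  by rewrite -exprMn; congr (_ ^+ _); ring.
rewrite le_eqVlt; apply/orP; left; apply/eqP; field.
by rewrite gt_eqF// exprn_gt0.
Qed.

Lemma ultra_bounded_cvg (U : set_system nat) (a : nat -> R) (C : R) : UltraFilter U ->
  (forall n, `|a n| <= C) -> exists p : R, a n @[n --> U] --> p.
Proof.
move=> UU aC.
have UaU : UltraFilter (a @ U).
  split=> [|G GP aG]; first exact: fmap_proper_filter.
  apply/seteqP; split=> [B GB|]; last exact: aG.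
  have [//|nB] := in_ultra_setVsetC (a @^-1` B) UU.
  have GnB : G (~` B) by exact: aG.
  by have [x []] := filter_ex (filterI GB GnB).
have UC : (a @ U) `[- C, C]%classic.
  suff H : setT `<=` a @^-1` `[- C, C] by exact: (filterS H filterT).
  by move=> n _ /=; rewrite in_itv/= -ler_norml.
have := @segment_compact R (- C) C; rewrite compact_ultra => /(_ _ UaU UC)[p [_ cp]].
by exists p.
Qed.

Variables (u : nat -> 'rV[R]_d -> R) (g : nat -> 'I_d -> 'rV[R]_d -> R) (C : R).
Hypotheses (ug : forall n, sobolev (u n) (g n))
  (u_le : forall n, ip mu (u n) (u n) <= C)
  (g_le : forall n, dirichlet (g n) <= C)
  (Vu_le : forall n, (\int[mu]_x (V x * u n x ^+ 2)%:E <= C%:E)%E).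

Let C0 : 0 <= C. Proof. exact: le_trans (ip_ge0 _ _) (u_le 0). Qed.

Let dirichlet_diff m n : dirichlet (fun i x => g m i x - g n i x) <= 4 * C.
Proof.
have [_ g2m _] := ug m; have [_ g2n _] := ug n.
apply: (@le_trans _ _ (2 * dirichlet (g m) + 2 * dirichlet (g n))); last first.
  by have := g_le m; have := g_le n; lra.
rewrite /dirichlet !mulr_sumr -big_split/=; apply: ler_sum => i _.
have := ip_sqrD_le (g2m i) (L2N (g2n i)); congr (_ <= _ + 2 * _).
by rewrite ipNl// ?[ip _ (g n i) _]ipC ?ipNl ?opprK//; exact: L2N.
Qed.

Let V_diff m n : (\int[mu]_x (V x * (u m x - u n x) ^+ 2)%:E <= (4 * C)%:E)%E.
Proof.
have [[mm _] _ _] := ug m; have [[mn _] _ _] := ug n.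
have mVu k : measurable_fun setT (fun x => (V x * u k x ^+ 2)%:E).
  have [[mk _] _ _] := ug k.
  by apply/measurable_EFinP; apply: measurable_funM => //; exact: measurable_funX.
have pVu k x : (0 <= (V x * u k x ^+ 2)%:E)%E by rewrite lee_fin mulr_ge0 ?sqr_ge0.
apply: (@le_trans _ _ (\int[mu]_x (2%:E * (V x * u m x ^+ 2)%:E + 2%:E * (V x * u n x ^+ 2)%:E))%E).
  apply: ge0_le_integral => //.
  - by move=> x _; rewrite lee_fin mulr_ge0 ?sqr_ge0.
  - apply/measurable_EFinP; apply: measurable_funM => //; apply: measurable_funX.
    exact: measurable_funB.
  - by apply: emeasurable_funD; exact: measurable_funeM.
  move=> x _; rewrite -!EFinM -EFinD lee_fin.
  have := V0 x; have := sqr_ge0 (u m x + u n x); nra.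
rewrite ge0_integralD//; last 4 first.
- by move=> x _; rewrite mule_ge0.
- exact: measurable_funeM.
- by move=> x _; rewrite mule_ge0.
- exact: measurable_funeM.
rewrite !ge0_integralZl//.
have -> : ((4 * C)%:E = 2%:E * C%:E + 2%:E * C%:E)%E.
  by rewrite -!EFinM -EFinD; congr (_%:E); ring.
by apply: leeD; apply: lee_wpmul2l.
Qed.

Lemma ultra_cauchy (U : set_system nat) (eps : R) : UltraFilter U -> 0 < eps ->
  exists2 A : set nat, U A & forall m n, A m -> A n ->
    ip mu (fun x => u m x - u n x) (fun x => u m x - u n x) <= eps.
Proof.
move=> UU e0.
pose M := 12 * (C + 1) / eps; have M0 : 0 < M by rewrite divr_gt0// mulr_gt0// ltr_wpDl.
have [rV HrV] := Voo M.
pose D : R := 2 * 4 ^+ d * (4 * (C + 1)).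
have D0 : 0 < D by rewrite !mulr_gt0 ?exprn_gt0// ltr_wpDl.
pose r : R := Num.min 1 (eps / (3 * D)).
have r0 : 0 < r by rewrite lt_min ltr01 divr_gt0// mulr_gt0.
have r1 : r <= 1 by rewrite ge_min lexx.
have rD : D * r <= eps / 3.
  apply: (@le_trans _ _ (D * (eps / (3 * D)))).
    by apply: ler_wpM2l; [exact: ltW|rewrite /r ge_min lexx orbT].
  by rewrite le_eqVlt; apply/orP; left; apply/eqP; field; rewrite gt_eqF.
pose K := (Num.trunc (`|rV| / r)).+1.
have KrV x : K%:R * r < `|x| -> M < V x.
  move=> Kx; apply: HrV; apply: lt_trans Kx; rewrite -ltr_pdivrMr//.
  apply: le_lt_trans (truncnS_gt _); by rewrite ler_wpM2r ?invr_ge0 ?(ltW r0) ?ler_norm.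
have Kr0 : 0 < K%:R * r by rewrite mulr_gt0.
pose Q : R := (2 * (K%:R * r)) ^+ d * 2 / (r ^+ d) ^+ 2.
have Q0 : 0 < Q by rewrite divr_gt0 ?mulr_gt0 ?exprn_gt0// mulr_gt0.
pose eta : R := Num.min 1 (eps / (3 * Q)).
have eta0 : 0 < eta by rewrite lt_min ltr01 divr_gt0// mulr_gt0.
have Qeta : Q * eta ^+ 2 <= eps / 3.
  apply: (@le_trans _ _ (Q * eta)).
    have : eta <= 1 by rewrite ge_min lexx.
    by move=> ?; rewrite ler_pM2l// expr2 ler_piMr// ltW.
  apply: (@le_trans _ _ (Q * (eps / (3 * Q)))).
    by apply: ler_wpM2l; [exact: ltW|rewrite /eta ge_min lexx orbT].
  by rewrite le_eqVlt; apply/orP; left; apply/eqP; field; rewrite gt_eqF.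
have L2u n : L2fun mu (u n) by have [] := ug n.
have /choice[p Hp] : forall f : {ffun 'I_d -> 'I_(2 * K).+1}, exists p : R,
    ip mu (u n) (\1_(cell r f)) @[n --> U] --> p.
  move=> f; apply: (@ultra_bounded_cvg _ _ (C + r ^+ d)) => // n.
  have Lc := L2_cell r0 f; have := cauchy_schwarz (L2u n) Lc.
  rewrite ip_cell// => cs.
  have rd0 : 0 < r ^+ d by rewrite exprn_gt0.
  have := u_le n; have := ip_ge0 mu (u n).
  move: (ip mu (u n) (u n)) cs => a cs a0 aC.
  rewrite -(@ler_pXn2r _ 2) ?nnegrE ?addr_ge0 ?(ltW rd0)// real_normK ?num_real//.
  by apply: le_trans cs _; nra.
exists [set n | forall f : {ffun 'I_d -> 'I_(2 * K).+1}, `|p f - ip mu (u n) (\1_(cell r f))| <= eta / 2].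
  apply: filter_forall => f; move/cvgrPdist_le : (Hp f); apply.
  by rewrite divr_gt0.
move=> m n Am An.
have := @L2_le_cells (fun x => u m x - u n x) (fun i x => g m i x - g n i x) r eta M K r0 M0
  (ltn0Sn _) (sobolevB (ug m) (ug n)) _ KrV.
have Hf f : `|ip mu (fun x => u m x - u n x) (\1_(cell (K := K) r f))| <= eta.
  have := Am f; have := An f; rewrite ipBl//; last exact: L2_cell.
  by rewrite !ler_norml => /andP[? ?] /andP[? ?]; apply/andP; split; lra.
move=> /(_ Hf) H; rewrite -lee_fin; apply: le_trans H _.
apply: (@le_trans _ _ ((eps / 3)%:E + (eps / 3)%:E + (eps / 3)%:E)%E); last first.
  by rewrite -!EFinD lee_fin; lra.
apply: leeD; first apply: leeD.
- rewrite lee_fin; apply: le_trans rD; rewrite /D.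
  have := dirichlet_diff m n; have := dirichlet_ge0 (fun i x => g m i x - g n i x).
  move: (dirichlet _) => G G0 GC; have F0 : 0 < 2 * 4 ^+ d :> R by rewrite mulr_gt0 ?exprn_gt0.
  have H : r ^+ 2 * G <= 4 * (C + 1) * r.
    clearbody r; rewrite expr2; have := mulr_ge0 (ltW r0) G0; nra.
  by have := ler_wpM2l (ltW F0) H; rewrite !mulrA.
- rewrite lee_fin; apply: le_trans Qeta; rewrite /Q le_eqVlt; apply/orP; left; apply/eqP.
  by field; rewrite gt_eqF ?exprn_gt0.
apply: (@le_trans _ _ ((M^-1)%:E * (4 * C)%:E)%E).
  by apply: lee_wpmul2l; [rewrite lee_fin invr_ge0 ltW|exact: V_diff].
rewrite -EFinM lee_fin /M invf_div mulrAC ler_pdivrMr ?mulr_gt0 ?ltr_wpDl//.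
by nra.
Qed.

Lemma compact_subsequence : exists sigma : nat -> nat, (forall k, (k <= sigma k)%N) /\
  forall eps, 0 < eps -> exists N, forall m n, (N <= m)%N -> (N <= n)%N ->
    ip mu (fun x => u (sigma m) x - u (sigma n) x) (fun x => u (sigma m) x - u (sigma n) x) <= eps.
Proof.
have [U [UU Uoo]] := ultraFilterLemma (eventually_filter : ProperFilter \oo).
have /choice[A HA] : forall k, exists A : set nat, U A /\ forall m n, A m -> A n ->
    ip mu (fun x => u m x - u n x) (fun x => u m x - u n x) <= k.+1%:R^-1.
  by move=> k; have [A UA HA] := @ultra_cauchy U k.+1%:R^-1 UU ltac:(by []); exists A.
have /choice[sigma Hs] : forall k, exists n, (k <= n)%N /\ forall j : 'I_k.+1, A j n.
  move=> k; have : U ([set n | (k <= n)%N] `&` [set n | forall j : 'I_k.+1, A j n]).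
    apply: filterI; first by apply: Uoo; exists k.
    by apply: filter_forall => j; have [] := HA j.
  by move=> /filter_ex[n [kn Hn]]; exists n.
exists sigma; split; first by move=> k; have [] := Hs k.
move=> eps e0; pose N := Num.trunc eps^-1; exists N => m n Nm Nn.
have Ne : N.+1%:R^-1 <= eps.
  by rewrite -[leRHS]invrK lef_pV2 ?posrE ?invr_gt0// ltW// truncnS_gt.
apply: le_trans Ne; apply: (HA N).2.
- by have [_ /(_ (Ordinal (Nm : (N < m.+1)%N)))] := Hs m.
- by have [_ /(_ (Ordinal (Nn : (N < n.+1)%N)))] := Hs n.
Qed.

End compactness.

(** * Abstract constrained minimization *)

Section bernoulli.
Context {R : realType}.
Implicit Types x y r p : R.

Lemma powR_bernoulli_lt y r : 0 < y -> 1 < r -> y != 1 -> 1 + r * (y - 1) < y `^ r.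
Proof.
move=> y0 r1 y1; have l0 : ln y != 0 by rewrite ln_eq0// gtr0_norm.
have -> : y `^ r = y * expR ((r - 1) * ln y).
  by rewrite /powR gt_eqF// -{2}(lnK y0) -expRD; congr expR; ring.
have h1 : 1 + (r - 1) * ln y < expR ((r - 1) * ln y).
  by apply: expR_gt1Dx; rewrite mulf_neq0// subr_eq0 gt_eqF.
have h2 : 1 + - ln y <= y^-1 by rewrite -{2}(lnK y0) -expRN expR_ge1Dx.
have h3 : y * y^-1 = 1 by rewrite divff// gt_eqF.
set a := expR _ in h1 *; set l := ln y in h1 h2 *.
have h4 : y * (1 + - l) <= 1 by rewrite -[leRHS]h3 ler_pM2l.
clearbody a l; clear h2 h3 l0.
have h5 : (r - 1) * (y * (1 + - l)) <= (r - 1) * 1 by rewrite ler_pM2l ?subr_gt0.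
have h6 : y * (1 + (r - 1) * l) < y * a by rewrite ltr_pM2l.
nra.
Qed.

Lemma powR_bernoulli y r : 0 <= y -> 1 < r -> 1 + r * (y - 1) <= y `^ r.
Proof.
rewrite le_eqVlt => /orP[/eqP <-|y0] r1; first by rewrite (le_trans _ (powR_ge0 _ _))//; lra.
have [->|y1] := eqVneq y 1; first by rewrite powR1 subrr mulr0 addr0.
exact/ltW/powR_bernoulli_lt.
Qed.

Lemma powR_convex x y p : 1 < p ->
  (p + 1) * (`|x| `^ (p - 1) * x * y) <= p * `|x| `^ (p + 1) + `|y| `^ (p + 1).
Proof.
move=> p1; have p10 : p + 1 != 0 by rewrite gt_eqF; lra.
have [->|x0] := eqVneq x 0.
  by rewrite mulr0 mul0r mulr0 addr_ge0 ?mulr_ge0 ?powR_ge0; lra.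
have nx0 : 0 < `|x| by rewrite normr_gt0.
have B := @powR_bernoulli (`|y| / `|x|) (p + 1) ltac:(by rewrite divr_ge0) ltac:(by lra).
have e1 : `|y| `^ (p + 1) = (`|y| / `|x|) `^ (p + 1) * `|x| `^ (p + 1).
  by rewrite -powRM ?divr_ge0// divfK// gt_eqF.
have e2 : `|x| `^ (p + 1) = `|x| `^ (p - 1) * `|x| * `|x|.
  rewrite (_ : p + 1 = p - 1 + 1 + 1); last by ring.
  by rewrite !powRD ?powRr1//; apply/implyP => _; rewrite gt_eqF.
have e3 : `|x| `^ (p - 1) * x * y <= `|x| `^ (p - 1) * `|x| * `|y|.
  by rewrite -!mulrA ler_wpM2l ?powR_ge0// -normrM ler_norm.
rewrite e1; apply: (@le_trans _ _ (p * `|x| `^ (p + 1) + (1 + (p + 1) * (`|y| / `|x| - 1)) * `|x| `^ (p + 1))).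
  have -> : p * `|x| `^ (p + 1) + (1 + (p + 1) * (`|y| / `|x| - 1)) * `|x| `^ (p + 1) =
    (p + 1) * (`|x| `^ (p - 1) * `|x| * `|y|).
    by rewrite e2; field; rewrite gt_eqF.
  by rewrite ler_wpM2l//; lra.
by rewrite lerD2l ler_wpM2r ?powR_ge0.
Qed.

End bernoulli.

Section psd.
Context {R : realType} {W : lmodType R}.

Record subspace (H : W -> Prop) : Prop := Subspace {
  subD : forall u v, H u -> H v -> H (u + v);
  subZ : forall c u, H u -> H (c *: u) }.

Record psd (H : W -> Prop) (f : W -> W -> R) : Prop := Psd {
  psdC : forall u v, f u v = f v u;
  psdDl : forall u v w, H u -> H v -> H w -> f (u + v) w = f u w + f v w;
  psdZl : forall c u v, H u -> H v -> f (c *: u) v = c * f u v;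
  psd_ge0 : forall u, H u -> 0 <= f u u }.

Variables (H : W -> Prop) (f : W -> W -> R).
Hypotheses (HH : subspace H) (Hf : psd H f).

Lemma subN u : H u -> H (- u).
Proof. by move=> Hu; rewrite -scaleN1r; exact: subZ. Qed.

Lemma subB u v : H u -> H v -> H (u - v).
Proof. by move=> Hu Hv; apply: subD => //; exact: subN. Qed.

Lemma psdDr u v w : H u -> H v -> H w -> f u (v + w) = f u v + f u w.
Proof. by move=> Hu Hv Hw; rewrite ![f u _](psdC Hf) (psdDl Hf). Qed.

Lemma psdZr c u v : H u -> H v -> f u (c *: v) = c * f u v.
Proof. by move=> Hu Hv; rewrite ![f u _](psdC Hf) (psdZl Hf). Qed.

Lemma psdZ c u : H u -> f (c *: u) (c *: u) = c ^+ 2 * f u u.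
Proof. by move=> Hu; rewrite (psdZl Hf) ?psdZr// ?mulrA//; exact: subZ. Qed.

Lemma psd_line u v t : H u -> H v ->
  f (u + t *: v) (u + t *: v) = f u u + 2 * t * f u v + t ^+ 2 * f v v.
Proof.
move=> Hu Hv; have Htv : H (t *: v) by exact: subZ.
have Huv : H (u + t *: v) by exact: subD.
by rewrite (psdDl Hf)// !psdDr// (psdC Hf (t *: v) u) psdZ// psdZr//; ring.
Qed.

Lemma psdD u v : H u -> H v -> f (u + v) (u + v) = f u u + 2 * f u v + f v v.
Proof. by move=> Hu Hv; rewrite -[v in u + v]scale1r psd_line//; ring. Qed.

Lemma psdB u v : H u -> H v -> f (u - v) (u - v) = f u u - 2 * f u v + f v v.
Proof. by move=> Hu Hv; rewrite -scaleN1r psd_line//; ring. Qed.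

Lemma psd_mid u v : H u -> H v -> f (u + 2^-1 *: (v - u)) (u + 2^-1 *: (v - u)) =
  (f u u + f v v) / 2 - f (v - u) (v - u) / 4.
Proof.
move=> Hu Hv; have HB : H (v - u) by exact: subB.
rewrite psd_line//; have -> : v - u = v + (-1) *: u by rewrite scaleN1r.
rewrite psd_line// psdDr ?psdZr//; last exact: subZ.
by rewrite (psdC Hf v u); field.
Qed.

Lemma psd_close A eps : 0 <= A -> 0 < eps -> exists2 eta, 0 < eta &
  forall v z, H v -> H z -> f v v <= A -> f z z <= eta ->
    `|f (v + z) (v + z) - f v v| <= eps.
Proof.
move=> A0 e0; pose th := eps / (3 * (A + 1)).
have th0 : 0 < th by rewrite divr_gt0// mulr_gt0// ltr_wpDl.
have thA : th * A <= eps / 3.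
  by rewrite /th mulrAC ler_pdivrMr ?mulr_gt0// ?ltr_wpDl//; lra.
exists (Num.min (eps / 3) (th * (eps / 3))).
  by rewrite lt_min; apply/andP; split; last apply: mulr_gt0 => //; apply: divr_gt0.
move=> v z Hv Hz vA; rewrite le_min => /andP[z1 z2].
have v0 := psd_ge0 Hf Hv; have z0 := psd_ge0 Hf Hz.
have a1 : 0 <= f (z + th *: v) (z + th *: v).
  by apply: (psd_ge0 Hf); apply: subD => //; exact: subZ.
have a2 : 0 <= f (z + (- th) *: v) (z + (- th) *: v).
  by apply: (psd_ge0 Hf); apply: subD => //; exact: subZ.
rewrite psd_line// in a1; rewrite psd_line// in a2.
rewrite psdD// [f v z](psdC Hf).
move: th (f v v) (f z v) (f z z) th0 thA vA z1 z2 v0 z0 a1 a2 => th a b g th0 thA vA z1 z2 v0 z0 a1 a2.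
have h1 : 2 * b <= eps / 3 + eps / 3.
  rewrite -(ler_pM2l th0); have := ler_wpM2l (ltW th0) vA; have := ler_wpM2l (ltW th0) thA; nra.
have h2 : - (2 * b) <= eps / 3 + eps / 3.
  rewrite -(ler_pM2l th0); have := ler_wpM2l (ltW th0) vA; have := ler_wpM2l (ltW th0) thA; nra.
by rewrite ler_norml; apply/andP; split; lra.
Qed.

End psd.

Section energy.
Context {R : realType} {W : lmodType R}.
Implicit Types (u v w z phi : W).

Record energy_space (p : R) (H : W -> Prop) (T M L : W -> W -> R) : Prop := EnergySpace {
  es_sub : subspace H;
  es_T : psd H T;
  es_M : psd H M;
  es_LDr : forall u v w, H u -> H v -> H w -> L u (v + w) = L u v + L u w;
  es_LZr : forall c u v, H u -> H v -> L u (c *: v) = c * L u v;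
  es_LZl : forall c u v, H u -> H v -> L (c *: u) v = `|c| `^ (p - 1) * c * L u v;
  es_L_gt0 : forall u, H u -> M u u != 0 -> 0 < L u u;
  es_L_ge0 : forall u, H u -> 0 <= L u u;
  es_young : forall u v, H u -> H v -> (p + 1) * L u v <= p * L u u + L v v }.

Variables (p : R) (H : W -> Prop) (T M L : W -> W -> R).
Hypotheses (p1 : 1 < p) (ES : energy_space p H T M L).

Let HH := es_sub ES.
Let HT := es_T ES.
Let HM := es_M ES.

Definition energy c u : R := T u u / 2 - c / (p + 1) * L u u.

Definition action c mu u : R := T u u / 2 - mu / 2 * M u u - c / (p + 1) * L u u.

Definition minimal c u := [/\ H u, M u u = 1 &
  forall v, H v -> M v v = 1 -> energy c u <= energy c v].

Definition critical c mu u := [/\ H u, M u u != 0 &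
  forall phi, H phi -> T u phi - mu * M u phi = c * L u phi].

Let p1_gt0 : 0 < p + 1. Proof. by rewrite addr_gt0// (lt_trans ltr01). Qed.

Let p10 : p + 1 != 0. Proof. by rewrite gt_eqF. Qed.

Lemma LN u : H u -> L (- u) (- u) = L u u.
Proof.
move=> Hu; have HN := subN HH Hu.
by rewrite -scaleN1r (es_LZl ES) ?(es_LZr ES) ?scaleN1r// normrN normr1 powR1; ring.
Qed.

Lemma LZ c u : H u -> L (c *: u) (c *: u) = `|c| `^ (p - 1) * c ^+ 2 * L u u.
Proof.
by move=> Hu; rewrite (es_LZl ES) ?(es_LZr ES)//; [ring|exact: (subZ HH)].
Qed.

Lemma psd_normalize f v : psd H f -> H v -> 0 < M v v ->
  f ((Num.sqrt (M v v))^-1 *: v) ((Num.sqrt (M v v))^-1 *: v) = f v v / M v v.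
Proof.
by move=> Hf Hv m0; rewrite (psdZ HH Hf)// exprVn sqr_sqrtr ?ltW// mulrC.
Qed.

Lemma L_normalize v : H v -> 0 < M v v ->
  let m := Num.sqrt (M v v) in L (m^-1 *: v) (m^-1 *: v) = m^-1 `^ (p - 1) * (L v v / M v v).
Proof.
move=> Hv m0 m; rewrite LZ// exprVn sqr_sqrtr ?ltW//.
by rewrite ger0_norm ?invr_ge0 ?sqrtr_ge0//; ring.
Qed.

Lemma energy_normalize c v : H v -> 0 < M v v ->
  let m := Num.sqrt (M v v) in energy c (m^-1 *: v) =
    T v v / M v v / 2 - c / (p + 1) * (m^-1 `^ (p - 1) * (L v v / M v v)).
Proof. by move=> Hv m0 m; rewrite /energy L_normalize// psd_normalize. Qed.

Lemma normalizeP v : H v -> 0 < M v v ->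
  H ((Num.sqrt (M v v))^-1 *: v) /\
  M ((Num.sqrt (M v v))^-1 *: v) ((Num.sqrt (M v v))^-1 *: v) = 1.
Proof.
move=> Hv m0; split; first exact: (subZ HH).
by rewrite psd_normalize// divff// gt_eqF.
Qed.

Lemma linear_coef_eq0 (a K : R) :
  (forall t, `|t| <= 1 -> 0 <= t * a + K * t ^+ 2) -> a = 0.
Proof.
move=> h; apply/eqP; apply: contrapT => /negP a0.
pose N := 1 + `|a| + `|K|; have N0 : 0 < N by rewrite /N -addrA ltr_pwDl.
have na : 0 < `|a| by rewrite normr_gt0.
have := h (- a / (2 * N)); rewrite normrM normrN normfV (@gtr0_norm _ (2 * N)) ?mulr_gt0//.
rewrite ler_pdivrMr ?mulr_gt0//.
have -> : - a / (2 * N) * a + K * (- a / (2 * N)) ^+ 2 = (a ^+ 2 / (4 * N ^+ 2)) * (K - 2 * N).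
  by field; rewrite gt_eqF.
have q0 : 0 < a ^+ 2 / (4 * N ^+ 2).
  apply: divr_gt0; first by rewrite lt_def sqrf_eq0 a0 sqr_ge0.
  by rewrite mulr_gt0 ?exprn_gt0.
rewrite pmulr_rge0//; have := ler_norm K; have := normr_ge0 K.
by move=> K0 K1 /(_ _); rewrite /N => h2; have := h2 ltac:(rewrite /N in N0 *; lra); lra.
Qed.

(* Perturbing along a direction [z] orthogonal to [u] makes the normalization
   factor [1 + O(t^2)], so that only first-order terms of [T] and [L] remain. *)
Lemma minimal_orthogonal c u z : 0 <= c -> minimal c u -> H z -> M u z = 0 ->
  T u z = c * L u z.
Proof.
move=> c0 [Hu u1 umin] Hz uz.
have b0 := psd_ge0 HM Hz; have T0 := psd_ge0 HT Hz; have B0 := es_L_ge0 ES Hu.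
apply/eqP; rewrite -subr_eq0; apply/eqP.
apply: (@linear_coef_eq0 _ (T z z / 2 + c * `|L u z| * M z z + c * L u u * M z z)) => t t1.
have Hv : H (u + t *: z) by apply: (subD HH) => //; exact: (subZ HH).
have Mv : M (u + t *: z) (u + t *: z) = 1 + t ^+ 2 * M z z.
  by rewrite (psd_line HH HM)// uz u1; ring.
have t20 := sqr_ge0 t; have tb0 : 0 <= t ^+ 2 * M z z by exact: mulr_ge0.
have Mv0 : 0 < M (u + t *: z) (u + t *: z) by rewrite Mv; lra.
have [Hw w1] := normalizeP Hv Mv0; have e := umin _ Hw w1.
have Y := es_young ES Hu Hw.
have Tw := psd_normalize HT Hv Mv0.
rewrite /energy Tw in e; set Bw := L (_ *: _) (_ *: _) in Y e; clearbody Bw; move: e.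
rewrite (es_LZr ES)// (es_LDr ES)// ?(es_LZr ES)// in Y; last exact: (subZ HH).
rewrite (psd_line HH HT)//; set m := Num.sqrt _ in Y *.
have m2 : m ^+ 2 = 1 + t ^+ 2 * M z z by rewrite -Mv sqr_sqrtr// ltW.
have m1 : 1 <= m by rewrite -[leLHS]sqrtr1 /m ler_wsqrtr// Mv lerDl.
have m0 : 0 < m by lra.
rewrite Mv -m2 => e; clear Hw w1 Tw Mv Mv0.
clearbody m.
have {Y}e2 : T u u / 2 <= (T u u + 2 * t * T u z + t ^+ 2 * T z z) / m ^+ 2 / 2
   - c * (L u u + t * L u z) / m + c * L u u.
  have k0 : 0 <= c / (p + 1) by rewrite divr_ge0// ltW.
  have Y2 : c * (m^-1 * (L u u + t * L u z)) <= (c - c / (p + 1)) * L u u + c / (p + 1) * Bw.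
    by have := ler_wpM2l k0 Y; congr (_ <= _); field; rewrite ?p10 ?gt_eqF.
  move: e Y2; set k := c / (p + 1); clearbody k; set X := _ / m ^+ 2 / 2; clearbody X.
  by rewrite [_ / m]mulrC => e Y2; lra.
have {}e2 : T u u / 2 * m ^+ 2 <= (T u u + 2 * t * T u z + t ^+ 2 * T z z) / 2
   - c * (L u u + t * L u z) * m + c * L u u * m ^+ 2.
  have := ler_wpM2r (sqr_ge0 m) e2; congr (_ <= _); field.
  by rewrite gt_eqF.
have Tu0 := psd_ge0 HT Hu.
clear e umin b0; move: (T u u) (T u z) (T z z) (L u u) (L u z) (M z z) Tu0 T0 B0 m2 tb0 e2.
move=> Tu tau Tz B l b Tu0 T0 B0 m2 tb0 e2.
have mm : m - 1 <= t ^+ 2 * b.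
  have : m <= m ^+ 2 by rewrite expr2 ler_peMl// ltW.
  by rewrite m2; lra.
have h1 : c * B * (m ^+ 2 - m) <= c * B * (t ^+ 2 * b).
  by rewrite ler_wpM2l ?mulr_ge0// m2; lra.
have h2 : - (c * (t * l) * (m - 1)) <= c * `|l| * (t ^+ 2 * b).
  have tl : - (t * l) <= `|l|.
    rewrite (le_trans (ler_norm _))// normrN normrM ler_piMl//.
  have tl0 := normr_ge0 l; move: (`|l|) (t * l) tl tl0 => nl s tl tl0.
  apply: (@le_trans _ _ (c * nl * (m - 1))).
    have : 0 <= (c * (m - 1)) * (nl + s) by rewrite !mulr_ge0//; lra.
    lra.
  by rewrite ler_wpM2l// mulr_ge0.
have h3 : 0 <= Tu / 2 * (m ^+ 2 - 1) by rewrite mulr_ge0//; lra.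
lra.
Qed.

Lemma euler_lagrange c u : 0 <= c -> minimal c u -> critical c (T u u - c * L u u) u.
Proof.
move=> c0 umin; have [Hu u1 _] := umin; split=> //; first by rewrite u1 oner_neq0.
move=> phi Hphi; have Hbu : H (- M u phi *: u) by exact: (subZ HH).
have Hz : H (phi + - M u phi *: u) by exact: (subD HH).
have := minimal_orthogonal c0 umin Hz.
rewrite (psdDr HM)// (psdZr HM)// u1 (psdDr HT)// (psdZr HT)// (es_LDr ES)// (es_LZr ES)//.
by rewrite mulr1 subrr => /(_ erefl); lra.
Qed.

Lemma critical_nehari c mu u : critical c mu u -> T u u - mu * M u u = c * L u u.
Proof. by move=> [Hu _ e]; exact: e. Qed.

Lemma action_unit c mu u : M u u = 1 -> action c mu u = energy c u - mu / 2.
Proof. by rewrite /action /energy => ->; ring. Qed.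

Lemma powR_half_sqr y : 0 < y -> y `^ (p - 1) * y ^+ 2 = (y ^+ 2) `^ ((p + 1) / 2).
Proof.
move=> y0; rewrite -!powR_mulrn ?ltW// -powRrM -powRD; first by congr (_ `^ _); field.
by apply/implyP => _; rewrite gt_eqF.
Qed.

(* On the ray through a critical point, [t |-> t^2/2 - t^(p+1)/(p+1)] has its
   strict maximum at [t = 1]. *)
Lemma critical_ray c mu v : 0 < c -> critical c mu v ->
  0 < M v v /\ let w := (Num.sqrt (M v v))^-1 *: v in
  energy c w - mu / 2 <= action c mu v /\
  (energy c w - mu / 2 = action c mu v -> M v v = 1).
Proof.
move=> c0 vc; have [Hv v0 _] := vc; have N := critical_nehari vc.
have m0 : 0 < M v v by rewrite lt_def v0 (psd_ge0 HM).
split=> //= ; have K0 : 0 < c * L v v by rewrite mulr_gt0// (es_L_gt0 ES).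
rewrite energy_normalize// /action; set m := Num.sqrt _.
have m2 : m ^+ 2 = M v v by rewrite sqr_sqrtr// ltW.
have mp : 0 < m by rewrite sqrtr_gt0.
have -> : T v v = c * L v v + mu * M v v by rewrite -N; ring.
have y0 : 0 < m^-1 by rewrite invr_gt0.
have Q := powR_half_sqr y0; set Y := m^-1 ^+ 2 in Q *.
have MY : (M v v)^-1 = Y by rewrite /Y exprVn m2.
have r1 : 1 < (p + 1) / 2 by rewrite ltr_pdivlMr// mul1r ltrD2r.
have Y0 : 0 < Y by rewrite exprn_gt0.
set P := m^-1 `^ (p - 1) in Q *.
have -> : (c * L v v + mu * M v v) / M v v / 2 - c / (p + 1) * (P * (L v v / M v v)) - mu / 2 =
   c * L v v * (Y / 2 - Y `^ ((p + 1) / 2) / (p + 1)).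
  by rewrite -Q mulrDl mulfK// MY; field.
have -> : (c * L v v + mu * M v v) / 2 - mu / 2 * M v v - c / (p + 1) * L v v =
  c * L v v * (1 / 2 - 1 / (p + 1)) by field.
have ip1 : 0 < (p + 1)^-1 by rewrite invr_gt0.
have ip0 := ltW ip1.
split.
  rewrite ler_pM2l//; have := ler_wpM2r ip0 (powR_bernoulli (ltW Y0) r1).
  have -> : (1 + (p + 1) / 2 * (Y - 1)) / (p + 1) = 1 / (p + 1) + (Y - 1) / 2 by field.
  by move=> ?; lra.
move=> /(mulfI (lt0r_neq0 K0)) e; apply/eqP; rewrite -invr_eq1 MY; apply/eqP; apply: contrapT => /eqP Y1.
have := powR_bernoulli_lt Y0 r1 Y1.
rewrite -(ltr_pM2r ip1).
have -> : (1 + (p + 1) / 2 * (Y - 1)) / (p + 1) = 1 / (p + 1) + (Y - 1) / 2 by field.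
by move=> ?; lra.
Qed.

Lemma minimal_action_le c mu u v : 0 < c -> minimal c u -> critical c mu v ->
  action c mu u <= action c mu v.
Proof.
move=> c0 [Hu u1 umin] vc; have [m0 /= [h _]] := critical_ray c0 vc.
apply: le_trans h; rewrite action_unit// lerD2r; have [Hv _ _] := vc.
by have [Hw w1] := normalizeP Hv m0; exact: umin.
Qed.

Lemma critical_minimal c mu u v : 0 < c -> minimal c u -> critical c mu v ->
  action c mu v <= action c mu u -> minimal c v.
Proof.
move=> c0 [Hu u1 umin] vc vu; have [m0 /= [h1 h2]] := critical_ray c0 vc.
have [Hv _ _] := vc; have [Hw w1] := normalizeP Hv m0.
have uw := umin _ Hw w1; rewrite (action_unit _ _ u1) in vu.
have v1 : M v v = 1 by apply: h2; apply/eqP; rewrite eq_le h1 /=; apply: (le_trans vu); rewrite lerD2r.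
split=> // w Hww ww1; apply: le_trans (umin _ Hww ww1).
by move: vu; rewrite (action_unit _ _ v1) lerD2r.
Qed.

Lemma minimal_energy_eq c u v : minimal c u -> minimal c v -> energy c u = energy c v.
Proof.
by move=> [Hu u1 umin] [Hv v1 vmin]; apply/eqP; rewrite eq_le umin// vmin.
Qed.

Lemma minimal_L_le c1 c2 u v : c1 < c2 -> minimal c1 u -> minimal c2 v -> L u u <= L v v.
Proof.
move=> c12 [Hu u1 umin] [Hv v1 vmin]; have := umin v Hv v1; have := vmin u Hu u1.
rewrite /energy => h1 h2.
have : 0 <= (c2 - c1) / (p + 1) * (L v v - L u u).
  rewrite (_ : _ * _ = c2 / (p + 1) * L v v - c2 / (p + 1) * L u u
    - (c1 / (p + 1) * L v v - c1 / (p + 1) * L u u)); last by ring.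
  lra.
by rewrite pmulr_rge0 ?subr_ge0// divr_gt0 ?subr_gt0.
Qed.

End energy.

Section countable_jumps.
Context {R : realType}.

Lemma countable_gaps (N : set R) (f g : R -> R) :
  (forall x, N x -> f x < g x) -> (forall x y, N x -> N y -> x < y -> g x <= f y) ->
  countable N.
Proof.
move=> fg gf; have /choice[r Hr] : forall x, exists r : rat, N x -> f x < ratr r < g x.
  move=> x; have [Nx|Nx] := pselect (N x); last by exists 0.
  by have [r] := rat_in_itvoo (fg _ Nx); rewrite in_itv/= => rP; exists r.
apply/countable_injP; exists (pickle \o r) => x y; rewrite !inE => Nx Ny /= /(pcan_inj pickleK) e.
apply: contrapT => /eqP; rewrite neq_lt => /orP[xy|yx].
  have := gf _ _ Nx Ny xy; have /andP[_ h1] := Hr x Nx; have /andP[h2 _] := Hr y Ny.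
  by rewrite e in h1; lra.
have := gf _ _ Ny Nx yx; have /andP[h1 _] := Hr x Nx; have /andP[_ h2] := Hr y Ny.
by rewrite e in h1; lra.
Qed.

End countable_jumps.

Section existence.
Context {R : realType} {W : lmodType R}.
Variables (p : R) (H : W -> Prop) (T M L : W -> W -> R).
Hypotheses (p1 : 1 < p) (ES : energy_space p H T M L).
Let HH := es_sub ES.
Let HT := es_T ES.
Let HM := es_M ES.

Hypothesis GN : forall eps, 0 < eps -> exists2 C, 0 <= C &
  forall w, H w -> M w w <= 1 -> L w w <= C * M w w + eps * T w w.

Hypothesis compactH : forall (w : nat -> W) C,
  (forall n, [/\ H (w n), M (w n) (w n) <= C & T (w n) (w n) <= C]) ->
  exists sigma : nat -> nat, (forall k, (k <= sigma k)%N) /\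
    forall eps, 0 < eps -> exists N, forall m n, (N <= m)%N -> (N <= n)%N ->
      M (w (sigma m) - w (sigma n)) (w (sigma m) - w (sigma n)) <= eps.

Hypothesis completeH : forall w : nat -> W, (forall n, H (w n)) ->
  (forall eps, 0 < eps -> exists N, forall m n, (N <= m)%N -> (N <= n)%N ->
    M (w m - w n) (w m - w n) <= eps /\ T (w m - w n) (w m - w n) <= eps) ->
  exists2 v, H v & forall eps N, 0 < eps -> exists n, [/\ (N <= n)%N,
    M (v - w n) (v - w n) <= eps & T (v - w n) (v - w n) <= eps].

Let p1_gt0 : 0 < p + 1. Proof. by rewrite addr_gt0// (lt_trans ltr01). Qed.
Let p_ge0 : 0 <= p. Proof. by rewrite ltW// (lt_trans ltr01). Qed.

Lemma L_small A delta : 0 <= A -> 0 < delta -> exists2 eta, 0 < eta &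
  forall u z, H u -> H z -> L u u <= A -> T z z <= A -> M z z <= eta ->
    `|L u z| <= delta.
Proof.
move=> A0 d0; pose lam := 1 + 3 * p * A / delta.
have lam0 : 0 < lam by rewrite ltr_wpDr// divr_ge0 ?(ltW d0)// !mulr_ge0.
have lamA : p * A <= delta / 3 * lam.
  rewrite /lam; have -> : delta / 3 * (1 + 3 * p * A / delta) = delta / 3 + p * A.
    by field; rewrite gt_eqF.
  by rewrite lerDr divr_ge0// ltW.
pose Lam := lam `^ (p - 1) * lam.
have Lam0 : 0 < Lam by rewrite mulr_gt0// powR_gt0.
have denA : 0 < 3 * Lam * (A + 1) by rewrite mulr_gt0 ?ltr_wpDl// mulr_gt0.
have [|C C0 HC] := @GN (delta / (3 * Lam * (A + 1))).
  by rewrite divr_gt0.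
pose eta := Num.min 1 (delta / (3 * Lam * (C + 1))).
have eta0 : 0 < eta by rewrite lt_min ltr01 divr_gt0// mulr_gt0 ?ltr_wpDl// mulr_gt0.
exists eta => // u z Hu Hz uA zA zeta.
have Lz : Lam * L z z <= delta / 3 + delta / 3.
  have z1 : M z z <= 1 by apply: (le_trans zeta); rewrite ge_min lexx.
  apply: (@le_trans _ _ (Lam * (C * eta + delta / (3 * Lam * (A + 1)) * A))).
    rewrite ler_pM2l//; apply: (le_trans (HC z Hz z1)); apply: lerD; apply: ler_wpM2l => //.
    exact: divr_ge0 (ltW d0) (ltW denA).
  rewrite mulrDr; apply: lerD.
    apply: (@le_trans _ _ (Lam * (C * (delta / (3 * Lam * (C + 1)))))).
      rewrite ler_pM2l//; apply: ler_wpM2l => //.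
      by rewrite /eta ge_min lexx orbT.
    have -> : Lam * (C * (delta / (3 * Lam * (C + 1)))) = delta / 3 * (C / (C + 1)).
      by field; rewrite !gt_eqF// ltr_wpDl.
    by rewrite ler_piMr ?divr_ge0 ?(ltW d0)// ler_pdivrMr ?ltr_wpDl// mul1r lerDl.
  have -> : Lam * (delta / (3 * Lam * (A + 1)) * A) = delta / 3 * (A / (A + 1)).
    by field; rewrite !gt_eqF// ltr_wpDl.
  by rewrite ler_piMr ?divr_ge0 ?(ltW d0)// ler_pdivrMr ?ltr_wpDl// mul1r lerDl.
have key z' : H z' -> L z' z' = L z z -> L u z' <= delta.
  move=> Hz' e; have Hlz : H (lam *: z') by exact: (subZ HH).
  have := es_young ES Hu Hlz.
  rewrite (LZ ES)// (es_LZr ES)// gtr0_norm// e.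
  have -> : lam `^ (p - 1) * lam ^+ 2 * L z z = lam * (Lam * L z z) by rewrite /Lam; ring.
  move: Lz; move: (Lam * L z z) => X XD Y.
  have Y2 : lam * ((p + 1) * L u z') <= lam * (delta / 3 + X).
    have h : p * L u u <= p * A by exact: ler_wpM2l.
    rewrite mulrDr [lam * (_ / _)]mulrC mulrCA (le_trans Y)// lerD2r.
    exact: le_trans lamA.
  move: Y2; rewrite ler_pM2l// => Y2.
  have [l0|l0] := ltP 0 (L u z'); last exact: le_trans l0 (ltW d0).
  apply: (@le_trans _ _ ((p + 1) * L u z')); last by lra.
  by rewrite ler_peMl ?(ltW l0)// lerDr.
rewrite ler_norml key// andbT lerNl -mulN1r -(es_LZr ES)//.
by apply: key; rewrite scaleN1r ?(LN ES)//; exact: (subN HH).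
Qed.

(* The parallelogram identity for [T], with the convexity of [L] and the
   homogeneity of the energy, turns an M-Cauchy minimizing sequence into a
   T-Cauchy one, so no weak compactness is required. *)
Lemma exists_minimal c : 0 <= c -> (exists2 w, H w & M w w = 1) ->
  exists u, minimal p H T M L c u.
Proof.
move=> c0 [w0 Hw0 Mw0].
pose k := c / (p + 1); have k0 : 0 <= k by rewrite divr_ge0// ltW.
have [|C1 C10 GN1] := @GN (1 / (4 * (k + 1))); first by rewrite divr_gt0// mulr_gt0 ?ltr_wpDl.
have lower w : H w -> M w w = 1 -> T w w / 4 - k * C1 <= energy p T L c w.
  move=> Hw w1; rewrite /energy -/k; have := GN1 w Hw; rewrite w1 => /(_ (lexx _)) h.
  have T0 := psd_ge0 HT Hw; have := ler_wpM2l k0 h.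
  have : k * (1 / (4 * (k + 1)) * T w w) <= T w w / 4.
    have -> : k * (1 / (4 * (k + 1)) * T w w) = T w w / 4 * (k / (k + 1)).
      by field; rewrite gt_eqF// ltr_wpDl.
    by rewrite ler_piMr ?divr_ge0// ler_pdivrMr ?ltr_wpDl// mul1r lerDl.
  by rewrite mulr1 mulrDr; move: (L w w) (1 / _ * _) => l y; lra.
pose S : set R := [set energy p T L c w | w in [set w | H w /\ M w w = 1]].
have S0 : S !=set0 by exists (energy p T L c w0), w0.
have Sb : has_lbound S.
  exists (- (k * C1)) => _ [w [Hw w1] <-]; apply: le_trans (lower w Hw w1).
  by have := psd_ge0 HT Hw; lra.
pose e := inf S.
have e_le w : H w -> M w w = 1 -> e <= energy p T L c w.
  by move=> Hw w1; apply: ge_inf => //; exists w.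
have /choice[w Hw] : forall n : nat, exists w, [/\ H w, M w w = 1 &
    energy p T L c w < e + n.+1%:R^-1].
  move=> n; have [_ [w [Hw w1] <-] h] := @inf_adherent _ S n.+1%:R^-1 ltac:(by []) (conj S0 Sb).
  by exists w.
clearbody e.
pose A0 := 4 * (`|e| + 1 + k * C1).
have TA n : T (w n) (w n) <= A0.
  have [Hn n1 En] := Hw n; have := lower _ Hn n1.
  have : n.+1%:R^-1 <= 1 :> R by rewrite invf_le1// ler1n.
  rewrite /A0; move: (`|e|) (ler_norm e) => ae e1; move: (energy _ _ _ _ _) (n.+1%:R^-1) En => E i; lra.
have A00 : 0 <= A0 by apply: mulr_ge0 => //; apply: addr_ge0; [exact: addr_ge0|exact: mulr_ge0].
have [|C2 C20 GN2] := @GN 1 => //.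
pose A := 4 * A0 + C2 + 1; have A_0 : 0 <= A by rewrite /A !addr_ge0// mulr_ge0.
have [|sigma [ksigma cau]] := @compactH w (A0 + 1).
  move=> n; have [Hn n1 _] := Hw n; split => //; first by rewrite n1 lerDr.
  by rewrite (le_trans (TA n))// lerDl.
pose v n := w (sigma n).
have Hv n : H (v n) by have [] := Hw (sigma n).
have v1 n : M (v n) (v n) = 1 by have [] := Hw (sigma n).
have TAv n : T (v n) (v n) <= A.
  by apply: (le_trans (TA _)); rewrite /A; lra.
have LAv n : L (v n) (v n) <= A.
  have := GN2 _ (Hv n); rewrite v1 => /(_ (lexx _)); have := TA (sigma n); rewrite -/(v n) /A; lra.
have TAd m n : T (v m - v n) (v m - v n) <= A.
  have h : 0 <= T (v m + v n) (v m + v n) by apply: (psd_ge0 HT); exact: (subD HH).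
  rewrite (psdD HH HT)// in h; rewrite (psdB HH HT)//.
  have := TA (sigma m); have := TA (sigma n); rewrite -/(v m) -/(v n) /A; lra.
have HvB m n : H (v m - v n) by exact: (subB HH).
have Ev n N : (N <= n)%N -> energy p T L c (v n) < e + N.+1%:R^-1.
  move=> Nn; have [_ _ h] := Hw (sigma n); apply: (lt_le_trans h); rewrite lerD2l.
  by rewrite lef_pV2 ?posrE// ler_nat ltnS (leq_trans Nn).
have small (eps : R) : 0 < eps -> exists N : nat, N.+1%:R^-1 <= eps.
  move=> e0; exists (Num.trunc eps^-1).
  by rewrite -[leRHS]invrK lef_pV2 ?posrE ?invr_gt0// ltW// truncnS_gt.
have cauT (eps : R) : 0 < eps -> exists N, forall m n, (N <= m)%N -> (N <= n)%N ->
    T (v m - v n) (v m - v n) <= eps.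
  move=> e0; pose d := eps / (64 * (k + 1)).
  have d0 : 0 < d by rewrite divr_gt0// mulr_gt0// ltr_wpDl.
  have kd : k * d <= eps / 64.
    have -> : k * d = eps / 64 * (k / (k + 1)) by rewrite /d; field; rewrite gt_eqF// ltr_wpDl.
    by rewrite ler_piMr ?divr_ge0 ?(ltW e0)// ler_pdivrMr ?ltr_wpDl// mul1r lerDl.
  have [eta eta0 Hsmall] := L_small A_0 (divr_gt0 d0 p1_gt0).
  have e00 := normr_ge0 e.
  pose th := Num.min eta (Num.min 1 (eps / (64 * (`|e| + 1)))).
  have th0 : 0 < th by rewrite !lt_min eta0 ltr01 divr_gt0// mulr_gt0// ltr_wpDl.
  have eth : `|e| * th <= eps / 64.
    apply: (@le_trans _ _ (`|e| * (eps / (64 * (`|e| + 1))))).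
      by apply: ler_wpM2l => //; rewrite /th !ge_min lexx !orbT.
    have -> : `|e| * (eps / (64 * (`|e| + 1))) = eps / 64 * (`|e| / (`|e| + 1)).
      by field; rewrite gt_eqF// ltr_wpDl.
    by rewrite ler_piMr ?divr_ge0 ?(ltW e0)// ler_pdivrMr ?ltr_wpDl// mul1r lerDl.
  have [N1 HN1] := cau th th0; have [|N2 HN2] := small (eps / 64); first exact: divr_gt0.
  exists (maxn N1 N2) => m n; rewrite !geq_max => /andP[m1 m2] /andP[n1 n2].
  have Mz := HN1 m n m1 n1; rewrite -/(v m) -/(v n) in Mz.
  have Mz1 : M (v m - v n) (v m - v n) <= 1 by apply: (le_trans Mz); rewrite /th !ge_min lexx !orbT.
  have Mz0 := psd_ge0 HM (HvB m n).
  have Lb i j : (i = m /\ j = n) \/ (i = n /\ j = m) ->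
      L (v i) (v i) - d <= L (v n + 2^-1 *: (v m - v n)) (v n + 2^-1 *: (v m - v n)).
    move=> ij; have -> : v n + 2^-1 *: (v m - v n) = v i + 2^-1 *: (v j - v i).
      case: ij => -[-> ->] //; have -> : v m = (v m - v n) + v n by rewrite subrK.
      rewrite addrK opprD addrCA subrr addr0 scalerN.
      have {2}-> : v m - v n = 2^-1 *: (v m - v n) + 2^-1 *: (v m - v n).
        by rewrite -scalerDl -[LHS]scale1r; congr (_ *: _); field.
      by rewrite addrAC addrK addrC.
    have Hy : H (2^-1 *: (v j - v i)) by exact: (subZ HH).
    have := es_young ES (Hv i) (subD HH (Hv i) Hy).
    rewrite (es_LDr ES)// (es_LZr ES)//.
    have : `|L (v i) (v j - v i)| <= d / (p + 1).
      apply: Hsmall => //.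
      have -> : M (v j - v i) (v j - v i) = M (v m - v n) (v m - v n).
        case: ij => -[-> ->] //; by rewrite !(psdB HH HM)// (psdC HM (v n)); ring.
      by apply: (le_trans Mz); rewrite /th ge_min lexx.
    rewrite ler_pdivlMr// => h; have : - d <= (p + 1) * L (v i) (v j - v i).
      by rewrite lerNl -mulrN (le_trans _ h)// mulrC ler_pM2r// -normrN ler_norm.
    move: (L _ _) (L (v i) (v i)) => l B; lra.
  have L1 := Lb m n (or_introl (conj erefl erefl)).
  have L2 := Lb n m (or_intror (conj erefl erefl)).
  have Hmid : H (v n + 2^-1 *: (v m - v n)) by apply: (subD HH) => //; exact: (subZ HH).
  have := psd_mid HH HM (Hv n) (Hv m); have := psd_mid HH HT (Hv n) (Hv m).
  rewrite !v1; move: (v n + _) Hmid L1 L2 {Lb} => y Hy L1 L2 Ty My.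
  have My0 : 0 < M y y by rewrite My; lra.
  have [Hyn yn1] := normalizeP ES Hy My0; have := e_le _ Hyn yn1.
  rewrite (energy_normalize ES c)// -/k.
  set m' := Num.sqrt _.
  have m'0 : 0 < m' by rewrite sqrtr_gt0.
  have m'1 : m' <= 1 by rewrite -[leRHS]sqrtr1 ler_wsqrtr// My; lra.
  have q1 : 1 <= m'^-1 `^ (p - 1).
    rewrite -[leLHS](powRr0 m'^-1) ler_powR//; last by rewrite subr_ge0 ltW.
    by rewrite invf_ge1.
  have Ly0 := es_L_ge0 ES Hy.
  move=> ey; have {ey q1} ey : e * M y y <= T y y / 2 - k * L y y.
    have := ler_wpM2r (ltW My0) ey; move/le_trans; apply.
    rewrite (_ : _ * M y y = T y y / 2 - k * (m'^-1 `^ (p - 1) * L y y)); last first.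
      by field; rewrite gt_eqF.
    by rewrite lerD2l lerN2; apply: ler_wpM2l => //; rewrite ler_peMl.
  have Em : energy p T L c (v m) <= e + eps / 64.
    by apply: le_trans (ltW (Ev m N2 m2)) _; rewrite lerD2l.
  have En : energy p T L c (v n) <= e + eps / 64.
    by apply: le_trans (ltW (Ev n N2 n2)) _; rewrite lerD2l.
  rewrite /energy -/k in Em En.
  have eM : - (`|e| * th) / 4 <= e * (M y y - 1).
    rewrite My; have h : - (e * M (v m - v n) (v m - v n)) >= - (`|e| * th).
      rewrite lerN2; apply: (@le_trans _ _ (`|e| * M (v m - v n) (v m - v n))).
        by apply: ler_wpM2r => //; exact: ler_norm.
      exact: ler_wpM2l.
    by lra.
  have kL1 := ler_wpM2l k0 L1; have kL2 := ler_wpM2l k0 L2.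
  rewrite !mulrBr in kL1 kL2.
  by rewrite Ty in ey; lra.
have [|u Hu cvu] := completeH Hv.
  move=> eps e0; have [N1 HN1] := cau eps e0; have [N2 HN2] := cauT eps e0.
  exists (maxn N1 N2) => m n; rewrite !geq_max => /andP[m1 m2] /andP[n1 n2].
  by split; [exact: HN1|exact: HN2].
have A1 : 1 <= A by rewrite /A lerDr addr_ge0// mulr_ge0.
have close eps : 0 < eps -> exists n, [/\ `|M u u - 1| <= eps,
    `|T u u - T (v n) (v n)| <= eps, energy p T L c (v n) <= e + eps &
    L (v n) (v n) - eps <= L u u].
  move=> e0; have [eta1 eta10 cl1] := psd_close HH HM (ltW ltr01) e0.
  have [eta2 eta20 cl2] := psd_close HH HT A_0 e0.
  have [eta3 eta30 cl3] := L_small A_0 (divr_gt0 e0 p1_gt0).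
  pose eta := Num.min (Num.min eta1 eta2) (Num.min eta3 1).
  have eta0 : 0 < eta by rewrite !lt_min eta10 eta20 eta30 ltr01.
  have [N HN] := small _ e0; have [n [Nn Mn Tn]] := cvu eta N eta0.
  have Hz : H (u - v n) by exact: (subB HH).
  have uE : u = v n + (u - v n) by rewrite addrC subrK.
  move: Mn Tn; rewrite !le_min => /andP[/andP[Mn1 Mn2] /andP[Mn3 Mn4]].
  move=> /andP[/andP[Tn1 Tn2] /andP[Tn3 Tn4]].
  exists n; split.
  - by rewrite -(v1 n) {1 2}uE; apply: cl1; rewrite ?v1.
  - by rewrite {1 2}uE; exact: cl2.
  - by apply: le_trans (ltW (Ev n N Nn)) _; rewrite lerD2l.
  have h := cl3 _ _ (Hv n) Hz (LAv n) (le_trans Tn4 A1) Mn3.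
  have := es_young ES (Hv n) Hu; rewrite {1}uE (es_LDr ES)//.
  have : - eps <= (p + 1) * L (v n) (u - v n).
    rewrite ler_pdivlMr// in h.
    by rewrite lerNl -mulrN (le_trans _ h)// mulrC ler_pM2r// -normrN ler_norm.
  move: (L (v n) (u - v n)) => l; lra.
have u1 : M u u = 1.
  apply/eqP; rewrite -subr_eq0 -normr_eq0 eq_le normr_ge0 andbT.
  by apply/ler_addgt0Pl => eps /close[n []]; rewrite addr0.
exists u; split => // y Hy y1; apply: le_trans (e_le y Hy y1).
apply/ler_addgt0Pl => eps e0.
have [|n [_ Tn En Ln]] := close (eps / (2 + k)); first by rewrite divr_gt0// ltr_wpDr.
move: En; rewrite /energy -/k => En; have := ler_wpM2l k0 Ln.
have h : eps / (2 + k) * (2 + k) = eps by rewrite divfK// gt_eqF// ltr_wpDr.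
move: Tn; rewrite ler_norml => /andP[_].
have : 0 <= eps / (2 + k) by rewrite divr_ge0 ?(ltW e0)// addr_ge0.
move: (eps / (2 + k)) h En => dl <-.
rewrite mulrBr; lra.
Qed.

End existence.

(** * The Schroedinger energy *)

Section schrodinger_energy.
Context {R : realType} (d : nat).
Local Notation mu := (@vol R d).
Variables (p : R) (V : 'rV[R]_d -> R).
Hypotheses (d1 : (1 <= d)%N) (p1 : 1 < p) (pd : p < 1 + 4 / d%:R).
Hypotheses (V0 : forall x, 0 <= V x) (mV : measurable_fun setT V).

Let W : lmodType R := (('rV[R]_d -> R) * ('I_d * 'rV[R]_d -> R))%type.
Implicit Types (w v : W) (u : 'rV[R]_d -> R).

Definition grad w : 'I_d -> 'rV[R]_d -> R := fun i x => w.2 (i, x).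

Definition weighted u : 'rV[R]_d -> R := fun x => Num.sqrt (V x) * u x.

Definition Hspace w := sobolev w.1 (grad w) /\ L2fun mu (weighted w.1).

Definition Tform w v : R :=
  \sum_(i < d) ip mu (grad w i) (grad v i) + ip mu (weighted w.1) (weighted v.1).

Definition Mform w v : R := ip mu w.1 v.1.

Definition Lform w v : R := Rintegral mu setT (fun x => `|w.1 x| `^ (p - 1) * w.1 x * v.1 x).

Lemma weightedD u u' : weighted (fun x => u x + u' x) = fun x => weighted u x + weighted u' x.
Proof. by apply/funext => x; rewrite /weighted mulrDr. Qed.

Lemma weightedZ c u : weighted (fun x => c * u x) = fun x => c * weighted u x.
Proof. by apply/funext => x; rewrite /weighted mulrCA. Qed.

Lemma weighted_sqr u x : weighted u x ^+ 2 = V x * u x ^+ 2.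
Proof. by rewrite exprMn sqr_sqrtr. Qed.

Lemma measurable_weighted u : measurable_fun setT u -> measurable_fun setT (weighted u).
Proof.
move=> mu'; apply: measurable_funM => //; apply: (measurableT_comp _ mV).
by apply: continuous_measurable_fun; exact: sqrt_continuous.
Qed.

Lemma HspaceP w : HV V w.1 (grad w) <-> Hspace w.
Proof.
have E : measurable_fun setT w.1 -> Int (fun x => (V x * w.1 x ^+ 2)%:E) =
    (\int[mu]_x (weighted w.1 x ^+ 2)%:E)%E.
  move=> mw; rewrite ge0_IntE; first by apply: eq_integral => x _; rewrite weighted_sqr.
    by move=> x; rewrite lee_fin mulr_ge0 ?sqr_ge0.
  by apply/measurable_EFinP; apply: measurable_funM => //; exact: measurable_funX.
split=> [[/L2E w2 g2 wg Vw]|[[w2 g2 wg] [mVw Vw]]].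
  have [mw _] := w2; split; first by split => // i; exact/L2E.
  by split; [exact: measurable_weighted|rewrite -E].
have [mw _] := w2; split=> //; [exact/L2E|by move=> i; exact/L2E|by rewrite E].
Qed.

Let scale1 c w : (c *: w).1 = fun x => c * w.1 x.
Proof. by []. Qed.

Let scale2 c w : grad (c *: w) = fun i x => c * grad w i x.
Proof. by []. Qed.

Lemma subspace_Hspace : subspace Hspace.
Proof.
split=> [u v [u1 u2] [v1 v2]|c u [u1 u2]].
  by split; [exact: sobolevD u1 v1|rewrite [weighted _](weightedD u.1 v.1); exact: L2D].
rewrite /Hspace scale1 scale2 weightedZ; split; [exact: sobolevZ|exact: L2Z].
Qed.

Lemma psd_Mform : psd Hspace Mform.
Proof.
split=> [u v|u v w [[? _ _] _] [[? _ _] _] [[? _ _] _]|c u v [[? _ _] _] [[? _ _] _]|u _].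
- by rewrite /Mform ipC.
- exact: ipDl.
- by rewrite /Mform scale1 ipZl.
- exact: ip_ge0.
Qed.

Lemma psd_Tform : psd Hspace Tform.
Proof.
split=> [u v|u v w [[_ u2 _] u3] [[_ v2 _] v3] [[_ w2 _] w3]|c u v [[_ u2 _] u3] [[_ v2 _] v3]|u _].
- by rewrite /Tform ipC; congr (_ + _); apply: eq_bigr => i _; rewrite ipC.
- rewrite /Tform [weighted (u + v).1](weightedD u.1 v.1) ipDl// addrACA -big_split/=; congr (_ + _).
  by apply: eq_bigr => i _; exact: (ipDl (u2 i) (v2 i) (w2 i)).
- rewrite /Tform scale1 scale2 weightedZ ipZl// mulrDr mulr_sumr; congr (_ + _).
  by apply: eq_bigr => i _; exact: (ipZl c (u2 i) (v2 i)).
- by rewrite addr_ge0 ?ip_ge0//; exact: dirichlet_ge0.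
Qed.

Lemma dirichlet_le_Tform w : dirichlet (grad w) <= Tform w w.
Proof. by rewrite lerDl ip_ge0. Qed.

Let q0 : 0 < p - 1. Proof. by rewrite subr_gt0. Qed.

Let qd : (p - 1) * d%:R < 4.
Proof.
by rewrite -ltr_pdivlMr ?ltr0n// ltrBlDl.
Qed.

Let qp : p - 1 + 2 = p + 1. Proof. by ring. Qed.

Lemma powR_sqrp (y : R) : `|y| `^ (p + 1) = `|y| `^ (p - 1) * y ^+ 2.
Proof. by rewrite -qp powR_sqr. Qed.

Lemma measurable_powRp u r : measurable_fun setT u -> measurable_fun setT (fun x => `|u x| `^ r).
Proof.
move=> mu'; apply: (measurableT_comp (measurable_powR r)).
exact: measurableT_comp.
Qed.

Lemma sobolev_powR_integrable u g : sobolev u g ->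
  mu.-integrable setT (EFin \o (fun x => `|u x| `^ (p + 1))).
Proof.
move=> ug; have [u2 _ _] := ug; have [mu' _] := u2.
have [C C0 HC] := gagliardo_nirenberg d1 q0 qd ltr01.
pose c := (1 + ip mu u u)^-1; have m0 := ip_ge0 mu u.
have D1 : 0 < 1 + ip mu u u by rewrite ltr_wpDr.
have c0 : 0 < c by rewrite invr_gt0.
have := HC _ _ (sobolevZ c ug); rewrite ipZl ?ipZr//; last exact: L2Z.
have c1 : c * (c * ip mu u u) <= 1.
  have : c * ip mu u u <= 1 by rewrite mulrC ler_pdivrMr// mul1r lerDr.
  have : c <= 1 by rewrite invf_le1// lerDl.
  move=> h1 h2; rewrite -[leRHS]mulr1; apply: ler_pM => //; first exact: ltW.
  by rewrite mulr_ge0// ltW.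
move=> /(_ c1) H; apply: ge0_integrable_EFin => [|x|].
- exact: measurable_powRp.
- exact: powR_ge0.
have -> : (\int[mu]_x (`|u x| `^ (p + 1))%:E =
    (c `^ (p + 1))^-1%:E * \int[mu]_x (`|c * u x| `^ (p - 1 + 2))%:E)%E.
  have mm : measurable_fun setT (fun x => (`|c * u x| `^ (p - 1 + 2))%:E).
    by apply/measurable_EFinP; apply: measurable_powRp; exact: measurable_funM.
  have k0 : (0 <= (c `^ (p + 1))^-1%:E)%E by rewrite lee_fin invr_ge0 powR_ge0.
  rewrite -ge0_integralZl//.
  apply: eq_integral => x _; rewrite -EFinM qp normrM powRM// (gtr0_norm c0) mulKf//.
  by rewrite gt_eqF// powR_gt0.
apply: (@le_lt_trans _ _ ((c `^ (p + 1))^-1%:E *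
   (C * (c * (c * ip mu u u)) + 1 * dirichlet (fun i x => c * g i x))%:E)%E).
  by apply: lee_wpmul2l => //; rewrite lee_fin invr_ge0 powR_ge0.
by rewrite -EFinM ltry.
Qed.

Lemma Hspace_powR_integrable w : Hspace w ->
  mu.-integrable setT (EFin \o (fun x => `|w.1 x| `^ (p + 1))).
Proof. by move=> [ug _]; exact: sobolev_powR_integrable ug. Qed.

Lemma Hspace_measurable w : Hspace w -> measurable_fun setT w.1.
Proof. by move=> [[[]]]. Qed.

Let p1_gt0 : 0 < p + 1. Proof. by rewrite addr_gt0// (lt_trans ltr01). Qed.

Lemma Lform_integrable w v : Hspace w -> Hspace v ->
  mu.-integrable setT (EFin \o (fun x => `|w.1 x| `^ (p - 1) * w.1 x * v.1 x)).
Proof.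
move=> Hw Hv; have iw := Hspace_powR_integrable Hw; have iv := Hspace_powR_integrable Hv.
have mw := Hspace_measurable Hw; have mv := Hspace_measurable Hv.
apply: (@le_integrable_EFin _ _ _ _ _ (fun x => `|w.1 x| `^ (p + 1) + `|v.1 x| `^ (p + 1))).
- by apply: measurable_funM => //; apply: measurable_funM => //; exact: measurable_powRp.
- exact: (integrableD measurableT iw iv).
move=> x; have h1 := powR_convex (w.1 x) (v.1 x) p1.
have := powR_convex (w.1 x) (- v.1 x) p1; rewrite mulrN normrN => h2.
have a0 := powR_ge0 `|w.1 x| (p + 1); have b0 := powR_ge0 `|v.1 x| (p + 1).
rewrite -(ler_pM2l p1_gt0).
rewrite -[p + 1 in X in X <= _](gtr0_norm p1_gt0) -normrM.
have pb : 0 <= p * (`|v.1 x| `^ (p + 1)) by rewrite mulr_ge0// ltW// (lt_trans ltr01).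
by rewrite ler_norml; apply/andP; split; lra.
Qed.

Lemma Lform_diag w : Lform w w = Rintegral mu setT (fun x => `|w.1 x| `^ (p + 1)).
Proof. by apply: eq_Rintegral => x _; rewrite powR_sqrp expr2 mulrA. Qed.

Lemma Lform_diagE w : Hspace w -> (\int[mu]_x (`|w.1 x| `^ (p + 1))%:E)%E = (Lform w w)%:E.
Proof. by move=> Hw; rewrite Lform_diag Rintegral_EFin//; exact: Hspace_powR_integrable. Qed.

Lemma Lform_gt0 w : Hspace w -> Mform w w != 0 -> 0 < Lform w w.
Proof.
move=> Hw; apply: contraNT; rewrite -leNgt => L0.
have mw := Hspace_measurable Hw; have [[w2 _ _] _] := Hw.
have mp := measurable_powRp (p + 1) mw.
have : (\int[mu]_x `|(`|w.1 x| `^ (p + 1))%:E| = 0)%E.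
  have -> : (\int[mu]_x `|(`|w.1 x| `^ (p + 1))%:E| = \int[mu]_x (`|w.1 x| `^ (p + 1))%:E)%E.
    by apply: eq_integral => x _; rewrite gee0_abs// lee_fin powR_ge0.
  apply/eqP; rewrite eq_le Lform_diagE// !lee_fin L0 Lform_diag.
  by apply: Rintegral_ge0 => x _; exact: powR_ge0.
move/(ae_eq_integral_abs mu measurableT (f := fun x => (`|w.1 x| `^ (p + 1))%:E)).
move=> /(_ (iffRL (measurable_EFinP _ _) mp)) ae0.
apply/eqP; apply: EFin_inj; rewrite -integral_sqrE//.
rewrite (_ : 0%:E = \int[mu]_x (cst 0%E x))%E; last by rewrite integral0.
apply: ae_eq_integral => //; first by apply/measurable_EFinP; exact: measurable_funX.
apply: filterS ae0 => x /(_ I) [] /powR_eq0_eq0 /normr0_eq0 w0 _.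
by rewrite /= w0 expr0n.
Qed.

Lemma energy_space_schrodinger : energy_space p Hspace Tform Mform Lform.
Proof.
split.
- exact: subspace_Hspace.
- exact: psd_Tform.
- exact: psd_Mform.
- move=> u v w Hu Hv Hw; rewrite -RintegralD//; [|exact: Lform_integrable..].
  by apply: eq_Rintegral => x _; rewrite -mulrDr.
- move=> c u v Hu Hv; rewrite /Lform scale1 -RintegralZl//; last exact: Lform_integrable.
  by apply: eq_Rintegral => x _; rewrite mulrCA.
- move=> c u v Hu Hv; rewrite /Lform scale1 -RintegralZl//; last exact: Lform_integrable.
  by apply: eq_Rintegral => x _; rewrite normrM powRM//; ring.
- exact: Lform_gt0.
- by move=> u Hu; rewrite Lform_diag; apply: Rintegral_ge0 => x _; exact: powR_ge0.
move=> u v Hu Hv; have iu := Hspace_powR_integrable Hu; have iv := Hspace_powR_integrable Hv.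
have iuv := Lform_integrable Hu Hv.
have ip_u : mu.-integrable setT (EFin \o (fun x => p * `|u.1 x| `^ (p + 1))).
  exact: (integrableZl measurableT p iu).
rewrite !Lform_diag -!RintegralZl// -RintegralD//.
apply: le_Rintegral => //.
- exact: (integrableZl measurableT (p + 1) iuv).
- exact: (integrableD measurableT ip_u iv).
by move=> x _; exact: powR_convex.
Qed.

Lemma Lform_le_Tform eps : 0 < eps -> exists2 C, 0 <= C &
  forall w, Hspace w -> Mform w w <= 1 -> Lform w w <= C * Mform w w + eps * Tform w w.
Proof.
move=> e0; have [C C0 HC] := gagliardo_nirenberg d1 q0 qd e0.
exists C => // w Hw w1; have [ug _] := Hw.
rewrite -lee_fin -Lform_diagE// -qp; apply: (le_trans (HC _ _ ug w1)).
by rewrite lee_fin lerD2l ler_pM2l// dirichlet_le_Tform.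
Qed.

Hypothesis Voo : forall M : R, exists r : R, forall x, r < `|x| -> M < V x.

Lemma Hspace_compact (w : nat -> W) C :
  (forall n, [/\ Hspace (w n), Mform (w n) (w n) <= C & Tform (w n) (w n) <= C]) ->
  exists sigma : nat -> nat, (forall k, (k <= sigma k)%N) /\
    forall eps, 0 < eps -> exists N, forall m n, (N <= m)%N -> (N <= n)%N ->
      Mform (w (sigma m) - w (sigma n)) (w (sigma m) - w (sigma n)) <= eps.
Proof.
move=> Hw; apply: (@compact_subsequence _ _ V V0 mV Voo (fun n => (w n).1) (fun n => grad (w n)) C).
- by move=> n; have [[]] := Hw n.
- by move=> n; have [] := Hw n.
- by move=> n; have [_ _] := Hw n; exact: le_trans (dirichlet_le_Tform _).
move=> n; have [[_ Vw] _ TC] := Hw n.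
have -> : (\int[mu]_x (V x * (w n).1 x ^+ 2)%:E = \int[mu]_x (weighted (w n).1 x ^+ 2)%:E)%E.
  by apply: eq_integral => x _; rewrite weighted_sqr.
rewrite integral_sqrE// lee_fin; apply: le_trans TC; rewrite lerDr.
exact: dirichlet_ge0.
Qed.

Lemma Tform_ge_grad w i : ip mu (grad w i) (grad w i) <= Tform w w.
Proof.
apply: le_trans (dirichlet_le_Tform _); rewrite /dirichlet (bigD1 i)//= lerDl.
by apply: sumr_ge0 => j _; exact: ip_ge0.
Qed.

Lemma Hspace_complete (w : nat -> W) : (forall n, Hspace (w n)) ->
  (forall eps, 0 < eps -> exists N, forall m n, (N <= m)%N -> (N <= n)%N ->
    Mform (w m - w n) (w m - w n) <= eps /\ Tform (w m - w n) (w m - w n) <= eps) ->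
  exists2 v, Hspace v & forall eps N, 0 < eps -> exists n, [/\ (N <= n)%N,
    Mform (v - w n) (v - w n) <= eps & Tform (v - w n) (v - w n) <= eps].
Proof.
move=> Hw cau.
have w2 n : L2fun mu (w n).1 by have [[]] := Hw n.
have g2 n i : L2fun mu (grad (w n) i) by have [[]] := Hw n.
have Vw2 n : L2fun mu (weighted (w n).1) by have [] := Hw n.
have [eps e0|u [k [u2 nk uk cvu]]] := L2_complete w2.
  by have [N HN] := cau eps e0; exists N => m n Nm Nn; have [] := HN m n Nm Nn.
have /choice[g Hg] : forall i, exists h, L2fun mu h /\ forall eps, 0 < eps -> exists N, forall n, (N <= n)%N ->
    ip mu (fun x => h x - grad (w n) i x) (fun x => h x - grad (w n) i x) <= eps.
  move=> i; have [eps e0|h [_ [h2 _ _ cvh]]] := L2_complete (g2^~ i); last by exists h.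
  have [N HN] := cau eps e0; exists N => m n Nm Nn; have [_ h] := HN m n Nm Nn.
  exact: le_trans (Tform_ge_grad (w m - w n) i) h.
have mu' : measurable_fun setT u by case: u2.
have Vn eps : 0 < eps -> exists N, forall n, (N <= n)%N ->
    (\int[mu]_x (weighted (fun x => u x - (w n).1 x) x ^+ 2)%:E <= eps%:E)%E.
  move=> e0; have [N HN] := cau eps e0; exists N => n Nn.
  pose D m (x : 'rV[R]_d) := weighted (fun x => (w m).1 x - (w n).1 x) x.
  apply: (@fatou_le _ _ _ _ (fun j (x : 'rV[R]_d) => (D (k (j + N)%N) x ^+ 2)%:E)).
  - move=> j; apply/measurable_EFinP; apply: measurable_funX; apply: measurable_weighted.
    by apply: measurable_funB; [case: (w2 (k (j + N)%N))|case: (w2 n)].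
  - apply/measurable_EFinP; apply: measurable_funX; apply: measurable_weighted.
    by apply: measurable_funB => //; case: (w2 n).
  - by move=> j x; rewrite lee_fin sqr_ge0.
  - by move=> x; rewrite lee_fin sqr_ge0.
  - apply: filterS uk => x cvx; apply: cvg_EFin; first exact: nearW.
    rewrite /D /weighted; apply: cvgM; apply: cvgM; try exact: cvg_cst.
      apply: cvgB; last exact: cvg_cst.
      by have := cvx; rewrite -(cvg_shiftn N).
    apply: cvgB; last exact: cvg_cst.
    by have := cvx; rewrite -(cvg_shiftn N).
  move=> j; have [|_ h] := HN (k (j + N)%N) n _ Nn.
    by rewrite (leq_trans _ (nk _))// leq_addl.
  have [_ D2] := subB subspace_Hspace (Hw (k (j + N)%N)) (Hw n).
  rewrite [leLHS](integral_sqrE D2) lee_fin; apply: le_trans h; rewrite lerDr.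
  exact: dirichlet_ge0.
have VB n : (\int[mu]_x (weighted (fun x => u x - (w n).1 x) x ^+ 2)%:E < +oo)%E ->
    L2fun mu (weighted (fun x => u x - (w n).1 x)).
  by split=> //; apply: measurable_weighted; apply: measurable_funB => //; case: (w2 n).
have Vu2 : L2fun mu (weighted u).
  have [N HN] := Vn 1 ltr01; have h := le_lt_trans (HN N (leqnn N)) (ltry 1).
  have := L2D (VB N h) (Vw2 N); rewrite -weightedD; congr (L2fun _ (weighted _)).
  by apply/funext => x; rewrite subrK.
have cv eps N : 0 < eps -> exists n, [/\ (N <= n)%N,
    ip mu (fun x => u x - (w n).1 x) (fun x => u x - (w n).1 x) <= eps,
    forall i, ip mu (fun x => g i x - grad (w n) i x) (fun x => g i x - grad (w n) i x) <= eps &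
    ip mu (weighted (fun x => u x - (w n).1 x)) (weighted (fun x => u x - (w n).1 x)) <= eps].
  move=> e0; have [N1 H1] := cvu eps e0; have [N2 H2] := Vn eps e0.
  have /choice[N3 H3] : forall i, exists N, forall n, (N <= n)%N ->
      ip mu (fun x => g i x - grad (w n) i x) (fun x => g i x - grad (w n) i x) <= eps.
    by move=> i; have [_ h] := Hg i; exact: h.
  pose n := maxn (maxn N N1) (maxn N2 (\max_i N3 i)).
  have /andP[/andP[n0 n1] /andP[n2 n3]] : ((N <= n) && (N1 <= n) && ((N2 <= n) && (\max_i N3 i <= n)))%N.
    by rewrite -!geq_max.
  exists n; split=> //; first exact: H1.
    by move=> i; apply: H3; apply: leq_trans n3; exact: leq_bigmax.
  have h := H2 n n2; have h2 := VB n (le_lt_trans h (ltry eps)).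
  by rewrite -lee_fin -integral_sqrE.
exists ((u, fun ix => g ix.1 ix.2) : W).
  split=> //; apply: (@sobolev_limit _ _ _ _ (fun n => (w n).1) (fun n => grad (w n))) => //.
  - by move=> n; have [] := Hw n.
  - by move=> i; have [] := Hg i.
  by move=> i eps e0; have [n [_ h1 h2 _]] := cv eps 0 e0; exists n.
move=> eps N e0; have e1 : 0 < eps / (d%:R + 1) by rewrite divr_gt0// ltr_wpDl.
have [n [Nn h1 h2 h3]] := cv _ N e1.
have le1 : eps / (d%:R + 1) <= eps.
  by rewrite ler_pdivrMr ?ltr_wpDl// ler_peMr ?(ltW e0)// lerDr.
exists n; split=> //; first exact: le_trans h1 le1.
apply: (@le_trans _ _ (\sum_(i < d) (eps / (d%:R + 1)) + eps / (d%:R + 1))).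
  by apply: lerD => //; apply: ler_sum => i _; exact: h2.
rewrite sumr_const card_ord -mulr_natl le_eqVlt; apply/orP; left; apply/eqP.
by field; rewrite gt_eqF// ltr_wpDl.
Qed.

Lemma exists_minimal_schrodinger c : 0 <= c -> (exists2 w, Hspace w & Mform w w = 1) ->
  exists w, minimal p Hspace Tform Mform Lform c w.
Proof.
apply: exists_minimal p1 energy_space_schrodinger _ _ _ _.
- exact: Lform_le_Tform.
- exact: Hspace_compact.
- exact: Hspace_complete.
Qed.

End schrodinger_energy.

Section bridge.
Context {R : realType} (d : nat).
Local Notation mu := (@vol R d).
Variables (p : R) (V : 'rV[R]_d -> R).
Hypotheses (d1 : (1 <= d)%N) (p1 : 1 < p) (pd : p < 1 + 4 / d%:R).
Hypotheses (V0 : forall x, 0 <= V x) (mV : measurable_fun setT V).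

Let W : lmodType R := (('rV[R]_d -> R) * ('I_d * 'rV[R]_d -> R))%type.
Implicit Types (w v : W) (u : 'rV[R]_d -> R) (g : 'I_d -> 'rV[R]_d -> R) (rho nu : R).

Local Notation HW := (@Hspace R d V).
Local Notation TW := (@Tform R d V).
Local Notation MW := (@Mform R d).
Local Notation LW := (@Lform R d p).

Let ES := energy_space_schrodinger V d1 p1 pd.
Let HH := subspace_Hspace V.

Lemma integrable_sum_ip (I : eqType) (s : seq I) (f h : I -> 'rV[R]_d -> R) :
  (forall i, L2fun mu (f i)) -> (forall i, L2fun mu (h i)) ->
  mu.-integrable setT (EFin \o (fun x => \sum_(i <- s) f i x * h i x)) /\
  Rintegral mu setT (fun x => \sum_(i <- s) f i x * h i x) = \sum_(i <- s) ip mu (f i) (h i).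
Proof.
move=> f2 h2; elim: s => [|i s [IH1 IH2]].
  rewrite big_nil; have -> : (fun x : 'rV[R]_d => \sum_(i <- [::]) f i x * h i x) = cst 0.
    by apply/funext => x; rewrite big_nil.
  by split; [exact: integrable0|rewrite Rintegral_cst// mul0r].
have -> : (fun x : 'rV[R]_d => \sum_(i <- i :: s) f i x * h i x) =
    (fun x => f i x * h i x + \sum_(i <- s) f i x * h i x).
  by apply/funext => x; rewrite big_cons.
have iM := L2M_integrable (f2 i) (h2 i).
split; first exact: (integrableD measurableT iM IH1).
by rewrite RintegralD// IH2 big_cons.
Qed.

Definition pack u g : W := (u, fun ix => g ix.1 ix.2).

Lemma HV_pack u g : HV V u g <-> HW (pack u g).
Proof. exact: (HspaceP V0 mV (pack u g)). Qed.

Lemma Int_sqr w : HW w -> Int (fun x => (w.1 x ^+ 2)%:E) = (MW w w)%:E.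
Proof.
move=> Hw; have mw := Hspace_measurable Hw; have [[w2 _ _] _] := Hw.
rewrite ge0_IntE ?integral_sqrE// => [x|]; first by rewrite lee_fin sqr_ge0.
by apply/measurable_EFinP; exact: measurable_funX.
Qed.

Lemma Int_powR w : HW w -> Int (fun x => (`|w.1 x| `^ (p + 1))%:E) = (LW w w)%:E.
Proof.
move=> Hw; have mw := Hspace_measurable Hw.
rewrite ge0_IntE ?(Lform_diagE d1 p1 pd Hw)//.
by apply/measurable_EFinP; exact: measurable_powRp.
Qed.

Lemma Int_sqgrad w : HW w -> Int (fun x => (sqgrad (grad w) x)%:E) = (dirichlet (grad w))%:E.
Proof.
move=> [[_ g2 _] _]; have [ig eg] := integrable_sum_ip (index_enum 'I_d) g2 g2.
have E : sqgrad (grad w) = (fun x => \sum_(i < d) grad w i x * grad w i x).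
  by apply/funext => x; apply: eq_bigr => i _; rewrite expr2.
rewrite ge0_IntE => [|x|].
- by rewrite E Rintegral_EFin// eg.
- by rewrite lee_fin sumr_ge0// => i _; rewrite sqr_ge0.
- by rewrite E; exact: (measurable_int mu).
Qed.

Lemma Int_potential w : HW w ->
  Int (fun x => (V x * w.1 x ^+ 2)%:E) = (ip mu (weighted V w.1) (weighted V w.1))%:E.
Proof.
move=> Hw; have mw := Hspace_measurable Hw; have [_ Vw] := Hw.
rewrite ge0_IntE => [|x|].
- rewrite -integral_sqrE//; apply: eq_integral => x _; by rewrite weighted_sqr.
- by rewrite lee_fin mulr_ge0 ?sqr_ge0.
- by apply/measurable_EFinP; apply: measurable_funM => //; exact: measurable_funX.
Qed.

Lemma Erho_energy rho w : HW w ->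
  Erho V p rho w.1 (grad w) = (energy p TW LW (rho `^ (p - 1)) w)%:E.
Proof.
move=> Hw; rewrite /Erho Int_sqgrad// Int_potential// Int_powR// -!EFinM -EFinD.
by congr (_%:E); rewrite /energy /Tform -/(dirichlet (grad w)); ring.
Qed.

Lemma Fmurho_action nu rho w : HW w ->
  Fmurho V p nu rho w.1 (grad w) = (action p TW MW LW (rho `^ (p - 1)) nu w)%:E.
Proof.
move=> Hw; rewrite /Fmurho Int_sqgrad// Int_potential// Int_powR// Int_sqr// -!EFinM -EFinD.
by congr (_%:E); rewrite /action /Tform -/(dirichlet (grad w)); ring.
Qed.

Lemma Ints_critical nu (c : R) w v : HW w -> HW v ->
  Ints (fun x => \sum_(i < d) grad w i x * grad v i x + (V x - nu) * w.1 x * v.1 x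
                 - c * (`|w.1 x| `^ (p - 1) * w.1 x) * v.1 x)
  = (TW w v - nu * MW w v - c * LW w v)%:E.
Proof.
move=> Hw Hv; have [[w2 gw2 _] Vw2] := Hw; have [[v2 gv2 _] Vv2] := Hv.
have [i1 e1] := integrable_sum_ip (index_enum 'I_d) gw2 gv2.
have i2 := L2M_integrable Vw2 Vv2.
have i3 := integrableZl measurableT nu (L2M_integrable w2 v2).
have i4 := integrableZl measurableT c (Lform_integrable d1 p1 pd Hw Hv).
pose f1 x := \sum_(i < d) grad w i x * grad v i x.
pose f2 x := weighted V w.1 x * weighted V v.1 x.
pose f3 x := nu * (w.1 x * v.1 x).
pose f4 x := c * (`|w.1 x| `^ (p - 1) * w.1 x * v.1 x).
rewrite (_ : (fun x => _) = (fun x => f1 x + f2 x - f3 x - f4 x)); last first.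
  apply/funext => x; rewrite -/(f1 x) /f2 /f3 /f4 /weighted.
  have := sqr_sqrtr (V0 x); move: (f1 x) (Num.sqrt (V x)) => a b <-; ring.
have i12 := integrableD measurableT i1 i2.
have i123 := integrableB measurableT i12 i3.
have i1234 := integrableB measurableT i123 i4.
rewrite IntsE; last by apply/measurable_EFinP; exact: (measurable_int mu i1234).
rewrite Rintegral_EFin//; congr (_%:E).
rewrite (RintegralB measurableT i123 i4) (RintegralB measurableT i12 i3).
rewrite (RintegralD measurableT i1 i2) e1 (RintegralZl nu measurableT (L2M_integrable w2 v2)).
by rewrite (RintegralZl c measurableT (Lform_integrable d1 p1 pd Hw Hv)).
Qed.

Lemma minimizerP rho u : minimizer V p rho u <->
  exists2 w, minimal p HW TW MW LW (rho `^ (p - 1)) w & w.1 = u.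
Proof.
split=> [[g [/HV_pack Hw u1 umin]]|[w [Hw w1 wmin] <-]].
  exists (pack u g) => //; split=> // [|v Hv v1].
    by apply: EFin_inj; rewrite -Int_sqr.
  rewrite -lee_fin -!Erho_energy//; apply: umin; first exact/HspaceP.
  by rewrite Int_sqr// v1.
exists (grad w); split; [exact/HspaceP|by rewrite Int_sqr// w1|].
move=> v h /HV_pack Hv; rewrite (Int_sqr Hv) => -[v1].
rewrite Erho_energy// [leRHS](Erho_energy rho Hv) lee_fin; exact: wmin.
Qed.

Lemma weak_solP nu rho u : weak_sol V p nu rho u <->
  exists2 w, critical HW TW MW LW (rho `^ (p - 1)) nu w & w.1 = u.
Proof.
split=> [[g [/HV_pack Hw u0 ucrit]]|[w [Hw w0 wcrit] <-]].
  exists (pack u g) => //; split=> // [|v Hv].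
    by move: u0; rewrite (Int_sqr Hw); apply: contra_neq => ->.
  have := ucrit v.1 (grad v) (iffRL (HspaceP V0 mV v) Hv).
  rewrite (Ints_critical nu (rho `^ (p - 1)) Hw Hv) => -[]; lra.
exists (grad w); split; [exact/HspaceP|by rewrite Int_sqr//; apply: contra_neq w0 => -[]|].
move=> phi h /HV_pack Hv; rewrite (Ints_critical nu (rho `^ (p - 1)) Hw Hv).
by rewrite wcrit// subrr.
Qed.

(* Critical points are tested against [(0, k)] with [k] the difference of two
   weak gradients, so the uniqueness of weak gradients is not required. *)
Lemma critical_action_le c nu w v : critical HW TW MW LW c nu w -> HW v -> v.1 = w.1 ->
  action p TW MW LW c nu w <= action p TW MW LW c nu v.
Proof.
move=> [Hw _ wcrit] Hv e; have Hz := subB HH Hv Hw.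
have z0 x : (v - w).1 x = 0.
  by rewrite (_ : (v - w).1 x = v.1 x - w.1 x)// e subrr.
have M0 (u : W) : MW u (v - w) = 0.
  by rewrite /Mform /ip; under eq_Rintegral => x _ do rewrite z0 mulr0; rewrite Rintegral_cst// mul0r.
have L0 (u : W) : LW u (v - w) = 0.
  by rewrite /Lform; under eq_Rintegral => x _ do rewrite z0 mulr0; rewrite Rintegral_cst// mul0r.
have T0 : TW w (v - w) = 0 by have := wcrit _ Hz; rewrite M0 L0 !mulr0 subr0.
have vE : v = w + (v - w) by rewrite addrC subrK.
have Tv : TW v v = TW w w + TW (v - w) (v - w).
  by rewrite {1 2}vE (psdD HH (es_T ES) Hw Hz) T0; ring.
have Mv : MW v v = MW w w by rewrite /Mform e.
have Lv : LW v v = LW w w by rewrite /Lform e.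
rewrite /action Mv Lv Tv; have := psd_ge0 (es_T ES) Hz; lra.
Qed.

Lemma ground_state_minimizer nu rho u u0 : 0 < rho ->
  minimizer V p rho u0 ->
  (forall w, minimal p HW TW MW LW (rho `^ (p - 1)) w ->
    critical HW TW MW LW (rho `^ (p - 1)) nu w) ->
  ground_state V p nu rho u <-> minimizer V p rho u.
Proof.
move=> rho0 /minimizerP[w0 m0 _] mc; have c0 : 0 < rho `^ (p - 1) by exact: powR_gt0.
split=> [[/weak_solP[w wc wu] [g [/HV_pack Hg gle]]]|].
  apply/minimizerP; exists w => //; apply: (critical_minimal p1 ES c0 m0 wc).
  apply: le_trans (critical_action_le wc Hg _) _; first by rewrite wu.
  have [Hw0 _ _] := m0.
  rewrite -lee_fin -(Fmurho_action nu rho Hg) -(Fmurho_action nu rho Hw0).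
  by apply: gle; [apply/weak_solP; exists w0 => //; exact: mc|exact/HspaceP].
move=> /minimizerP[w wm <-]; have wc := mc _ wm; have [Hw _ _] := wm.
split; first by apply/weak_solP; exists w.
exists (grad w); split; first exact/HspaceP.
move=> v h /weak_solP[z zc zv] /HV_pack Hv.
rewrite (Fmurho_action nu rho Hw) [leRHS](Fmurho_action nu rho Hv) lee_fin.
apply: le_trans (minimal_action_le p1 ES c0 wm zc) _.
by apply: (critical_action_le zc Hv); rewrite zv.
Qed.

End bridge.

Theorem theorem1p1 (R : realType) (d : nat) (p alpha : R) (V : 'rV[R]_d -> R) :
  (1 <= d)%N ->
  1 < p -> p < 1 + 4 / d%:R ->
  0 < alpha -> alpha < 1 ->
  (forall x, 0 <= V x) ->
  Linf_loc V ->
  holder_loc alpha V ->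
  (forall eps : R, 0 < eps -> exists x, V x < eps) ->
  (forall M : R, exists r : R, forall x, r < `|x| -> M < V x) ->
  exists N : set R, [/\ measurable N, (@lebesgue_measure R N = 0)%E &
    forall rho : R, 0 < rho -> ~ N rho ->
      exists mu : R,
        (forall u, minimizer V p rho u -> weak_sol V p mu rho u) /\
        (forall u, ground_state V p mu rho u <-> minimizer V p rho u)].
Proof.
move=> d1 p1 pd _ _ V0 VL _ _ Voo.
have mV : measurable_fun setT V by apply/rmeasE; case: VL.
have ES := energy_space_schrodinger V d1 p1 pd.
have c0 (rho : R) : 0 < rho -> 0 < rho `^ (p - 1) by exact: powR_gt0.
pose Min (rho : R) := minimal p (Hspace V) (Tform V) (@Mform R d) (@Lform R d p) (rho `^ (p - 1)).
pose N := [set rho : R | 0 < rho /\ exists w1 w2, [/\ Min rho w1, Min rho w2 &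
  Lform p w1 w1 < Lform p w2 w2]].
have N_countable : countable N.
  have /choice[f Hf] : forall rho, exists ab : R * R, N rho -> ab.1 < ab.2 /\
      exists w1 w2, [/\ Min rho w1, Min rho w2, ab.1 = Lform p w1 w1 & ab.2 = Lform p w2 w2].
    move=> rho; have [[rho0 [w1 [w2 [m1 m2 lt12]]]]|nN] := pselect (N rho); last by exists (0, 0).
    by exists (Lform p w1 w1, Lform p w2 w2) => _; split=> //; exists w1, w2.
  apply: (@countable_gaps _ N (fun x => (f x).1) (fun x => (f x).2)) => [x Nx|x y Nx Ny xy].
    by have [] := Hf x Nx.
  have [_ [_ [w2 [_ m2 _ ->]]]] := Hf x Nx; have [_ [w1 [_ [m1 _ -> _]]]] := Hf y Ny.
  apply: (minimal_L_le p1 _ m2 m1); have [x0 _] := Nx; have [y0 _] := Ny.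
  by apply: gt0_ltr_powR => //; rewrite ?subr_gt0// ?nnegrE ltW.
exists N; split.
- by apply: countable_measurable => //; exact: measurable_set1.
- exact: countable_lebesgue_measure0.
move=> rho rho0 Nrho; have cr := c0 rho rho0.
have [[w0 m0]|nomin] := pselect (exists w, Min rho w); last first.
  exists 0; have nmin u : ~ minimizer V p rho u.
    by move=> /(minimizerP d1 p1 pd V0 mV)[w wm _]; apply: nomin; exists w.
  split=> [u /nmin//|u]; split=> [[/(weak_solP d1 p1 pd V0 mV)[w [Hw w1 _] _] _]|/nmin//].
  exfalso; apply: nomin; apply: exists_minimal_schrodinger => //; first exact: ltW.
  have [] := normalizeP ES Hw _; first by rewrite lt_def w1 (psd_ge0 (es_M ES)).
  by move=> Hn n1; eexists; [exact: Hn|exact: n1].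
have mc w : Min rho w -> critical (Hspace V) (Tform V) (@Mform R d) (@Lform R d p)
    (rho `^ (p - 1)) (Tform V w0 w0 - rho `^ (p - 1) * Lform p w0 w0) w.
  move=> wm; have := euler_lagrange p1 ES (ltW cr) wm.
  have Le : Lform p w w = Lform p w0 w0.
    apply/eqP; apply: contrapT => /negP; rewrite neq_lt => /orP[lt|lt]; apply: Nrho.
      by split=> //; exists w, w0.
    by split=> //; exists w0, w.
  have := minimal_energy_eq wm m0; rewrite /energy Le => e.
  suff -> : Tform V w w = Tform V w0 w0 by [].
  lra.
exists (Tform V w0 w0 - rho `^ (p - 1) * Lform p w0 w0); split=> u.
  by move=> /(minimizerP d1 p1 pd V0 mV)[w wm <-]; apply/(weak_solP d1 p1 pd V0 mV); exists w => //; exact: mc.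
have mw0 : minimizer V p rho w0.1 by apply/(minimizerP d1 p1 pd V0 mV); exists w0.
exact: (ground_state_minimizer d1 p1 pd V0 mV u rho0 mw0 mc).
Qed.
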